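(* Let $K$ be a field, $E$ a directed graph and $L=L_K(E)$. The following are equivalent. (1) Every proper ideal of $L$ is a product of (finitely many) prime ideals. (2) There are only finitely many prime ideals minimal over any proper non-prime ideal of $L$. (3) Every proper homomorphic image of $L$ is either a prime ring or possesses only a finite number of minimal prime ideals. (4) For every admissible pair $(H,S)$ with $H\ne E^0$, $(E\setminus(H,S))^0$ is the irredundant union of $n>0$ maximal tails, and there are at most $n$ cycles without exits in $E\setminus(H,S)$.
   Context: Graphs: $E=(E^0,E^1,r,s)$ with $E^0\neq\emptyset$, $r,s:E^1\to E^0$, no cardinality restrictions. A path is a finite sequence $e_1\cdots e_n$ of edges with $r(e_i)=s(e_{i+1})$ (vertices are paths of length 0). A cycle is a path with $r(e_n)=s(e_1)$ and $s(e_i)\ne s(e_j)$ for $i\ne j$ (cycles are distinguished by their sets of edges); an exit of $e_1\cdots e_n$ is an edge $f\notin\{e_1,\dots,e_n\}$ with $s(f)=s(e_i)$ for some $i$. A vertex $v$ is regular if $s^{-1}(v)$ is finite nonempty, an infinite emitter if $s^{-1}(v)$ is infinite. $u\ge v$ means there is a path from $u$ to $v$. $H\subseteq E^0$ is hereditary if $u\in H$, $u\ge v$ imply $v\in H$; saturated if every regular $v$ with $r(s^{-1}(v))\subseteq H$ lies in $H$. For a graph $F$, a nonempty $M\subseteq F^0$ is a maximal tail if (MT1) $v\in M$, $u\ge v$ imply $u\in M$; (MT2) every regular $v\in M$ emits an edge $e$ with $r(e)\in M$; (MT3) for all $u,v\in M$ there is $w\in M$ with $u\ge w$, $v\ge w$.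 A union is irredundant if no member is contained in the union of the others. The Leavitt path algebra $L_K(E)$ is generated by $\{v:v\in E^0\}\cup\{e,e^*:e\in E^1\}$ with relations $vw=\delta_{v,w}v$; $s(e)e=er(e)=e$; $r(e)e^*=e^*s(e)=e^*$; $e^*f=\delta_{e,f}r(e)$; $v=\sum_{e\in s^{-1}(v)}ee^*$ for regular $v$. For hereditary saturated $H$, $B_H$ is the set of infinite emitters $w\notin H$ with $0<|s^{-1}(w)\cap r^{-1}(E^0\setminus H)|<\infty$. An admissible pair is $(H,S)$ with $H$ hereditary saturated and $S\subseteq B_H$. The quotient graph $E\setminus(H,S)$ has vertices $(E^0\setminus H)\cup\{v':v\in B_H\setminus S\}$ and edges $\{e\in E^1:r(e)\notin H\}\cup\{e':e\in E^1,\ r(e)\in B_H\setminus S\}$ with $s(e')=s(e)$, $r(e')=r(e)'$. A proper ideal $P$ (ideals are two-sided) is prime if $AB\subseteq P$ for ideals $A,B$ implies $A\subseteq P$ or $B\subseteq P$; a ring is prime if its zero ideal is prime. *)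

(* Defs.v *)
From HB Require Import structures.
From mathcomp Require Import all_boot all_algebra.
From mathcomp Require Import generic_quotient ring_quotient.
From mathcomp.multinomials Require Import monalg.
From Stdlib Require Import ClassicalEpsilon.
From Stdlib Require List.

Set Implicit Arguments.
Unset Strict Implicit.
Unset Printing Implicit Defensive.

Import GRing.Theory.
Local Open Scope ring_scope.
Local Open Scope quotient_scope.

Definition decP (P : Prop) : bool :=
  if excluded_middle_informative P then true else false.

Lemma decPE (P : Prop) : decP P = true <-> P.
Proof. by rewrite /decP; case: excluded_middle_informative. Qed.

(* A (possibly non-unital) ring is represented as a subset S of a    *)
(* ring B (closed under the ring operations); every non-unital ring   *)
(* arises this way (e.g. inside its Dorroh unitization).  All notions *)
(* below are relative to S: ideals of S, products of ideals of S, ... *)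
Section IdealTheory.
Variables (B : pzRingType) (S : B -> Prop).

Definition set_incl (X Y : B -> Prop) : Prop := forall x, X x -> Y x.
Definition seteq (X Y : B -> Prop) : Prop := forall x, X x <-> Y x.

Definition is_ideal (I : B -> Prop) : Prop :=
  [/\ set_incl I S, I 0,
      (forall x y, I x -> I y -> I (x - y)) &
      (forall a x, S a -> I x -> I (a * x) /\ I (x * a))].

Definition proper_ideal_of (I : B -> Prop) : Prop :=
  is_ideal I /\ exists x, S x /\ ~ I x.

Definition idprod (I1 I2 : B -> Prop) : B -> Prop := fun x =>
  exists l : seq (B * B)%type,
    (forall p, List.In p l -> I1 p.1 /\ I2 p.2) /\
    x = \sum_(p <- l) p.1 * p.2.

Fixpoint idprodl (l : seq (B -> Prop)) : B -> Prop :=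
  match l with
  | [::] => S
  | P :: l' => match l' with
               | [::] => P
               | _ => idprod P (idprodl l')
               end
  end.

Definition is_prime (P : B -> Prop) : Prop :=
  proper_ideal_of P /\
  forall I1 I2, is_ideal I1 -> is_ideal I2 ->
    set_incl (idprod I1 I2) P -> set_incl I1 P \/ set_incl I2 P.

Definition min_prime_over (I P : B -> Prop) : Prop :=
  [/\ is_prime P, set_incl I P &
      forall Q, is_prime Q -> set_incl I Q -> set_incl Q P -> set_incl P Q].

Definition finite_family (X : (B -> Prop) -> Prop) : Prop :=
  exists l : seq (B -> Prop),
    forall P, X P -> List.Exists (fun Q => seteq P Q) l.

Definition zero_ideal : B -> Prop := fun x => x = 0.

Definition prime_ring : Prop := is_prime zero_ideal.

Definition minimal_prime (P : B -> Prop) : Prop := min_prime_over zero_ideal P.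

End IdealTheory.

Definition ring_hom_on (B B' : pzRingType) (S : B -> Prop) (f : B -> B') :=
  forall x y, S x -> S y -> f (x + y) = f x + f y /\ f (x * y) = f x * f y.

Definition image_of (B B' : pzRingType) (S : B -> Prop) (f : B -> B') : B' -> Prop :=
  fun y => exists2 x, S x & y = f x.

(* Part 2. Graphs (with vertex / edge subsets, so that quotient graphs *)
(* can be described inside a sum type).                                *)
Record pgraph := PGraph {
  pV : Type; pE : Type;
  pvin : pV -> Prop;
  pein : pE -> Prop;
  psrc : pE -> pV; prng : pE -> pV }.

Section GraphTheory.
Variable G : pgraph.
Local Notation V := (pV G).
Local Notation Ed := (pE G).

Definition emits_finitely (v : V) : Prop :=
  exists l : seq Ed, forall e, pein e -> psrc e = v -> List.In e l.

Definition regular (v : V) : Prop :=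
  emits_finitely v /\ exists e, pein e /\ psrc e = v.

Definition infinite_emitter (v : V) : Prop := ~ emits_finitely v.

Fixpoint path_from (u : V) (p : seq Ed) (v : V) : Prop :=
  match p with
  | [::] => u = v
  | e :: p' => [/\ pein e, psrc e = u & path_from (prng e) p' v]
  end.

Definition reaches (u v : V) : Prop := exists p, path_from u p v.

Definition hereditary (H : V -> Prop) : Prop :=
  forall u v, H u -> reaches u v -> H v.

Definition saturated (H : V -> Prop) : Prop :=
  forall v, pvin v -> regular v ->
    (forall e, pein e -> psrc e = v -> H (prng e)) -> H v.

Definition breaking_vertex (H : V -> Prop) (w : V) : Prop :=
  [/\ pvin w, infinite_emitter w, ~ H w,
      (exists l : seq Ed, forall e, pein e -> psrc e = w -> ~ H (prng e) ->
                                   List.In e l) &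
      (exists e, [/\ pein e, psrc e = w & ~ H (prng e)])].

Definition admissible_pair (H S : V -> Prop) : Prop :=
  [/\ hereditary H, saturated H & forall w, S w -> breaking_vertex H w].

Definition maximal_tail (M : V -> Prop) : Prop :=
  [/\ (exists v, M v), (forall v, M v -> pvin v),
      (* MT1 *) (forall u v, pvin u -> M v -> reaches u v -> M u),
      (* MT2 *) (forall v, M v -> regular v ->
                   exists e, [/\ pein e, psrc e = v & M (prng e)]) &
      (* MT3 *) (forall u v, M u -> M v ->
                   exists w, [/\ M w, reaches u w & reaches v w])].

Definition is_cycle (c : seq Ed) : Prop :=
  exists e c', [/\ c = e :: c', path_from (psrc e) c (psrc e) &
               List.NoDup (map (@psrc G) c)].

Definition is_exit (c : seq Ed) (f : Ed) : Prop :=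
  [/\ pein f, ~ List.In f c & exists e, List.In e c /\ psrc f = psrc e].

Definition cycle_without_exits (c : seq Ed) : Prop :=
  is_cycle c /\ forall f, ~ is_exit c f.

Definition irredundant_mt_union (n : nat) (M : nat -> V -> Prop) : Prop :=
  [/\ forall i, (i < n)%N -> maximal_tail (M i),
      forall v, pvin v <-> exists2 i, (i < n)%N & M i v &
      forall i, (i < n)%N -> exists v, M i v /\
         forall j, (j < n)%N -> j <> i -> ~ M j v].

(* there are at most n cycles without exits (cycles being identified
   with their sets of edges) *)
Definition at_most_n_exitless_cycles (n : nat) : Prop :=
  exists l : seq (Ed -> Prop), (size l <= n)%N /\
    forall c, cycle_without_exits c ->
      List.Exists (fun X => forall e, X e <-> List.In e c) l.

End GraphTheory.

Section ConcreteGraph.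
Variables (V Ed : Type) (s r : Ed -> V).

Definition fullgraph : pgraph := PGraph (fun _ : V => True) (fun _ : Ed => True) s r.

(* E \ (H,S): vertices inl v (v notin H) and inr v = v' (v in B_H \ S);
   edges inl e (r e notin H) and inr e = e' (r e in B_H \ S),
   s(e') = s(e), r(e') = r(e)'. *)
Definition quotient_graph (H S : V -> Prop) : pgraph :=
  @PGraph (V + V)%type (Ed + Ed)%type
    (fun x => match x with
              | inl v => ~ H v
              | inr v => breaking_vertex (G := fullgraph) H v /\ ~ S v end)
    (fun x => match x with
              | inl e => ~ H (r e)
              | inr e => breaking_vertex (G := fullgraph) H (r e) /\ ~ S (r e) end)
    (fun x => match x with inl e => inl (s e) | inr e => inl (s e) end)
    (fun x => match x with inl e => inl (r e) | inr e => inr (r e) end).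

End ConcreteGraph.

(* Let X = E^0 + E^1 + (E^1)^* be the set of generators and            *)
(* F = K<X> the free unital K-algebra (monoid algebra of the free      *)
(* monoid on X).  Let J be the two-sided ideal of F generated by the   *)
(* Leavitt relations and A = F / J.  L_K(E) is the (in general         *)
(* non-unital) subalgebra of A generated by the images of the          *)
(* generators, i.e. the image of the augmentation ideal of F (the      *)
(* K-span of the nonempty words).  Since all relations lie in the      *)
(* augmentation ideal, this is exactly the K-algebra presented by the  *)
(* generators and relations of L_K(E).                                 *)
Section LPA.
Variables (K : fieldType) (V Ed : choiceType) (s r : Ed -> V).

Definition gen := ((V + Ed) + Ed)%type.
Local Notation freealg := {malg K[fmonom gen]}.

Definition gv (v : V) : freealg := << fmu (inl (inl v) : gen) >>.
Definition ge (e : Ed) : freealg := << fmu (inl (inr e) : gen) >>.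
Definition gs (e : Ed) : freealg := << fmu (inr e : gen) >>.

Definition leavitt_rel (x : freealg) : Prop :=
  (exists v w : V, x = gv v * gv w - (if v == w then gv v else 0)) \/
  (exists e : Ed, x = gv (s e) * ge e - ge e) \/
  (exists e : Ed, x = ge e * gv (r e) - ge e) \/
  (exists e : Ed, x = gv (r e) * gs e - gs e) \/
  (exists e : Ed, x = gs e * gv (s e) - gs e) \/
  (exists e f : Ed, x = gs e * ge f - (if e == f then gv (r e) else 0)) \/
  (exists (v : V) (l : seq Ed),
      [/\ l != [::], uniq l, (forall e, s e = v <-> e \in l) &
          x = gv v - \sum_(e <- l) ge e * gs e]).

Definition relideal (x : freealg) : Prop :=
  exists l : seq ((freealg * freealg) * freealg)%type,
    (forall t, List.In t l -> leavitt_rel t.1.2) /\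
    x = \sum_(t <- l) t.1.1 * t.1.2 * t.2.

Definition relidealb : pred freealg := fun x => decP (relideal x).

Lemma relidealbP x : relidealb x <-> relideal x.
Proof. exact: decPE. Qed.

Lemma relideal0 : relidealb 0.
Proof. by apply/relidealbP; exists [::]; split => //; rewrite big_nil. Qed.

Lemma relidealB x y : relidealb x -> relidealb y -> relidealb (x - y).
Proof.
move=> /relidealbP [l1 [H1 ->]] /relidealbP [l2 [H2 ->]]; apply/relidealbP.
exists (l1 ++ map (fun t => (- t.1.1, t.1.2, t.2)) l2); split.
  move=> t Ht; case: (List.in_app_or _ _ _ Ht); first exact: H1.
  by case/List.in_map_iff => t' [<- /H2].
rewrite big_cat big_map /= -sumrN; congr (_ + _).
by apply: eq_bigr => t _; rewrite !mulNr.
Qed.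

Lemma relidealMl a x : relidealb x -> relidealb (a * x).
Proof.
move=> /relidealbP [l [Hl ->]]; apply/relidealbP.
exists (map (fun t => (a * t.1.1, t.1.2, t.2)) l); split.
  by move=> t; case/List.in_map_iff => t' [<- /Hl].
by rewrite big_map mulr_sumr; apply: eq_bigr => t _; rewrite !mulrA.
Qed.

Lemma relidealMr a x : relidealb x -> relidealb (x * a).
Proof.
move=> /relidealbP [l [Hl ->]]; apply/relidealbP.
exists (map (fun t => (t.1.1, t.1.2, t.2 * a)) l); split.
  by move=> t; case/List.in_map_iff => t' [<- /Hl].
by rewrite big_map mulr_suml; apply: eq_bigr => t _; rewrite !mulrA.
Qed.

Lemma relideal_zmod_closed : zmod_closed relidealb.
Proof. split; [exact: relideal0 | exact: relidealB]. Qed.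

HB.instance Definition _ :=
  GRing.isZmodClosed.Build freealg relidealb relideal_zmod_closed.

Definition relidealZ := GRing.ZmodClosed.clone freealg relidealb _.
Definition lpa_amb := Quotient.quot relidealZ.
HB.instance Definition _ := Choice.on lpa_amb.
HB.instance Definition _ := GRing.Zmodule.on lpa_amb.

Definition lpa_one : lpa_amb := lift_cst lpa_amb 1.
Definition lpa_mul := lift_op2 lpa_amb *%R.

Canonical lpa_one_morph := PiConst lpa_one.

Lemma lpa_pi_mul : {morph \pi_lpa_amb : x y / x * y >-> lpa_mul x y}.
Proof.
move=> x y; unlock lpa_mul; apply/eqP; rewrite piE Quotient.equivE.
set x' := repr (\pi_lpa_amb x); set y' := repr (\pi_lpa_amb y).
have hx : x - x' \in relidealZ by rewrite Quotient.idealrBE reprK.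
have hy : y - y' \in relidealZ by rewrite Quotient.idealrBE reprK.
have -> : x * y - x' * y' = x * (y - y') + (x - x') * y'.
  by rewrite mulrBr mulrBl addrA subrK.
apply: rpredD; [exact: relidealMl | exact: relidealMr].
Qed.
Canonical lpa_pi_mul_morph := PiMorph2 lpa_pi_mul.

Lemma lpa_mulA : associative lpa_mul.
Proof. by move=> x y z; rewrite -[x]reprK -[y]reprK -[z]reprK !piE mulrA. Qed.

Lemma lpa_mul1 : left_id lpa_one lpa_mul.
Proof. by move=> x; rewrite -[x]reprK !piE mul1r. Qed.

Lemma lpa_mulr1 : right_id lpa_one lpa_mul.
Proof. by move=> x; rewrite -[x]reprK !piE mulr1. Qed.

Lemma lpa_mulDl : left_distributive lpa_mul +%R.
Proof.
move=> x y z; rewrite -[x]reprK -[y]reprK -[z]reprK.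
by apply/eqP; rewrite piE /= mulrDl Quotient.equivE subrr rpred0.
Qed.

Lemma lpa_mulDr : right_distributive lpa_mul +%R.
Proof.
move=> x y z; rewrite -[x]reprK -[y]reprK -[z]reprK.
by apply/eqP; rewrite piE /= mulrDr Quotient.equivE subrr rpred0.
Qed.

HB.instance Definition _ := GRing.Zmodule_isPzRing.Build lpa_amb
  lpa_mulA lpa_mul1 lpa_mulr1 lpa_mulDl lpa_mulDr.

Definition LPA : lpa_amb -> Prop :=
  fun a => exists2 x : freealg, x@_(@fmone gen) = 0 & a = \pi_lpa_amb x.

End LPA.

(* Main.v *)
(** Every ideal I of L has an admissible pair (H, S), and L/I carries a
    Leavitt family of the quotient graph Q = E \ (H, S) with all vertices
    nonzero.  By the reduction theorem, every nonzero element of L/I can be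
    multiplied by paths and ghost paths into a nonzero multiple of a vertex or a
    nonzero polynomial in a cycle without exits.

    A prime containing a product contains one of the factors, so the primes
    minimal over a product of primes are among the factors.

    For (H, S) admissible, the action on functions on the boundary paths of Q
    gives an ideal whose quotient keeps every vertex of Q nonzero.  Each vertex
    is avoided by a minimal prime over that ideal (Zorn), and the vertices
    outside a prime form a maximal tail; finitely many minimal primes therefore
    give finitely many maximal tails covering Q.  Two cycles without exits in the
    same tail coincide.

    Conversely, given maximal tails M_1, ..., M_n, attach to M_i one prime
    avoiding M_i, or, when M_i contains a cycle c without exits, one prime for
    each irreducible factor of the generator of the ideal of polynomials f with
    f(c) in I.  By reduction the product of these primes lies in I.  For the
    other inclusion, I is generated by vertices, by the gap elements of S and by
    polynomials in exitless cycles (reduction modulo the ideal J they generate);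
    irredundancy puts the base vertex of a cycle of M_i into all primes attached
    to the other tails, so these generators lie in the product. *)

Require Import Defs.
From HB Require Import structures.
From mathcomp Require Import all_boot all_algebra.
From mathcomp Require Import generic_quotient ring_quotient.
From mathcomp.multinomials Require Import monalg.
From mathcomp Require Import zify.
From mathcomp Require Import boolp classical_sets.
From Stdlib Require List.

Set Implicit Arguments.
Unset Strict Implicit.
Unset Printing Implicit Defensive.

Import GRing.Theory.
Local Open Scope ring_scope.

(** * Ideals and primes of rings without unit *)

(** An ideal [I] need not be generated by vertices and gap elements, so [L/I] is in general not the
    Leavitt path algebra of its quotient graph [Q]. The structural results are therefore stated for
    a [leavitt_family] in an arbitrary ring, which asks only for the relations and for the right
    vertices to be nonzero. One graph [Q] can then serve two rings, [L/I] and [L/J], and the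
    reduction theorem is used in both. The corner at a cyclic vertex is the image of K[x,1/x] under
    evaluation at the loop: evaluation is injective, or its kernel is generated by a polynomial
    prime to x. The primes used come from 0 in the first case and from irreducible factors in the
    second, so [prime_poly] admits 0 and excludes divisors of ['X]. Factors keep their multiplicity,
    because their product itself has to vanish at the loop. [L] has no unit in general. Scalars live
    in the ambient unital ring, and finite sums of vertices, acting as local units, make the ideals
    of [L] stable under them. *)

Lemma zorn_above (T : Type) (P : (T -> Prop) -> Prop) (X0 : T -> Prop) :
  P X0 ->
  (forall F : (T -> Prop) -> Prop,
     (exists X, F X) -> (forall X, F X -> P X) ->
     (forall X Y, F X -> F Y -> (forall x, X x -> Y x) \/ (forall x, Y x -> X x)) ->
     P (fun x => exists2 X, F X & X x)) ->
  exists M, [/\ P M, forall x, X0 x -> M x &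
    forall Y, P Y -> (forall x, M x -> Y x) -> forall x, Y x -> M x].
Proof.
move=> PX0 chain.
(* [Zorn_bigcup] also feeds the empty chain to its hypothesis. Joining [X0] to every set turns the
   empty union into [X0], for which [P] is known. *)
pose P' (X : set T) := P (fun x => X x \/ X0 x).
have [|A [PA Amax]] := @Zorn_bigcup T P'.
  move=> F FP Ftot; rewrite /P'.
  have [[X FX]|Fno] := pselect (exists X, F X); last first.
    suff -> : (fun x => (\bigcup_(X in F) X)%classic x \/ X0 x) = X0 by [].
    apply/funext => x; apply/propext; split; last by right.
    by case=> // -[X FX]; case: Fno; exists X.
  pose F' Y := exists2 X, F X & Y = (fun x => X x \/ X0 x).
  suff -> : (fun x => (\bigcup_(X in F) X)%classic x \/ X0 x) =
            (fun x => exists2 X, F' X & X x).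
    apply: chain; first by eexists; exists X.
      by move=> _ [Y FY ->]; apply: FP.
    move=> _ _ [Y FY ->] [Z FZ ->]; case: (Ftot _ _ FY FZ) => YZ; [left|right];
      by move=> x [/YZ|]; [left|right].
  apply/funext => x; apply/propext; split.
    case=> [[Y FY Yx]|X0x]; first by exists (fun x => Y x \/ X0 x); [exists Y|left].
    by exists (fun x => X x \/ X0 x); [exists X|right].
  by case=> _ [Y FY ->] [Yx|]; [left; exists Y|right].
exists (fun x => A x \/ X0 x); split => //; first by right.
move=> Y PY AY x Yx; apply: contrapT => nAx.
have YX0 : (fun x => Y x \/ X0 x) = Y.
  by apply/funext => z; apply/propext; split; [case=> // ?; apply: AY; right|left].
apply: (Amax Y); last by rewrite /P' YX0.
split; first by move=> z Az; apply: AY; left.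
by move=> YA; apply: nAx; left; apply: YA.
Qed.

Lemma InP_cat (T : Type) (x : T) (l1 l2 : seq T) :
  List.In x (l1 ++ l2) <-> List.In x l1 \/ List.In x l2.
Proof. exact: List.in_app_iff. Qed.

Lemma InP_map (T U : Type) (f : T -> U) (y : U) (l : seq T) :
  List.In y (map f l) <-> exists x, f x = y /\ List.In x l.
Proof. exact: List.in_map_iff. Qed.

Section Ideals.
Variables (B : pzRingType) (S : B -> Prop).
Hypothesis SS : is_ideal S S.
Implicit Types (I P Q X Y : B -> Prop) (l : seq (B -> Prop)).

Lemma ideal_sub I : is_ideal S I -> set_incl I S. Proof. by case. Qed.
Lemma ideal0 I : is_ideal S I -> I 0. Proof. by case. Qed.
Lemma idealB I x y : is_ideal S I -> I x -> I y -> I (x - y).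
Proof. by case=> _ _ + _; apply. Qed.
Lemma idealN I x : is_ideal S I -> I x -> I (- x).
Proof. by move=> hI Ix; rewrite -sub0r; apply: idealB => //; apply: ideal0. Qed.
Lemma idealD I x y : is_ideal S I -> I x -> I y -> I (x + y).
Proof. by move=> hI Ix Iy; rewrite -[y]opprK; apply: idealB => //; apply: idealN. Qed.
Lemma ideal_mull I a x : is_ideal S I -> S a -> I x -> I (a * x).
Proof. by case=> _ _ _ h Sa Ix; case: (h a x). Qed.
Lemma ideal_mulr I a x : is_ideal S I -> S a -> I x -> I (x * a).
Proof. by case=> _ _ _ h Sa Ix; case: (h a x). Qed.
Lemma ideal_sum I T (l : seq T) (F : T -> B) : is_ideal S I ->
  (forall t, List.In t l -> I (F t)) -> I (\sum_(t <- l) F t).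
Proof.
move=> hI; elim: l => [|t l IH] h; first by rewrite big_nil; apply: ideal0.
rewrite big_cons; apply: idealD => //; first by apply: h; left.
by apply: IH => u ul; apply: h; right.
Qed.
Lemma idealBl I x y : is_ideal S I -> I (x - y) -> I y -> I x.
Proof. by move=> hI xy Iy; rewrite -(subrK y x); apply: idealD. Qed.

Lemma idprod_mul X Y x y : X x -> Y y -> idprod X Y (x * y).
Proof.
move=> Xx Yy; exists [:: (x, y)]; split; first by move=> p [<-|[]].
by rewrite big_seq1.
Qed.

Lemma idprod_incl X Y Z : is_ideal S Z ->
  (forall x y, X x -> Y y -> Z (x * y)) -> set_incl (idprod X Y) Z.
Proof.
move=> hZ h _ [l [hl ->]]; apply: ideal_sum => // p /hl [? ?]; exact: h.
Qed.

Lemma idprod_ideal X Y : is_ideal S X -> is_ideal S Y -> is_ideal S (idprod X Y).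
Proof.
move=> hX hY; split.
- apply: idprod_incl => // x y /(ideal_sub hX) Sx /(ideal_sub hY) Sy.
  exact: (ideal_mull SS).
- by exists [::]; split => //; rewrite big_nil.
- move=> _ _ [l1 [h1 ->]] [l2 [h2 ->]].
  exists (l1 ++ map (fun p => (- p.1, p.2)) l2); split.
    move=> p /InP_cat [/h1//|/InP_map [q [<- /h2 [? ?]]]].
    by split => //=; apply: idealN.
  rewrite big_cat big_map /= -sumrN; congr (_ + _).
  by apply: eq_bigr => p _; rewrite mulNr.
- move=> a _ Sa [l [hl ->]]; split.
    exists (map (fun p => (a * p.1, p.2)) l); split.
      by move=> p /InP_map [q [<- /hl [? ?]]]; split => //=; apply: ideal_mull.
    by rewrite big_map mulr_sumr; apply: eq_bigr => p _; rewrite mulrA.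
  exists (map (fun p => (p.1, p.2 * a)) l); split.
    by move=> p /InP_map [q [<- /hl [? ?]]]; split => //=; apply: ideal_mulr.
  by rewrite big_map mulr_suml; apply: eq_bigr => p _; rewrite mulrA.
Qed.

Lemma idprodl_ideal l : (forall P, List.In P l -> is_ideal S P) ->
  is_ideal S (idprodl S l).
Proof.
elim: l => [//|P [|Q l] IH] h; first by apply: h; left.
by apply: idprod_ideal; [apply: h; left|apply: IH => R HR; apply: h; right].
Qed.

Lemma idprodl_cons P l x y : l <> [::] -> P x -> idprodl S l y ->
  idprodl S (P :: l) (x * y).
Proof. by case: l => // Q l _ Px ly; apply: idprod_mul. Qed.

Lemma idprodl_sub_hd P l : is_ideal S P -> (forall Q, List.In Q l -> is_ideal S Q) ->
  set_incl (idprodl S (P :: l)) P.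
Proof.
case: l => [_ _ x //|Q l] hP hl; apply: idprod_incl => // x y Px Sy.
by apply: ideal_mulr => //; apply: (ideal_sub (idprodl_ideal hl)).
Qed.

Lemma idprodl_sub_tl P l : is_ideal S P -> (forall Q, List.In Q l -> is_ideal S Q) ->
  set_incl (idprodl S (P :: l)) (idprodl S l).
Proof.
case: l => [/ideal_sub//|Q l] hP hl; apply: idprod_incl => [|x y Px Sy].
  exact: idprodl_ideal.
by apply: ideal_mull => //; [apply: idprodl_ideal|apply: (ideal_sub hP)].
Qed.

Lemma idprodl_sub_mem P l : (forall Q, List.In Q l -> is_ideal S Q) ->
  List.In P l -> set_incl (idprodl S l) P.
Proof.
elim: l => // Q l IH hl; have hQ := hl _ (or_introl erefl).
have hl' R : List.In R l -> is_ideal S R by move=> ?; apply: hl; right.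
case=> [<-|/(IH hl') h] x; first exact: idprodl_sub_hd.
by move=> /(idprodl_sub_tl hQ hl'); apply: h.
Qed.

Lemma idprodl_sub_catr l1 l2 :
  (forall Q, List.In Q (l1 ++ l2) -> is_ideal S Q) ->
  set_incl (idprodl S (l1 ++ l2)) (idprodl S l2).
Proof.
elim: l1 => [_ x //|P l1 IH] hl x h; apply: IH.
  by move=> Q HQ; apply: hl; right.
apply: (idprodl_sub_tl _ _ h) => [|Q HQ]; first by apply: hl; left.
by apply: hl; right.
Qed.

Lemma idprodl_sub_catl l1 l2 : l1 <> [::] ->
  (forall Q, List.In Q (l1 ++ l2) -> is_ideal S Q) ->
  set_incl (idprodl S (l1 ++ l2)) (idprodl S l1).
Proof.
elim: l1 => [//|P [|Q l1] IH] _ hl.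
  apply: idprodl_sub_hd => [|Q HQ]; first by apply: hl; left.
  by apply: hl; right.
have hl' R : List.In R ((Q :: l1) ++ l2) -> is_ideal S R.
  by move=> ?; apply: hl; right.
have hP : is_ideal S P by apply: hl; left.
apply: idprod_incl => [|x y Px /(IH _ hl') h].
  apply: idprodl_ideal => R HR; apply: hl; apply/InP_cat.
  by left.
by apply: idprod_mul => //; apply: h.
Qed.

Lemma idprodl_cat l1 l2 x y : l1 <> [::] -> l2 <> [::] ->
  (forall Q, List.In Q (l1 ++ l2) -> is_ideal S Q) ->
  idprodl S l1 x -> idprodl S l2 y -> idprodl S (l1 ++ l2) (x * y).
Proof.
move=> + l2N; elim: l1 x => [//|P [|Q l1] IH] x _ hl.
  by move=> Px ly; apply: idprodl_cons.
have hl' R : List.In R ((Q :: l1) ++ l2) -> is_ideal S R.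
  by move=> ?; apply: hl; right.
move=> + ly; have hI := idprodl_ideal hl; case=> l [h ->].
rewrite mulr_suml; apply: ideal_sum => //= p /h [Pp lp].
by rewrite -mulrA; apply: idprod_mul => //; apply: IH.
Qed.

Lemma idprodl_idem l e : e * e = e -> S e ->
  (forall Q, List.In Q l -> Q e) -> idprodl S l e.
Proof.
move=> ee Se; elim: l => [//|P [|Q l] IH] h; first by apply: h; left.
rewrite -ee; apply: idprodl_cons => //; first by apply: h; left.
by apply: IH => R HR; apply: h; right.
Qed.

(** Since [x = e x e], the factors before and after the block can be filled with copies of [e], each
    copy taken from one of the remaining ideals. *)
Lemma idprodl_block l1 b l2 e x :
  (forall Q, List.In Q (l1 ++ b ++ l2) -> is_ideal S Q) -> b <> [::] ->
  e * e = e -> S e -> e * x = x -> x * e = x ->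
  (forall Q, List.In Q (l1 ++ l2) -> Q e) ->
  idprodl S b x -> idprodl S (l1 ++ b ++ l2) x.
Proof.
move=> hl bN ee Se ex xe he bx.
have b2x : idprodl S (b ++ l2) x.
  have [->|l2N] := pselect (l2 = [::]); first by rewrite cats0.
  rewrite -xe; apply: idprodl_cat => // [Q HQ|].
    by apply: hl; apply/InP_cat; right.
  by apply: idprodl_idem => // Q HQ; apply: he; apply/InP_cat; right.
have [->//|l1N] := pselect (l1 = [::]).
rewrite -ex; apply: idprodl_cat => //; first by case: (b) bN.
by apply: idprodl_idem => // Q HQ; apply: he; apply/InP_cat; left.
Qed.

Lemma prime_ideal P : is_prime S P -> is_ideal S P. Proof. by case=> -[]. Qed.

Lemma prime_idprodl P l : is_prime S P -> l <> [::] ->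
  (forall Q, List.In Q l -> is_ideal S Q) -> set_incl (idprodl S l) P ->
  exists2 Q, List.In Q l & set_incl Q P.
Proof.
move=> pP; elim: l => [//|Q [|R l] IH] _ hl lP; first by exists Q => //; left.
have hl' X : List.In X (R :: l) -> is_ideal S X by move=> ?; apply: hl; right.
have hQ : is_ideal S Q by apply: hl; left.
have [QP|/IH] := pP.2 Q _ hQ (idprodl_ideal hl') lP.
- by exists Q => //; left.
- by case=> // X HX XP; exists X => //; right.
Qed.

Lemma finitely_many_minimal_of_product I l :
  is_ideal S I -> l <> [::] -> List.Forall (is_prime S) l ->
  seteq I (idprodl S l) -> finite_family (min_prime_over S I).
Proof.
move=> hI lN /List.Forall_forall lP Il; exists l => P [pP IP Pmin].
have hl Q : List.In Q l -> is_ideal S Q by move/lP/prime_ideal.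
have [|Q Ql QP] := prime_idprodl pP lN hl; first by move=> x /Il /IP.
have IQ : set_incl I Q by move=> x /Il; apply: idprodl_sub_mem.
apply/List.Exists_exists; exists Q; split => // x; split; last exact: QP.
by apply: (Pmin Q); [apply: lP|exact: IQ|exact: QP].
Qed.

(** Together with [prime_elements] this gives the elementwise criterion: [x S y] inside [P] forces
    [x] or [y] into [P]. In this form primality passes to intersections of chains and along
    homomorphisms without handling ideals. *)
Lemma prime_of_elements P : is_ideal S P -> (exists x, S x /\ ~ P x) ->
  (forall x y, S x -> S y -> ~ P x -> ~ P y -> exists2 a, S a & ~ P (x * a * y)) ->
  is_prime S P.
Proof.
move=> hP P1 h; split => // X Y hX hY XYP.
apply: contrapT => /not_orP [/existsNP [x /not_implyP [Xx nPx]]].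
move=> /existsNP [y /not_implyP [Yy nPy]].
have [a Sa] := h x y (ideal_sub hX Xx) (ideal_sub hY Yy) nPx nPy.
by apply; apply: XYP; apply: idprod_mul => //; apply: ideal_mulr.
Qed.

(* [X = { z | z S y <= P }] and [Y = { w | X S w <= P }] are ideals; they replace the ideals generated by [x] and [y], which are awkward in a ring without unit. *)
Lemma prime_elements P x y : is_prime S P -> S x -> S y -> ~ P x -> ~ P y ->
  exists2 a, S a & ~ P (x * a * y).
Proof.
move=> pP Sx Sy nPx nPy; apply: contrapT => no.
have hP := prime_ideal pP; have [_ S0 SB SM] := SS.
have xSyP a : S a -> P (x * a * y).
  by move=> Sa; apply: contrapT => nP; apply: no; exists a.
pose X z := S z /\ forall a, S a -> P (z * a * y).
have hX : is_ideal S X.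
  split=> [z []//||z w [Sz Xz] [Sw Xw]|b z Sb [Sz Xz]].
  - by split => // a _; rewrite !mul0r; apply: ideal0.
  - split; first exact: SB.
    by move=> a Sa; rewrite !mulrBl; apply: (idealB hP); [apply: Xz|apply: Xw].
  - split; split.
    + by case: (SM b z).
    + by move=> a Sa; rewrite -!mulrA; apply: (ideal_mull hP) => //; rewrite mulrA; apply: Xz.
    + by case: (SM b z).
    + by move=> a Sa; rewrite -[z * b * a]mulrA; apply: Xz; case: (SM b a).
pose Y w := S w /\ forall z a, X z -> S a -> P (z * a * w).
have hY : is_ideal S Y.
  split=> [z []//||z w [Sz Xz] [Sw Xw]|b z Sb [Sz Xz]].
  - by split => // c a _ _; rewrite mulr0; apply: ideal0.
  - split; first exact: SB.
    by move=> c a Xc Sa; rewrite !mulrBr; apply: (idealB hP); [apply: Xz|apply: Xw].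
  - split; split.
    + by case: (SM b z).
    + move=> c a Xc Sa; rewrite mulrA -[c * a * b]mulrA; apply: Xz => //.
      by case: (SM b a).
    + by case: (SM b z).
    + by move=> c a Xc Sa; rewrite mulrA; apply: (ideal_mulr hP) => //; apply: Xz.
have Xx : X x by split.
have Yy : Y y by split => // z a [_ h] /h.
have hXY := idprod_ideal hX hY.
(* [Y] controls only products [z a w] with [a] in [S], so the middle factor of [X (X Y)] plays the
   part of [a]. Primality is then used twice. *)
have XXY : set_incl (idprod X (idprod X Y)) P.
  apply: idprod_incl => // z w Xz [l [h ->]]; rewrite mulr_sumr.
  apply: ideal_sum => // p /h [Xp1 [_ Yp2]]; rewrite mulrA; apply: Yp2 => //.
  by case: Xp1.
case: (pP.2 X _ hX hXY XXY) => [XP|XYP]; first exact: nPx (XP _ Xx).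
by case: (pP.2 X Y hX hY XYP) => [XP|YP]; [apply: nPx (XP _ Xx)|apply: nPy (YP _ Yy)].
Qed.

Lemma ideal_chain_union (F : (B -> Prop) -> Prop) :
  (exists X, F X) -> (forall X, F X -> is_ideal S X) ->
  (forall X Y, F X -> F Y -> (forall x, X x -> Y x) \/ (forall x, Y x -> X x)) ->
  is_ideal S (fun x => exists2 X, F X & X x).
Proof.
move=> [X0 FX0] Fid Ftot; split.
- by move=> x [X /Fid hX Xx]; apply: (ideal_sub hX).
- by exists X0 => //; apply: (ideal0 (Fid _ FX0)).
- move=> x y [X FX Xx] [Y FY Yy]; case: (Ftot _ _ FX FY) => XY.
    by exists Y => //; apply: (idealB (Fid _ FY)) => //; apply: XY.
  by exists X => //; apply: (idealB (Fid _ FX)) => //; apply: XY.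
- move=> a x Sa [X FX Xx]; split; exists X => //.
    exact: (ideal_mull (Fid _ FX)).
  exact: (ideal_mulr (Fid _ FX)).
Qed.

Definition idsum X Y : B -> Prop := fun x => exists y z, [/\ X y, Y z & x = y + z].

Lemma idsum_ideal X Y : is_ideal S X -> is_ideal S Y -> is_ideal S (idsum X Y).
Proof.
move=> hX hY; split.
- move=> _ [y [z [Xy Yz ->]]].
  by apply: (idealD SS); [apply: (ideal_sub hX)|apply: (ideal_sub hY)].
- by exists 0, 0; rewrite addr0; split => //; apply: ideal0.
- move=> _ _ [y [z [Xy Yz ->]]] [y' [z' [Xy' Yz' ->]]].
  exists (y - y'), (z - z'); split; [exact: idealB|exact: idealB|].
  by rewrite opprD addrACA.
- move=> a _ Sa [y [z [Xy Yz ->]]]; split.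
    by exists (a * y), (a * z); rewrite mulrDr; split => //; apply: ideal_mull.
  by exists (y * a), (z * a); rewrite mulrDl; split => //; apply: ideal_mulr.
Qed.

(** An ideal [P] maximal among those containing [I] and missing [T] is prime: if [X] and [Y] are not
    inside [P], then [P + X] and [P + Y] meet [T], hence so does their product, which lies in [P] as
    soon as [X Y] does. In the applications [T] is a single idempotent or the set of vertices of a
    maximal tail. *)
Lemma exists_prime_avoiding I (T : B -> Prop) : is_ideal S I ->
  (exists2 t, T t & S t) -> (forall t, T t -> ~ I t) ->
  (forall X Y x y, is_ideal S X -> is_ideal S Y -> T x -> X x -> T y -> Y y ->
     exists2 t, T t & idprod X Y t) ->
  exists P, [/\ is_prime S P, set_incl I P & forall t, T t -> ~ P t].
Proof.
move=> hI [t0 Tt0 St0] IT Tm.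
pose D X := [/\ is_ideal S X, set_incl I X & forall t, T t -> ~ X t].
have [|F [X0 FX0] FD Ftot|P [[hP IP PT] _ Pmax]] := @zorn_above B D I.
- by split.
- split; last by move=> t Tt [X /FD [_ _ /(_ t Tt)]].
    by apply: ideal_chain_union => //; [exists X0|move=> X /FD []].
  by move=> x Ix; exists X0 => //; case: (FD _ FX0) => _ h _; apply: h.
exists P; split => //; split; first by split => //; exists t0; split => //; apply: PT.
move=> X Y hX hY XYP; apply: contrapT => /not_orP.
have meet Z : is_ideal S Z -> ~ set_incl Z P -> exists2 t, T t & idsum P Z t.
  move=> hZ nZP; apply: contrapT => no; apply: nZP => z Zz.
  apply: (Pmax (idsum P Z)).
  - split; first exact: idsum_ideal.
    + by move=> x Ix; exists x, 0; rewrite addr0; split => //;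
        [apply: IP|apply: (ideal0 hZ)].
    + by move=> t Tt Zt; apply: no; exists t.
  - by move=> x Px; exists x, 0; rewrite addr0; split => //; apply: (ideal0 hZ).
  - by exists 0, z; rewrite add0r; split => //; apply: (ideal0 hP).
case=> /(meet _ hX) [t Tt Xt] /(meet _ hY) [u Tu Yu].
have [w Tw] := Tm _ _ t u (idsum_ideal hP hX) (idsum_ideal hP hY) Tt Xt Tu Yu.
suff h : set_incl (idprod (idsum P X) (idsum P Y)) P by move=> /h; apply: PT.
apply: idprod_incl => // _ _ [y [z [Py Xz ->]]] [y' [z' [Py' Yz' ->]]].
rewrite mulrDr; apply: (idealD hP).
  apply: (ideal_mull hP) => //; apply: (idealD SS); first exact: (ideal_sub hP).
  exact: (ideal_sub hX).
rewrite mulrDl; apply: (idealD hP); last by apply: XYP; apply: idprod_mul.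
by apply: (ideal_mulr hP) => //; apply: (ideal_sub hY).
Qed.

(** Zorn's lemma produces maximal sets, so it is applied to complements of primes; a union of
    complements is the complement of the intersection of a chain of primes. *)
Lemma exists_minimal_prime I Q : is_prime S Q -> set_incl I Q ->
  exists2 P, min_prime_over S I P & set_incl P Q.
Proof.
move=> pQ IQ.
pose D X := is_prime S (fun x => ~ X x) /\ (forall x, X x -> ~ I x).
have NN (X : B -> Prop) : (fun x => ~ ~ X x) = X by apply/funext => x; rewrite notK.
have [|F [X0 FX0] FD Ftot|M [[pM MI] QM Mmax]] := @zorn_above B D (fun x => ~ Q x).
- by split; [rewrite NN|move=> x nQx /IQ].
- have uE : (fun x => ~ exists2 X, F X & X x) = (fun x => forall X, F X -> ~ X x).
    apply/funext => x; apply/propext; split; first by move=> no X FX Xx; apply: no; exists X.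
    by move=> h [X /h].
  split; last by move=> x [X /FD [_ h] /h].
  rewrite uE; have hX X : F X -> is_ideal S (fun x => ~ X x).
    by move=> /FD [/prime_ideal].
  apply: prime_of_elements.
  + split.
    * by move=> x h; apply: (ideal_sub (hX _ FX0)); apply: h.
    * by move=> X FX; apply: (ideal0 (hX _ FX)).
    * by move=> x y hx hy X FX; apply: (idealB (hX _ FX)); [apply: hx|apply: hy].
    * move=> a x Sa h; split=> X FX.
        by apply: (ideal_mull (hX _ FX)) => //; apply: h.
      by apply: (ideal_mulr (hX _ FX)) => //; apply: h.
  + have [[[_ [x [Sx Xx]]] _] _] := FD _ FX0; exists x; split => //.
    by move=> /(_ _ FX0).
  + move=> x y Sx Sy /existsNP [X /not_implyP [FX nXx]] /existsNP [Y /not_implyP [FY nYy]].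
    (* The larger of the two complements contains both elements, so one prime of the chain avoids
       both and its elementwise criterion applies. *)
    have [Z FZ [Zx Zy]] : exists2 Z, F Z & Z x /\ Z y.
      move: nXx nYy => /contrapT Xx /contrapT Yy.
      by case: (Ftot _ _ FX FY) => h; [exists Y|exists X] => //; split => //; apply: h.
    have [pZ _] := FD _ FZ.
    have [a Sa nz] := prime_elements pZ Sx Sy (fun h => h Zx) (fun h => h Zy).
    by exists a => // /(_ _ FZ).
exists (fun x => ~ M x); last by move=> x nMx; apply: contrapT => /QM.
split => //; first by move=> x Ix /MI.
move=> R pR IR RM x nMx; apply: contrapT => nRx; apply: nMx.
apply: (Mmax (fun x => ~ R x)) => //; last by move=> y My /RM.
by split; [rewrite NN|move=> y nRy /IR].
Qed.

End Ideals.

(** * Ideals and primes under a ring homomorphism *)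

Section Transfer.
Variables (B B' : pzRingType) (S : B -> Prop) (f : B -> B').
Hypothesis SS : is_ideal S S.
Hypothesis fS : ring_hom_on S f.
Local Notation S' := (image_of S f).

Lemma homD x y : S x -> S y -> f (x + y) = f x + f y.
Proof. by move=> Sx Sy; case: (fS Sx Sy). Qed.
Lemma homM x y : S x -> S y -> f (x * y) = f x * f y.
Proof. by move=> Sx Sy; case: (fS Sx Sy). Qed.
Lemma hom0 : f 0 = 0.
Proof.
have S0 := ideal0 SS; apply: (addrI (f 0)).
by rewrite -homD // !addr0.
Qed.
Lemma homB x y : S x -> S y -> f (x - y) = f x - f y.
Proof.
move=> Sx Sy; apply: (addIr (f y)); rewrite -homD //; last exact: (idealB SS).
by rewrite !subrK.
Qed.
Lemma hom_sum T (l : seq T) (F : T -> B) : (forall t, List.In t l -> S (F t)) ->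
  f (\sum_(t <- l) F t) = \sum_(t <- l) f (F t).
Proof.
elim: l => [|t l IH] h; first by rewrite !big_nil hom0.
rewrite !big_cons homD; last 2 first.
- by apply: h; left.
- by apply: (ideal_sum SS) => u ul; apply: h; right.
by rewrite IH // => u ul; apply: h; right.
Qed.

(** [f] is additive and multiplicative on [S] only, so the preimage is cut down to [S]. *)
Definition preideal (Y : B' -> Prop) : B -> Prop := fun x => S x /\ Y (f x).
Definition kernel : B -> Prop := preideal (@zero_ideal B').

Lemma image_S x : S x -> S' (f x). Proof. by exists x. Qed.

Lemma image_ideal X : is_ideal S X -> is_ideal S' (image_of X f).
Proof.
move=> hX; have XS := ideal_sub hX; split.
- by move=> _ [x Xx ->]; apply/image_S/XS.
- by exists 0; [apply: (ideal0 hX)|rewrite hom0].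
- by move=> _ _ [x Xx ->] [y Xy ->]; exists (x - y);
    [apply: (idealB hX)|rewrite homB //; apply: XS].
- move=> _ _ [a Sa ->] [x Xx ->]; split.
    by exists (a * x); [apply: (ideal_mull hX)|rewrite homM //; apply: XS].
  by exists (x * a); [apply: (ideal_mulr hX)|rewrite homM //; apply: XS].
Qed.

Lemma image_SS : is_ideal S' S'. Proof. exact: image_ideal. Qed.

Lemma preideal_ideal Y : is_ideal S' Y -> is_ideal S (preideal Y).
Proof.
move=> hY; split.
- by move=> x [].
- by split; [apply: (ideal0 SS)|rewrite hom0; apply: (ideal0 hY)].
- move=> x y [Sx Yx] [Sy Yy]; split; first exact: (idealB SS).
  by rewrite homB //; apply: (idealB hY).
- move=> a x Sa [Sx Yx]; split; split; [exact: (ideal_mull SS)| |exact: (ideal_mulr SS)|].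
    by rewrite homM //; apply: (ideal_mull hY) => //; apply: image_S.
  by rewrite homM //; apply: (ideal_mulr hY) => //; apply: image_S.
Qed.

Lemma kernel_preideal Y : is_ideal S' Y -> set_incl kernel (preideal Y).
Proof. by move=> hY x [Sx fx0]; split => //; rewrite fx0; apply: (ideal0 hY). Qed.

Lemma preideal_image X : is_ideal S X -> set_incl kernel X ->
  seteq (preideal (image_of X f)) X.
Proof.
move=> hX kX x; split; last by move=> Xx; split; [apply: (ideal_sub hX)|exists x].
case=> Sx [y Xy fxy]; have Sy := ideal_sub hX Xy.
apply: (idealBl hX _ Xy); apply: kX; split; first exact: (idealB SS).
by rewrite /zero_ideal homB // fxy subrr.
Qed.

Lemma image_preideal Y : is_ideal S' Y -> seteq (image_of (preideal Y) f) Y.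
Proof.
move=> hY y; split; first by case=> x [Sx Yx] ->.
by move=> Yy; have [x Sx yfx] := ideal_sub hY Yy; exists x => //; split; rewrite -?yfx.
Qed.

Lemma preideal_prime Y : is_prime S' Y -> is_prime S (preideal Y).
Proof.
move=> pY; have hY := prime_ideal pY.
apply: (prime_of_elements (preideal_ideal hY)).
  have [[_ [_ [[x Sx ->] nYx]]] _] := pY; exists x; split => //.
  by case.
move=> x y Sx Sy nx ny.
have [||_ [a Sa ->] nYa] := prime_elements image_SS pY (image_S Sx) (image_S Sy).
- by move=> Yx; apply: nx.
- by move=> Yy; apply: ny.
exists a => // -[_]; rewrite !homM //; exact: (ideal_mull SS).
Qed.

Lemma image_prime X : is_prime S X -> set_incl kernel X -> is_prime S' (image_of X f).
Proof.
move=> pX kX; have hX := prime_ideal pX.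
have inX x : S x -> image_of X f (f x) -> X x.
  by move=> Sx h; apply: (preideal_image hX kX x).1.
apply: (prime_of_elements (image_ideal hX)).
  have [[_ [x [Sx nXx]]] _] := pX; exists (f x).
  by split; [apply: image_S|move=> /(inX _ Sx)].
move=> _ _ [x Sx ->] [y Sy ->] nx ny.
have [||a Sa na] := prime_elements SS pX Sx Sy.
- by move=> Xx; apply: nx; exists x.
- by move=> Xy; apply: ny; exists y.
exists (f a); first exact: image_S.
rewrite -!homM //; last exact: (ideal_mull SS).
by move=> /inX h; apply: na; apply: h; apply: (ideal_mull SS) => //; apply: (ideal_mull SS).
Qed.

Lemma kernel_ideal : is_ideal S kernel.
Proof.
apply: preideal_ideal; split.
- by move=> _ ->; exists 0; [apply: (ideal0 SS)|rewrite hom0].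
- by [].
- by move=> _ _ -> ->; rewrite /zero_ideal subr0.
- by move=> a _ _ ->; rewrite /zero_ideal mulr0 mul0r.
Qed.

Lemma image_kernel : image_of kernel f = @zero_ideal B'.
Proof.
apply/funext => y; apply/propext; split; first by case=> x [_ fx0] ->.
by move=> ->; exists 0; [split; [apply: (ideal0 SS)|exact: hom0]|rewrite hom0].
Qed.

Lemma kernel_prime : is_prime S kernel <-> prime_ring S'.
Proof.
split; last exact: preideal_prime.
by move=> pk; rewrite /prime_ring -image_kernel; apply: image_prime.
Qed.

Lemma finite_minimal_transfer :
  finite_family (min_prime_over S kernel) <-> finite_family (minimal_prime S').
Proof.
split=> -[l hl].
  exists (map (fun X => image_of X f) l) => Y [pY _ Ymin].
  have hY := prime_ideal pY.
  have /hl : min_prime_over S kernel (preideal Y).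
    split; [exact: preideal_prime|exact: kernel_preideal|].
    move=> Q pQ kQ QY x [Sx Yx].
    apply: (preideal_image (prime_ideal pQ) kQ x).1; split => //.
    apply: Ymin => //; first exact: image_prime.
      by move=> _ ->; exists 0; [apply: (ideal0 (prime_ideal pQ))|rewrite hom0].
    by move=> _ [z /QY [_ ?] ->].
  move=> /List.Exists_exists [X [Xl PX]].
  apply/List.Exists_exists; exists (image_of X f); split.
    by apply/InP_map; exists X.
  have -> : X = preideal Y by apply/funext => x; apply/propext; rewrite (PX x).
  by move=> y; rewrite (image_preideal hY y).
exists (map preideal l) => X [pX kX Xmin].
have hX := prime_ideal pX.
have /hl : minimal_prime S' (image_of X f).
  split; [exact: image_prime| |].
    by move=> _ ->; exists 0; [apply: (ideal0 hX)|rewrite hom0].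
  move=> Q pQ _ QX _ [x Xx ->]; have Sx := ideal_sub hX Xx.
  suff [] : preideal Q x by [].
  apply: (Xmin _ (preideal_prime pQ) (kernel_preideal (prime_ideal pQ))) => //.
  by move=> z [Sz /QX h]; apply: (preideal_image hX kX z).1.
move=> /List.Exists_exists [Y [Yl XY]].
apply/List.Exists_exists; exists (preideal Y); split; first by apply/InP_map; exists Y.
have -> : Y = image_of X f by apply/funext => y; apply/propext; rewrite (XY y).
by move=> x; rewrite (preideal_image hX kX x).
Qed.

Lemma preideal_idprodl (l : seq (B' -> Prop)) : (forall Q, List.In Q l -> is_ideal S' Q) ->
  forall x, idprodl S (map preideal l) x -> idprodl S' l (f x).
Proof.
elim: l => [|P [|Q l] IH] hl x; [exact: image_S|by case|].
have hl' R : List.In R (Q :: l) -> is_ideal S' R by move=> ?; apply: hl; right.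
have hP : is_ideal S' P by apply: hl; left.
have hQ : is_ideal S (idprodl S (map preideal (Q :: l))).
  apply: (idprodl_ideal SS) => R /InP_map [R' [<- hR]].
  exact: (preideal_ideal (hl' _ hR)).
case=> s [hs ->].
rewrite hom_sum; last by move=> p /hs [[Sp _] h2]; exact: (ideal_mull SS Sp (ideal_sub hQ h2)).
apply: (ideal_sum (idprodl_ideal image_SS hl)) => p /hs [[Sp Pp] Qp].
rewrite homM //; last exact: (ideal_sub hQ).
by apply: idprod_mul => //; apply: IH.
Qed.

End Transfer.

Lemma InP (T : eqType) (x : T) (l : seq T) : List.In x l <-> x \in l.
Proof.
elim: l => // y l IH; rewrite inE /=; split.
  by case=> [->|/IH ->]; rewrite ?eqxx ?orbT.
by case/orP => [/eqP ->|/IH ?]; [left|right].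
Qed.

(** * Orthogonal idempotents and evaluation of polynomials *)

Section Orthogonal.
Variables (B : pzRingType) (T : eqType) (U : eqType) (id : T -> B).
Hypothesis idM : forall a b, id a * id b = if a == b then id a else 0.

Lemma orth_suml (l : seq T) a : uniq l -> a \in l -> (\sum_(b <- l) id b) * id a = id a.
Proof.
move=> ul al; rewrite mulr_suml (bigD1_seq a) //= idM eqxx big1 ?addr0 // => b ba.
by rewrite idM (negbTE ba).
Qed.

Lemma orth_sumr (l : seq T) a : uniq l -> a \in l -> id a * (\sum_(b <- l) id b) = id a.
Proof.
move=> ul al; rewrite mulr_sumr (bigD1_seq a) //= idM eqxx big1 ?addr0 // => b ba.
by rewrite idM eq_sym (negbTE ba).
Qed.

(** The sum of the distinct idempotents [id (c t)] is a left unit for the whole sum, so they cannot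
    all kill it. *)
Lemma support_left (l : seq U) (F : U -> B) (c : U -> T) :
  (forall t, t \in l -> id (c t) * F t = F t) -> \sum_(t <- l) F t <> 0 ->
  exists2 t, t \in l & id (c t) * \sum_(u <- l) F u <> 0.
Proof.
move=> h nz; apply: contrapT => no; apply: nz.
pose s := undup (map c l).
have <- : (\sum_(a <- s) id a) * (\sum_(t <- l) F t) = \sum_(t <- l) F t.
  rewrite mulr_sumr; apply: eq_big_seq => t tl; rewrite -{1}(h _ tl) mulrA.
  by rewrite orth_suml ?undup_uniq ?mem_undup ?map_f // h.
rewrite mulr_suml big_seq big1 // => a; rewrite mem_undup => /mapP[t tl ->].
by apply: contrapT => nz; apply: no; exists t.
Qed.

Lemma support_right (l : seq U) (F : U -> B) (c : U -> T) :
  (forall t, t \in l -> F t * id (c t) = F t) -> \sum_(t <- l) F t <> 0 ->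
  exists2 t, t \in l & (\sum_(u <- l) F u) * id (c t) <> 0.
Proof.
move=> h nz; apply: contrapT => no; apply: nz.
pose s := undup (map c l).
have <- : (\sum_(t <- l) F t) * (\sum_(a <- s) id a) = \sum_(t <- l) F t.
  rewrite mulr_suml; apply: eq_big_seq => t tl; rewrite -{1}(h _ tl) -mulrA.
  by rewrite orth_sumr ?undup_uniq ?mem_undup ?map_f // h.
rewrite mulr_sumr big_seq big1 // => a; rewrite mem_undup => /mapP[t tl ->].
by apply: contrapT => nz; apply: no; exists t.
Qed.
End Orthogonal.

Section PolyEval.
Variables (K : fieldType) (B : pzRingType) (kap : {rmorphism K -> B}).
Hypothesis kapC : forall k x, kap k * x = x * kap k.
Implicit Types (c x d : B) (f g : {poly K}).

(** Evaluation K[x] -> B through the scalars [kap]. As these are central, it is a ring morphism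
    although [B] is not commutative. *)
Definition peval (c : B) (f : {poly K}) : B := \sum_(i < size f) kap f`_i * c ^+ i.

Lemma pevalE c f n : (size f <= n)%N -> peval c f = \sum_(i < n) kap f`_i * c ^+ i.
Proof.
move=> fn; rewrite /peval (big_ord_widen _ (fun i : nat => kap f`_i * c ^+ i) fn).
rewrite big_mkcond /=; apply: eq_bigr => i _; case: ltnP => // h.
by rewrite nth_default // rmorph0 mul0r.
Qed.

Lemma pevalD c f g : peval c (f + g) = peval c f + peval c g.
Proof.
pose n := maxn (size (f + g)) (maxn (size f) (size g)).
rewrite !(@pevalE c _ n) ?leq_max ?leqnn ?orbT // -big_split /=.
by apply: eq_bigr => i _; rewrite coefD rmorphD mulrDl.
Qed.

Lemma pevalC c a : peval c a%:P = kap a.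
Proof.
by rewrite (@pevalE c _ 1) ?size_polyC ?leq_b1 // big_ord1 coefC eqxx expr0 mulr1.
Qed.

Lemma peval0 c : peval c 0 = 0.
Proof. by rewrite -[0]/(0%:P) pevalC rmorph0. Qed.

Lemma peval1 c : peval c 1 = 1.
Proof. by rewrite -[1]/(1%:P) pevalC rmorph1. Qed.

Lemma pevalMX c f : peval c (f * 'X) = peval c f * c.
Proof.
rewrite (@pevalE c _ (size f).+1); last first.
  by apply: leq_trans (size_polyMleq _ _) _; rewrite size_polyX addn2.
rewrite big_ord_recl coefMX /= rmorph0 mul0r add0r /peval mulr_suml.
by apply: eq_bigr => i _; rewrite coefMX /= exprSr mulrA.
Qed.

Lemma pevalCM c a f : peval c (a%:P * f) = kap a * peval c f.
Proof.
rewrite (@pevalE c _ (size f)); last by rewrite mul_polyC size_scale_leq.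
rewrite /peval mulr_sumr; apply: eq_bigr => i _.
by rewrite coefCM rmorphM mulrA.
Qed.

Lemma peval_com c f x : x * c = c * x -> x * peval c f = peval c f * x.
Proof.
move=> xc; rewrite /peval mulr_sumr mulr_suml; apply: eq_bigr => i _.
rewrite mulrA -kapC -!mulrA; congr (_ * _).
by elim: (nat_of_ord i) => [|n IH]; rewrite ?expr0 ?mulr1 ?mul1r // exprS mulrA xc -!mulrA IH.
Qed.

Lemma pevalM c f g : peval c (f * g) = peval c f * peval c g.
Proof.
elim/poly_ind: f => [|f a IH]; first by rewrite mul0r peval0 mul0r.
rewrite mulrDl !pevalD pevalCM pevalC mulrDl; congr (_ + _).
by rewrite -mulrA [_ * g]mulrC mulrA !pevalMX IH -!mulrA (peval_com g (erefl (c * c))).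
Qed.

Lemma pevalXn c n : peval c 'X^n = c ^+ n.
Proof.
elim: n => [|n IH]; first by rewrite !expr0 peval1.
by rewrite !exprSr pevalMX IH.
Qed.

Lemma peval_conj c d x f : c * x = x * d -> peval c f * x = x * peval d f.
Proof.
move=> cx; rewrite /peval mulr_suml mulr_sumr; apply: eq_bigr => i _.
rewrite [RHS]mulrA -kapC -!mulrA; congr (_ * _).
by elim: (nat_of_ord i) => [|n IH]; rewrite ?expr0 ?mulr1 ?mul1r // !exprSr -mulrA cx mulrA IH mulrA.
Qed.
End PolyEval.

(** * Closed paths and cyclic vertices *)

Section Paths.
Variable G : pgraph.
Local Notation path := (@path_from G).
Implicit Types (u v w : pV G) (p q : seq (pE G)).

Lemma path_cat u p q w :
  path u (p ++ q) w <-> exists2 z, path u p z & path z q w.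
Proof.
elim: p u => [|e p IH] u /=; first by split=> [|[z ->]] //; exists u.
split; first by case=> ? ? /IH [z ? ?]; exists z.
by case=> z [? ? ?] ?; split => //; apply/IH; exists z.
Qed.

Lemma path_catI u p q z w : path u p z -> path z q w -> path u (p ++ q) w.
Proof. by move=> ? ?; apply/path_cat; exists z. Qed.

Lemma path_end u p z w : path u p z -> path u p w -> z = w.
Proof. by elim: p u => [|e p IH] u /= => [-> ->|[_ _ /IH h] [_ _ /h]]. Qed.

Lemma path_catl u p q z w : path u p z -> path u (p ++ q) w -> path z q w.
Proof. by move=> up /path_cat [z' /(path_end up) <-]. Qed.

Lemma reaches_trans u v w : reaches u v -> reaches v w -> reaches u w.
Proof. by move=> [p up] [q vq]; exists (p ++ q); apply: path_catI vq. Qed.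

Lemma reaches_refl u : reaches u u. Proof. by exists [::]. Qed.

Definition closed_path w p := p <> [::] /\ path w p w.

Definition emits_one w := forall e f, pein e -> pein f -> psrc e = w -> psrc f = w -> e = f.

(** This says that [w] lies on a cycle without exits, without choosing the cycle: [w] is on a closed
    path and nothing reachable from it branches. *)
Definition cyclic w := (exists p, closed_path w p) /\ forall z, reaches w z -> emits_one z.

Definition shortest_closed w p :=
  closed_path w p /\ forall q, closed_path w q -> (size p <= size q)%N.

Lemma exists_shortest_closed w p : closed_path w p -> exists q, shortest_closed w q.
Proof.
have [n] := ubnP (size p); elim: n p => // n IH p pn wp.
have [h|/existsNP [q /not_implyP [wq /negP]]] :=
  pselect (forall q, closed_path w q -> (size p <= size q)%N); first by exists p.
by rewrite -ltnNge => qp; apply: (IH q) => //; apply: leq_trans qp _.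
Qed.

(** Length-minimality is what makes other closed paths at a cyclic vertex powers of this one. The
    value [[::]] is a default for vertices on no closed path. *)
Definition loop w : seq (pE G) :=
  match pselect (exists p, shortest_closed w p) with
  | left h => sval (cid h) | right _ => [::] end.

Lemma loopP w p : closed_path w p -> shortest_closed w (loop w).
Proof.
move=> /exists_shortest_closed h; rewrite /loop; case: pselect => // h'.
by case: (cid h').
Qed.

Lemma cyclic_loop w : cyclic w -> shortest_closed w (loop w).
Proof. by case=> [[p /loopP]]. Qed.

Lemma emits_one_unique u p q z w : (forall x, reaches u x -> emits_one x) ->
  path u p z -> path u q w -> (size p <= size q)%N -> q = p ++ drop (size p) q.
Proof.
elim: p u q => [|e p IH] u [|f q] //= h.
case=> pe se ep [pf sf fq] pq.
have ef : e = f by apply: (h u) => //; apply: reaches_refl.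
rewrite -ef in fq *; rewrite {1}(IH _ _ _ ep fq) // => x ex.
by apply: h; apply: reaches_trans ex; exists [:: e].
Qed.

Lemma cyclic_unique u p q z w : cyclic u ->
  path u p z -> path u q w -> size p = size q -> p = q.
Proof.
move=> [_ h] up uq pq.
have := emits_one_unique h up uq; rewrite pq leqnn => /(_ isT).
by rewrite drop_size cats0.
Qed.

Lemma iter_loop_path w p n : path w p w -> path w (flatten (nseq n p)) w.
Proof. by move=> wp; elim: n => // n IH; apply: path_catI IH. Qed.

(** Without branching, the shorter of two paths from [w] is a prefix of the longer, so the loop can
    be stripped off repeatedly. *)
Lemma cyclic_closed_power w p : cyclic w -> path w p w ->
  exists n, p = flatten (nseq n (loop w)).
Proof.
move=> cw; have [[lN wl] lmin] := cyclic_loop cw; have [_ h] := cw.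
have [n] := ubnP (size p); elim: n p => // n IH [|e p] pn wp; first by exists 0.
have le : (size (loop w) <= size (e :: p))%N by apply: lmin.
have E := emits_one_unique h wl wp le.
rewrite E in wp; have wp' := path_catl wl wp.
have [|m Em] := IH _ _ wp'; last by exists m.+1; rewrite /= -Em -E.
rewrite size_drop; case: (loop w) lN => // f l _ /=; rewrite subSS.
by apply: leq_ltn_trans (leq_subr _ _) _.
Qed.

(** The same stripping for a vertex that may branch: being a prefix of a power of [p] replaces the
    absence of branching. *)
Lemma prefix_closed_power w p q n : shortest_closed w p -> path w q w ->
  (exists z, q ++ z = flatten (nseq n p)) -> exists m, q = flatten (nseq m p).
Proof.
move=> [[pN wp] pmin]; elim: n q => [|n IH] q wq [z] /=.
  by case: q wq => // _ _; exists 0.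
have [->|qN] := pselect (q = [::]); first by exists 0.
move=> E; have le : (size p <= size q)%N by apply: pmin.
have Eq : q = p ++ drop (size p) q.
  by rewrite -{1}(cat_take_drop (size p) q); congr (_ ++ _);
    rewrite -(takel_cat z le) E take_size_cat.
rewrite Eq in wq; have wq' := path_catl wp wq.
have [|m Em] := IH _ wq'; last by exists m.+1; rewrite /= -Em -Eq.
exists z; move: E; rewrite {1}Eq -catA => /(congr1 (drop (size p))).
by rewrite !drop_size_cat.
Qed.

Lemma cyclic_reach w z : cyclic w -> reaches w z -> cyclic z /\ reaches z w.
Proof.
move=> cw [p wp]; have [[lN wl] _] := cyclic_loop cw; have [_ h] := cw.
have back : exists q, [/\ path z q w & (size p <= size (p ++ q))%N].
  (* The loop is nonempty, so [size p] windings are at least as long as [p] and extend it; what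
     remains leads from [z] back to [w]. *)
  pose n := size p; have wL := iter_loop_path n wl.
  have le : (size p <= size (flatten (nseq n (loop w))))%N.
    rewrite size_flatten /shape map_nseq sumn_nseq mulnC leq_pmulr //.
    by case: (loop w) lN.
  have E := emits_one_unique h wp wL le; rewrite E in wL.
  by exists (drop (size p) (flatten (nseq n (loop w)))); split;
     [apply: path_catl wL|rewrite size_cat leq_addr].
have [q [zq _]] := back; have rzw : reaches z w by exists q.
split => //; split; last by move=> x zx; apply: h; apply: reaches_trans zx; exists p.
exists (q ++ loop w ++ p); split; last by apply: path_catI zq (path_catI wl wp).
by case: q {zq} => //; case: (loop w) lN.
Qed.

Lemma loop_rotate_size w z : cyclic w -> reaches w z ->
  (size (loop z) <= size (loop w))%N.
Proof.
move=> cw wz; have [[lN wl] _] := cyclic_loop cw; have [_ h] := cw.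
have [cz _] := cyclic_reach cw wz; have [_ zmin] := cyclic_loop cz.
have [p wp] := wz; have wlp := path_catI wl wp.
have E : loop w ++ p = p ++ drop (size p) (loop w ++ p).
  by apply: emits_one_unique wp wlp _; rewrite // size_cat leq_addl.
have sz : size (drop (size p) (loop w ++ p)) = size (loop w).
  by rewrite size_drop size_cat addnK.
rewrite -sz; apply: zmin; split; first by move/(congr1 size); rewrite sz; case: (loop w) lN.
by rewrite E in wlp; apply: path_catl wlp.
Qed.

(** [loop_rotate_size], used in both directions, shows that the loops at [w] and [z] have the same
    length; both sides are then paths of equal length from a vertex after which nothing branches. *)
Lemma loop_rotate w z p : cyclic w -> path w p z -> loop w ++ p = p ++ loop z.
Proof.
move=> cw wp; have wz : reaches w z by exists p.
have [cz zw] := cyclic_reach cw wz.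
have sz : size (loop w) = size (loop z).
  by apply/eqP; rewrite eqn_leq !loop_rotate_size.
have [[_ wl] _] := cyclic_loop cw; have [[_ zl] _] := cyclic_loop cz.
by apply: (cyclic_unique cw (path_catI wl wp) (path_catI wp zl));
  rewrite !size_cat sz addnC.
Qed.

(** Suppose no vertex mutually reachable with [w] branches. By induction along a path from [w], each
    vertex has a nonempty way back to [w], whose first edge must be the next edge of the path. So
    every reachable vertex returns to [w] and emits one edge. *)
Lemma branching_or_cyclic w p : closed_path w p ->
  cyclic w \/ exists z e f, [/\ reaches w z, reaches z w, e <> f,
    pein e /\ psrc e = z & pein f /\ psrc f = z].
Proof.
move=> wp; have [[z [e [f h]]]|no] := pselect (exists z e f, [/\ reaches w z,
  reaches z w, e <> f, pein e /\ psrc e = z & pein f /\ psrc f = z]).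
  by right; exists z, e, f.
left; split; first by exists p.
have one z : reaches w z -> reaches z w -> emits_one z.
  move=> wz zw e f pe pf se sf; apply: contrapT => ef.
  by apply: no; exists z, e, f.
move=> z wz; apply: (one _ wz); case: wz => q.
elim/last_ind: q z => [|q e IH] z; first by move=> <-; apply: reaches_refl.
rewrite -cats1 => /path_cat [x wq [pe se <-]].
have [t xt] := IH _ wq.
have wx : reaches w x by exists q.
have [tp xtp] : exists2 t', t' <> [::] & path x t' w.
  exists (t ++ p); last by apply: path_catI xt _; case: wp.
  by case: wp => pN _; case: (t) => //; case: (p) pN.
case: tp xtp => // f tp _ [pf sf ft].
have <- : f = e by apply: (one x) => //; exists t.
by exists tp.
Qed.
End Paths.

(** * Leavitt families and the reduction theorem *)

(** All Leavitt relations except the sum at regular vertices. The elements attached to the quotient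
    graph satisfy these already in [L], before any quotient is taken. *)
Record toeplitz_family (B : pzRingType) (V E : eqType) (s r : E -> V)
  (fv : V -> B) (fe fs : E -> B) : Prop := ToeplitzFamily {
  tf_vv : forall v w, fv v * fv w = if v == w then fv v else 0;
  tf_se : forall e, fv (s e) * fe e = fe e;
  tf_er : forall e, fe e * fv (r e) = fe e;
  tf_rs : forall e, fv (r e) * fs e = fs e;
  tf_ss : forall e, fs e * fv (s e) = fs e;
  tf_sfe : forall e f, fs e * fe f = if e == f then fv (r e) else 0 }.

(** Vertices are indexed by a whole type, but exactly those in [vin] have nonzero value; in this way
    the quotient graph can sit inside [V + V]. *)
Record leavitt_family (B : pzRingType) (V E : eqType) (vin : V -> Prop)
  (ein : E -> Prop) (s r : E -> V) (fv : V -> B) (fe fs : E -> B) : Prop :=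
  LeavittFamily {
  lf_toeplitz : toeplitz_family s r fv fe fs;
  lf_vin : forall v, vin v <-> fv v <> 0;
  lf_ein : forall e, ein e <-> vin (r e);
  lf_ck2 : forall v l, uniq l -> l <> [::] -> (forall e, e \in l <-> ein e /\ s e = v) ->
    fv v = \sum_(e <- l) fe e * fs e }.

(** The start vertex is an argument so that the empty path at [u] has the value [fv u]. *)
HB.lock Definition pth (B : pzRingType) (V E : Type) (fv : V -> B) (fe : E -> B)
  (u : V) (p : seq E) : B := fv u * foldr (fun e x => fe e * x) 1 p.
HB.lock Definition gst (B : pzRingType) (V E : Type) (fv : V -> B) (fs : E -> B)
  (u : V) (p : seq E) : B := foldr (fun e x => x * fs e) 1 p * fv u.

Section Toeplitz.
Variables (B : pzRingType) (V E : eqType) (vin : V -> Prop) (ein : E -> Prop).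
Variables (s r : E -> V) (fv : V -> B) (fe fs : E -> B).
Hypothesis TF : toeplitz_family s r fv fe fs.
Let G := PGraph vin ein s r.
Local Notation path := (@path_from G).
Implicit Types (u v w : V) (e f : E) (p q : seq E).

Local Notation pth := (pth fv fe).
Local Notation gst := (gst fv fs).

Lemma fvv v : fv v * fv v = fv v. Proof. by rewrite (tf_vv TF) eqxx. Qed.
Lemma fvw v w : v <> w -> fv v * fv w = 0.
Proof. by move=> /eqP vw; rewrite (tf_vv TF) (negbTE vw). Qed.

Lemma pth_nil u : pth u [::] = fv u. Proof. by rewrite pth.unlock /= mulr1. Qed.
Lemma gst_nil u : gst u [::] = fv u. Proof. by rewrite gst.unlock /= mul1r. Qed.
Lemma pth_cons e p : pth (s e) (e :: p) = fe e * pth (r e) p.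
Proof. by rewrite pth.unlock /= mulrA (tf_se TF) mulrA (tf_er TF). Qed.
Lemma gst_cons e p : gst (s e) (e :: p) = gst (r e) p * fs e.
Proof. by rewrite gst.unlock /= -mulrA (tf_ss TF) -mulrA (tf_rs TF). Qed.
Lemma pth_src u p : fv u * pth u p = pth u p.
Proof. by rewrite pth.unlock mulrA fvv. Qed.
Lemma gst_src u p : gst u p * fv u = gst u p.
Proof. by rewrite gst.unlock -mulrA fvv. Qed.

Lemma pth_cat u p q w : path u p w -> pth u (p ++ q) = pth u p * pth w q.
Proof.
elim: p u => [|e p IH] u /=; first by move=> ->; rewrite pth_nil pth_src.
by case=> _ <- ep; rewrite !pth_cons (IH _ ep) mulrA.
Qed.

Lemma gst_cat u p q w : path u p w -> gst u (p ++ q) = gst w q * gst u p.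
Proof.
elim: p u => [|e p IH] u /=; first by move=> ->; rewrite gst_nil gst_src.
by case=> _ <- ep; rewrite !gst_cons (IH _ ep) mulrA.
Qed.

Lemma pth_tgt u p w : path u p w -> pth u p * fv w = pth u p.
Proof. by move=> up; rewrite -[in RHS](cats0 p) (pth_cat _ up) pth_nil. Qed.
Lemma gst_tgt u p w : path u p w -> fv w * gst u p = gst u p.
Proof. by move=> up; rewrite -[in RHS](cats0 p) (gst_cat _ up) gst_nil. Qed.

Lemma gst_pth u p w : path u p w -> gst u p * pth u p = fv w.
Proof.
elim: p u => [|e p IH] u /=; first by move=> ->; rewrite pth_nil gst_nil fvv.
case=> _ <- ep; rewrite pth_cons gst_cons -mulrA (mulrA (fs e)) (tf_sfe TF) eqxx.
by rewrite pth_src IH.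
Qed.

Lemma gst_pth_catr u p q w : path u p w -> gst u p * pth u (p ++ q) = pth w q.
Proof. by move=> up; rewrite (pth_cat _ up) mulrA (gst_pth up) pth_src. Qed.

Lemma gst_pth_neq u v p q : u <> v -> gst u p * pth v q = 0.
Proof. by move=> uv; rewrite -gst_src -pth_src -mulrA (mulrA (fv u)) fvw // mul0r mulr0. Qed.

Lemma gst_pth_cases u p q w w' : path u p w -> path u q w' ->
  [\/ gst u p * pth u q = 0, exists t, q = p ++ t | exists t, p = q ++ t].
Proof.
elim: p u q => [|e p IH] u [|f q] /=.
- by move=> _ _; apply: Or32; exists [::].
- by move=> _ _; apply: Or32; exists (f :: q).
- by move=> _ _; apply: Or33; exists (e :: p).
case=> pe <- ep [pf sf fq].
have [ef|ef] := eqVneq e f; last first.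
  apply: Or31; rewrite gst_cons -sf pth_cons -mulrA (mulrA (fs e)) (tf_sfe TF).
  by rewrite (negbTE ef) mul0r mulr0.
rewrite -ef in fq *.
have [h|[t ->]|[t ->]] := IH _ _ ep fq; [|by apply: Or32; exists t|by apply: Or33; exists t].
apply: Or31; rewrite gst_cons pth_cons -mulrA (mulrA (fs e)) (tf_sfe TF) eqxx.
by rewrite pth_src.
Qed.

Lemma fs_pth e u p w : path u p w -> p <> [::] -> ohead p <> Some e -> fs e * pth u p = 0.
Proof.
case: p => //= f p [_ <- _] _ ef; rewrite pth_cons mulrA (tf_sfe TF).
by case: eqP ef => [->|]; rewrite ?mul0r.
Qed.

Lemma gst_fe e u p w : path u p w -> p <> [::] -> ohead p <> Some e -> gst u p * fe e = 0.
Proof.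
case: p => //= f p [_ <- _] _ ef; rewrite gst_cons -mulrA (tf_sfe TF).
by case: eqP ef => [->|]; rewrite ?mulr0.
Qed.

Lemma feM e f : (fe e * fs e) * (fe f * fs f) = if e == f then fe e * fs e else 0.
Proof.
rewrite -mulrA (mulrA (fs e)) (tf_sfe TF); case: eqP => [->|_]; last by rewrite mul0r mulr0.
by rewrite (tf_rs TF).
Qed.
End Toeplitz.

Definition loop_el (B : pzRingType) (V E : Type) (vin : V -> Prop) (ein : E -> Prop)
  (s r : E -> V) (fv : V -> B) (fe : E -> B) (w : V) : B :=
  pth fv fe w (loop (G := PGraph vin ein s r) w).

(** The factor [fv w] moves the value into the corner at [w], where [fv w] is the unit. *)
HB.lock Definition lpeval (K : fieldType) (B : pzRingType) (kap : {rmorphism K -> B})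
  (V E : Type) (vin : V -> Prop) (ein : E -> Prop) (s r : E -> V)
  (fv : V -> B) (fe : E -> B) (w : V) (f : {poly K}) : B :=
  peval kap (loop_el vin ein s r fv fe w) f * fv w.

Section ToeplitzEval.
Variables (K : fieldType) (B : pzRingType) (kap : {rmorphism K -> B}).
Hypothesis kapC : forall k x, kap k * x = x * kap k.
Variables (V E : eqType) (vin : V -> Prop) (ein : E -> Prop).
Variables (s r : E -> V) (fv : V -> B) (fe fs : E -> B).
Hypothesis TF : toeplitz_family s r fv fe fs.
Let G := PGraph vin ein s r.
Local Notation path := (@path_from G).
Local Notation loop_el := (loop_el vin ein s r fv fe).
Local Notation lpeval := (lpeval kap vin ein s r fv fe).
Implicit Types (w : V) (f g : {poly K}).

Lemma loop_el_comm w : path w (loop (G := G) w) w -> fv w * loop_el w = loop_el w * fv w.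
Proof. by move=> wl; rewrite /loop_el (pth_src TF) (pth_tgt TF wl). Qed.

Lemma lpeval_src w f : path w (loop (G := G) w) w -> fv w * lpeval w f = lpeval w f.
Proof.
move=> wl; rewrite lpeval.unlock mulrA (peval_com kapC) ?loop_el_comm //.
by rewrite -mulrA (fvv TF).
Qed.

Lemma lpeval_tgt w f : lpeval w f * fv w = lpeval w f.
Proof. by rewrite lpeval.unlock -mulrA (fvv TF). Qed.

Lemma lpeval_mul w f g : path w (loop (G := G) w) w ->
  lpeval w (f * g) = lpeval w f * lpeval w g.
Proof.
move=> wl; have cg := peval_com kapC g (loop_el_comm wl).
by rewrite lpeval.unlock (pevalM kapC) -!mulrA -cg (mulrA (fv w)) (fvv TF) cg.
Qed.
End ToeplitzEval.

(** * Reduction to vertices and loop polynomials *)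

Section Leavitt.
Variables (K : fieldType) (B : pzRingType) (kap : {rmorphism K -> B}).
Hypothesis kapC : forall k x, kap k * x = x * kap k.
Variables (V E : choiceType) (vin : V -> Prop) (ein : E -> Prop).
Variables (s r : E -> V) (fv : V -> B) (fe fs : E -> B).
Hypothesis LF : leavitt_family vin ein s r fv fe fs.
Let TF := lf_toeplitz LF.
Let G := PGraph vin ein s r.
Local Notation path := (@path_from G).
Local Notation pth := (pth fv fe).
Local Notation gst := (gst fv fs).
Implicit Types (u v w : V) (e f : E) (p q : seq E).

Lemma path_vin u p w : path u p w -> vin u -> vin w.
Proof.
by elim: p u => [|e p IH] u /=; [move=> ->|case=> /(lf_ein LF) re _ /IH h _; apply: h].
Qed.

(** A scalar and two based paths p, q, standing for the monomial k p q^* ; [rterm] below is the case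
    without ghost part. *)
Definition term := (K * ((V * seq E) * (V * seq E)))%type.
Definition mon_val (t : term) : B := kap t.1 * (pth t.2.1.1 t.2.1.2 * gst t.2.2.1 t.2.2.2).
Definition mon_ok (t : term) :=
  exists w, path t.2.1.1 t.2.1.2 w /\ path t.2.2.1 t.2.2.2 w.
Definition spanned x :=
  exists2 l : seq term, (forall t, t \in l -> mon_ok t) & x = \sum_(t <- l) mon_val t.

Definition rterm := (K * (V * seq E))%type.
Definition rval (t : rterm) : B := kap t.1 * pth t.2.1 t.2.2.
Definition real v (l : seq rterm) := forall t, t \in l -> path t.2.1 t.2.2 v.

Local Notation loop_el := (loop_el vin ein s r fv fe).
Local Notation lpeval := (lpeval kap vin ein s r fv fe).

Definition reduced y w :=
  (exists2 k, k <> 0 & y = kap k * fv w) \/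
  (cyclic (G := G) w /\ exists f : {poly K}, y = lpeval w f).
Definition reducible x := exists u p w u' q,
  [/\ path u p w, path u' q w, gst u p * x * pth u' q <> 0 &
      reduced (gst u p * x * pth u' q) w].

(** Products of paths or ghost paths whose endpoints do not match are 0, so nonvanishing lets the
    inner paths be appended to the outer ones. *)
Lemma reducible_corner u p w u' q v x : path u p w -> path u' q v ->
  reducible (gst u p * x * pth u' q) -> reducible x.
Proof.
move=> up uq [z [p' [z' [y [q' [zp yq nz red]]]]]].
have wz : w = z.
  apply: contrapT => wz; apply: nz.
  by rewrite -(gst_tgt TF up) -(gst_src TF z) -!mulrA
     (mulrA (fv z)) (fvw TF (nesym wz)) mul0r mulr0.
have vy : v = y.
  apply: contrapT => vy; apply: nz.
  by rewrite -(pth_tgt TF uq) -(pth_src TF y) -!mulrA (mulrA (fv v))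
     (fvw TF vy) mul0r !mulr0.
rewrite -{}wz -{}vy in zp yq nz red.
have E1 : gst w p' * (gst u p * x * pth u' q) * pth v q' =
    gst u (p ++ p') * x * pth u' (q ++ q').
  by rewrite (gst_cat TF _ up) (pth_cat TF _ uq) !mulrA.
rewrite E1 in nz red.
by exists u, (p ++ p'), z', u', (q ++ q'); split => //; apply: path_catI; eassumption.
Qed.

Lemma reducible_left u p w x : path u p w -> reducible (gst u p * x) -> reducible x.
Proof.
move=> up [z [p' [z' [y [q' [zp yq nz red]]]]]].
apply: (@reducible_corner u p w y [::] y) => //.
exists z, p', z', y, q'; rewrite pth_nil.
have <- : gst z p' * (gst u p * x) * pth y q' = gst z p' * (gst u p * x * fv y) * pth y q'.
  by rewrite -!mulrA (pth_src TF).
by [].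
Qed.

Lemma real_edge_tail e (l : seq rterm) v : real v l ->
  (forall t, t \in l -> exists2 p', t.2.2 = e :: p' & t.2.1 = s e) ->
  real v [seq (t.1, (r e, behead t.2.2)) | t <- l].
Proof.
move=> rl hl _ /mapP[t tl ->] /=; have := rl _ tl.
by have [p' -> ->] := hl _ tl => -[].
Qed.

Lemma rval_src t : fv t.2.1 * rval t = rval t.
Proof. by rewrite /rval mulrA -kapC -mulrA (pth_src TF). Qed.

Lemma mon_val_src t : fv t.2.1.1 * mon_val t = mon_val t.
Proof. by rewrite /mon_val mulrA -kapC -mulrA (mulrA (fv _)) (pth_src TF). Qed.

Lemma mon_val_tgt t : mon_val t * fv t.2.2.1 = mon_val t.
Proof. by rewrite /mon_val -!mulrA (gst_src TF). Qed.

Lemma sum_corner (T : eqType) (l : seq T) (F : T -> B) (c : T -> V) v :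
  (forall t, t \in l -> fv (c t) * F t = F t) ->
  fv v * (\sum_(t <- l) F t) = \sum_(t <- l | c t == v) F t.
Proof.
move=> h; rewrite mulr_sumr [RHS]big_mkcond /=; apply: eq_big_seq => t tl.
rewrite -(h _ tl) mulrA (tf_vv TF) eq_sym.
by case: eqP => [->|]; rewrite ?h ?mul0r.
Qed.

(* A left multiple of [y] by a ghost path turns its shortest monomial into a vertex. *)
Lemma real_normal_form n v (l : seq rterm) : real v l ->
  (forall t, t \in l -> (size t.2.2 < n)%N) -> \sum_(t <- l) rval t <> 0 ->
  exists u p k (l' : seq rterm),
  [/\ path u p v, k <> 0, gst u p * (\sum_(t <- l) rval t) <> 0,
      forall t, t \in l' -> t.2.1 = v /\ closed_path (G := G) v t.2.2 &
      gst u p * (\sum_(t <- l) rval t) = kap k * fv v + \sum_(t <- l') rval t].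
Proof.
elim: n l => [|n IH] l rl ln nz.
  by case: nz; rewrite big_seq big_pred0 // => t; apply/negP => /ln.
have [t0 _ nz1] := support_left (tf_vv TF) (fun t (_ : t \in l) => rval_src t) nz.
move: t0.2.1 nz1 => u nz1.
have Eu := sum_corner u (fun t (_ : t \in l) => rval_src t).
pose k0 := \sum_(t <- l | (t.2.1 == u) && (t.2.2 == [::])) t.1.
have nilE : \sum_(t <- l | (t.2.1 == u) && (t.2.2 == [::])) rval t = kap k0 * fv u.
  rewrite rmorph_sum mulr_suml; apply: eq_bigr => -[k [u' p]] /= /andP[/eqP-> /eqP->].
  by rewrite /rval /= pth_nil.
have Esplit : fv u * (\sum_(t <- l) rval t) = kap k0 * fv u +
   \sum_(t <- l | (t.2.1 == u) && (t.2.2 != [::])) rval t.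
  by rewrite Eu (bigID (fun t : rterm => t.2.2 == [::])) /= nilE.
(* All the paths end at [v], so one of length zero can only start there. *)
have k0v : k0 <> 0 -> u = v.
  move=> nk; apply: contrapT => uv; apply: nk; rewrite /k0 big_seq_cond big_pred0 //.
  move=> t; apply/negP => /andP[/rl + /andP[/eqP tu /eqP tn]]; rewrite tn tu.
  by move=> /uv.
have [k00|/eqP k0n] := eqVneq k0 0; last first.
  have uv := k0v k0n; rewrite -{}uv in rl *.
  exists u, [::], k0, [seq t <- l | (t.2.1 == u) && (t.2.2 != [::])];
    split => //; rewrite ?gst_nil ?big_filter //.
  move=> t; rewrite mem_filter => /andP[/andP[/eqP tu /eqP tn] /rl]; rewrite tu.
  by split.
rewrite k00 rmorph0 mul0r add0r in Esplit.
have nz2 := nz1; rewrite Esplit -big_filter in nz2.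
set l1 := [seq _ <- _ | _] in nz2.
have l1P t : t \in l1 -> [/\ t \in l, t.2.1 = u & exists e p, t.2.2 = e :: p /\ s e = u].
  rewrite mem_filter => /andP[/andP[/eqP tu tn] tl]; split => //.
  by have := rl _ tl; rewrite tu; case: (t.2.2) tn => // e p _ [_ se _]; exists e, p.
have [d0|[e0 _]] : l1 = [::] \/ exists e : E, True.
- case: (l1) l1P => [|t l2] h; first by left.
  by have [_ _ [e _]] := h t (mem_head _ _); right; exists e.
- by rewrite d0 big_nil in nz2.
pose hd (t : rterm) := head e0 t.2.2.
have hdP t : t \in l1 -> (fe (hd t) * fs (hd t)) * rval t = rval t.
  case: t => k [u' p] /l1P [/= tl -> [e [q [pE se]]]]; rewrite /hd /= pE /rval /=.
  rewrite -se (pth_cons TF) mulrA -kapC -!mulrA (mulrA (fs e)) (tf_sfe TF) eqxx.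
  by rewrite (pth_src TF).
(* The elements e e^* are orthogonal idempotents, so for some first edge [e] multiplication by its
   ghost keeps the sum nonzero. It shortens the paths beginning with [e] by one and kills the
   others. *)
have [t1 t1l nz3] := support_left (feM TF) hdP nz2.
have [t1l' t1u [e [p1 [pE se]]]] := l1P _ t1l.
have pe : ein e by have := rl _ t1l'; rewrite pE => -[].
have he : hd t1 = e by rewrite /hd pE.
rewrite {}he -mulrA in nz3.
pose l2 := [seq (t.1, (r e, behead t.2.2)) | t <- [seq t <- l1 | hd t == e]].
have E2 : fs e * (\sum_(t <- l1) rval t) = \sum_(t <- l2) rval t.
  rewrite big_map [RHS]big_filter mulr_sumr [RHS]big_mkcond /=; apply: eq_big_seq => t tl.
  have [tl' tu [f [q [tE sf]]]] := l1P _ tl.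
  case: t tl tl' tu tE => k [u' p] /= tl tl' -> ->; rewrite /hd /=.
  rewrite /rval /= -sf (pth_cons TF) mulrA -kapC -mulrA (mulrA (fs e)) (tf_sfe TF) eq_sym.
  by case: eqP => [->|]; rewrite ?(pth_src TF) ?mul0r ?mulr0.
have l2P t : t \in [seq t <- l1 | hd t == e] -> [/\ t \in l, t.2.1 = s e &
    exists p, t.2.2 = e :: p].
  rewrite mem_filter => /andP[/eqP th /l1P [? ? [f [p [tE _]]]]]; rewrite se; split => //.
  by exists p; rewrite tE; move: th; rewrite /hd tE /= => ->.
have E3 : fs e * (\sum_(t <- l) rval t) = \sum_(t <- l2) rval t.
  by rewrite -E2 /l1 big_filter -Esplit -{1}(tf_ss TF) se -mulrA.
have [||| u2 [p2 [k [l' [up2 kn nz4 hl' E4]]]]] := IH l2.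
- apply: real_edge_tail => t /l2P [tl ts [p tE]]; first exact: rl.
  by exists p.
- move=> _ /mapP[t /l2P [/ln + _ [p tE]] ->] /=; rewrite tE /=.
  by rewrite ltnS.
- by move=> z; apply: nz3; rewrite E2 z mulr0.
have u2e : u2 = r e.
  apply: contrapT => ne; apply: nz4.
  by rewrite -E3 -(gst_src TF) -(tf_rs TF) -!mulrA (mulrA (fv _)) (fvw TF) ?mul0r ?mulr0.
rewrite u2e in up2 nz4 E4; rewrite -E3 mulrA -(gst_cons TF) se in nz4 E4.
by exists u, (e :: p2), k, l'; split.
Qed.

Lemma flatten_nseqC (T : Type) m n (p : seq T) :
  flatten (nseq m p) ++ flatten (nseq n p) = flatten (nseq n p) ++ flatten (nseq m p).
Proof. by rewrite -!flatten_cat -!nseqD addnC. Qed.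

(* A path that winds [N] times around the shortest loop at [w] and then leaves it cannot be continued from itself after a closed path shorter than the winding. *)
Lemma winding_not_periodic v t w d N a (f : E) h :
  path v t w -> shortest_closed (G := G) w a -> ohead a <> Some f ->
  closed_path (G := G) v d -> (size d <= N)%N ->
  d ++ t ++ flatten (nseq N a) ++ [:: f] <> (t ++ flatten (nseq N a) ++ [:: f]) ++ h.
Proof.
move=> vt sa af [dN vd] dle E0.
have aN : a <> [::] by case: sa => -[].
set A := flatten (nseq N a) in E0.
have sA : (N <= size A)%N.
  rewrite size_flatten /shape map_nseq sumn_nseq mulnC leq_pmulr //.
  by case: (a) aN.
pose d' := take (size d) A.
have sd' : size d' = size d by rewrite size_takel // (leq_trans dle).
(* Compare the prefixes of length |d| + |t| in [E0]. Since [N] is at least |d|, what follows [t]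
   there lies entirely within the windings [A]. *)
have E1 : d ++ t = t ++ d'.
  have := congr1 (take (size d + size t)) E0.
  rewrite catA -size_cat take_size_cat // => ->.
  rewrite size_cat addnC -catA take_cat ltnNge leq_addr /= addKn; congr (_ ++ _).
  by rewrite -catA takel_cat // (leq_trans dle).
have wd' : path w d' w.
  by apply: (path_catl vt); rewrite -E1; apply: path_catI vd vt.
have [|m Em] := prefix_closed_power (n := N) sa wd'.
  by exists (drop (size d) A); rewrite cat_take_drop.
(* As powers of [a] commute, cancelling [t] and [A] leaves the equality of [d'] followed by [f] with
   [f] followed by [h]. Here [d'] is a nonzero power of [a], so [a] would begin with [f]. *)
move: E0; rewrite catA E1 -!catA => /(congr1 (drop (size t))).
rewrite !drop_size_cat // Em catA flatten_nseqC -/A -catA => /(congr1 (drop (size A))).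
rewrite !drop_size_cat //.
case: m Em => [|m] Em.
  by move: sd'; rewrite Em /=; case: (d) dN.
by case: (a) aN af => //= b l _ af [ba _]; apply: af; rewrite ba.
Qed.

Lemma kap_fv_neq0 k v : vin v -> k <> 0 -> kap k * fv v <> 0.
Proof.
move=> /(lf_vin LF) nv /eqP kn h; apply: nv.
by rewrite -[fv v]mul1r -(rmorph1 kap) -(mulVf kn) rmorphM -mulrA h mulr0.
Qed.

Lemma loop_power w n : path w (loop (G := G) w) w ->
  pth w (flatten (nseq n (loop (G := G) w))) = loop_el w ^+ n * fv w.
Proof.
move=> wl; elim: n => [|n IH]; first by rewrite /= pth_nil mul1r.
by rewrite [in LHS]/= (pth_cat TF _ wl) IH exprS mulrA.
Qed.

Lemma lpevalD w (f g : {poly K}) : lpeval w (f + g) = lpeval w f + lpeval w g.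
Proof. by rewrite lpeval.unlock pevalD mulrDl. Qed.

Lemma lpeval_corner w (f : {poly K}) : path w (loop (G := G) w) w -> fv w * lpeval w f * fv w = lpeval w f.
Proof.
by move=> wl; rewrite (lpeval_src kapC TF _ wl) (lpeval_tgt _ _ _ TF).
Qed.

Lemma real_cyclic v (l : seq rterm) : cyclic (G := G) v ->
  (forall t, t \in l -> t.2.1 = v /\ path v t.2.2 v) ->
  exists f : {poly K}, \sum_(t <- l) rval t = lpeval v f.
Proof.
move=> cv; elim: l => [|t l IH] hl.
  by exists 0; rewrite big_nil lpeval.unlock peval0 mul0r.
have [|f Ef] := IH; first by move=> t' t'l; apply: hl; rewrite inE t'l orbT.
have [tv vt] := hl _ (mem_head _ _); have [n En] := cyclic_closed_power cv vt.
exists (t.1%:P * 'X^n + f); rewrite big_cons Ef lpevalD; congr (_ + _).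
rewrite /rval tv En lpeval.unlock pevalCM pevalXn loop_power ?mulrA //.
by case: (cyclic_loop cv) => -[].
Qed.

(** The normal form is k v plus closed paths at [v]. If [v] is cyclic, this is a polynomial in the
    loop. Otherwise some vertex on the way branches, and compression by a path [g] that winds around
    a loop longer than all these closed paths and then leaves it kills everything except k v. *)
Lemma reducible_real v (l : seq rterm) : real v l -> \sum_(t <- l) rval t <> 0 ->
  vin v -> reducible (\sum_(t <- l) rval t).
Proof.
move=> rl nz vv.
have [|u [p [k [l' [up kn nz' hl' E0]]]]] :=
  @real_normal_form (\max_(t <- l) size t.2.2).+1 v l rl _ nz.
  by move=> t tl; rewrite ltnS; apply: (leq_bigmax_seq (F := fun t : rterm => size t.2.2) _ tl).
apply: (reducible_left up); rewrite E0 in nz' *.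
case: l' hl' E0 nz' => [|t0 l'] hl' _ nz'.
  rewrite big_nil addr0 in nz' *; exists v, [::], v, v, [::].
  rewrite gst_nil pth_nil mulrA -kapC -!mulrA !(fvv TF).
  by split => //; left; exists k.
have [_ cd0] := hl' _ (mem_head _ _).
have [cv|[w [e [f [[t vt] [t' wt'] ef [pe se] [pf sf]]]]]] := branching_or_cyclic cd0.
  have [|g Eg] := @real_cyclic v (t0 :: l') cv; first by move=> t /hl' [? []].
  have [[_ vl] _] := cyclic_loop cv.
  have Eg' : kap k * fv v + \sum_(t <- t0 :: l') rval t = lpeval v (k%:P + g).
    by rewrite lpevalD Eg lpeval.unlock pevalC.
  exists v, [::], v, v, [::]; rewrite gst_nil pth_nil Eg' lpeval_corner // -Eg'.
  by split => //; right; split => //; exists (k%:P + g).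
have cw : closed_path (G := G) w (t' ++ t0.2.2 ++ t).
  split; last by apply: path_catI wt' (path_catI _ vt); case: cd0.
  by case: cd0; case: (t0.2.2) => // a b _ _; case: (t').
have sa := loopP cw; set a := loop w in sa.
(* Two distinct edges leave [w], so one of them is not the first edge of the loop. *)
have [f1 [pf1 sf1 af1]] : exists f1, [/\ ein f1, s f1 = w & ohead a <> Some f1].
  have [ae|ne] := pselect (ohead a = Some e).
    by exists f; split => //; rewrite ae => -[].
  by exists e.
pose N := \max_(t <- t0 :: l') size t.2.2.
pose g := t ++ flatten (nseq N a) ++ [:: f1].
have vg : path v g (r f1).
  have [[_ wa] _] := sa; apply: (path_catI vt).
  by apply: (path_catI (iter_loop_path N wa)); split.
exists v, g, (r f1), v, g.
suff -> : gst v g * (kap k * fv v + \sum_(t <- t0 :: l') rval t) * pth v g =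
    kap k * fv (r f1).
  split => //; last by left; exists k.
  exact: (kap_fv_neq0 (path_vin vg vv) kn).
rewrite mulrDr mulrDl mulr_sumr mulr_suml big_seq big1 ?addr0.
  by rewrite mulrA -kapC -!mulrA (pth_src TF) (gst_pth TF vg).
move=> [kt [u' d]] tl; have [/= -> vd] := hl' _ tl; rewrite /rval /=.
have vd' := vd.2; rewrite mulrA -kapC -!mulrA -(pth_cat TF _ vd').
have [->|[h]|[h]] := gst_pth_cases TF vg (path_catI vd' vg).
- by rewrite mulr0.
- move=> Eh; case: (winding_not_periodic (h := h) vt sa af1 vd _ Eh).
  exact: (leq_bigmax_seq (F := fun t : rterm => size t.2.2) _ tl).
- move/(congr1 size)/eqP; rewrite !size_cat => /eqP.
  by case: (d) vd.1 => // b d1 _ /=; rewrite -addnA => /esym /eqP; lia.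
Qed.

Lemma emits_finitelyP v : emits_finitely (G := G) v <->
  exists2 l, uniq l & forall e, e \in l <-> ein e /\ s e = v.
Proof.
split=> [[l hl]|[l _ hl]]; last by exists l => e pe se; apply/InP/hl.
exists (undup [seq e <- l | `[< ein e /\ s e = v >]]); first exact: undup_uniq.
move=> e; rewrite mem_undup mem_filter; split; first by case/andP => /asboolP.
by move=> [pe se]; apply/andP; split; [apply/asboolP|apply/InP/hl].
Qed.

Lemma reducible_right u q w x : path u q w -> reducible (x * pth u q) -> reducible x.
Proof.
move=> uq [z [p' [z' [y [q' [zp yq nz red]]]]]].
apply: (@reducible_corner z [::] z u q w) => //.
exists z, p', z', y, q'; rewrite gst_nil.
have <- : gst z p' * (x * pth u q) * pth y q' = gst z p' * (fv z * x * pth u q) * pth y q'.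
  by rewrite -!mulrA (mulrA (gst z p') (fv z)) (gst_src TF).
by [].
Qed.

(** Induction on the length of the ghost parts: right multiplication by an edge shortens them, as
    long as some edge does not kill [x]. If all do, [v] is an infinite emitter, and an edge avoiding
    the finitely many paths involved isolates a multiple of a vertex. *)
Lemma reducible_span n (l : seq term) : (forall t, t \in l -> mon_ok t) ->
  (forall t, t \in l -> (size t.2.2.2 < n)%N) -> \sum_(t <- l) mon_val t <> 0 ->
  reducible (\sum_(t <- l) mon_val t).
Proof.
elim: n l => [|n IH] l gl ln nz.
  by case: nz; rewrite big_seq big_pred0 // => t; apply/negP => /ln.
set x := \sum_(t <- l) mon_val t.
have [t0 _ nz1] := support_right (tf_vv TF) (fun t (_ : t \in l) => mon_val_tgt t) nz.
move: t0.2.2.1 nz1 => v; rewrite -/x => nz1.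
have vv : vin v by apply/(lf_vin LF) => v0; apply: nz1; rewrite v0 mulr0.
pose l0 := [seq t <- l | (t.2.2.1 == v) && (t.2.2.2 == [::])].
pose l1 := [seq t <- l | (t.2.2.1 == v) && (t.2.2.2 != [::])].
have Ex : x * fv v = \sum_(t <- l0) mon_val t + \sum_(t <- l1) mon_val t.
  rewrite !big_filter -(bigID (fun t : term => t.2.2.2 == [::]) (fun t => t.2.2.1 == v)) /=.
  rewrite mulr_suml [RHS]big_mkcond /=; apply: eq_bigr => t _.
  by rewrite -mon_val_tgt -mulrA (tf_vv TF); case: eqP; rewrite ?mon_val_tgt ?mulr0.
have l0P t : t \in l0 -> [/\ path t.2.1.1 t.2.1.2 v, t.2.2.1 = v & t.2.2.2 = [::]].
  rewrite mem_filter => /andP[/andP[/eqP tv /eqP tn] /gl [w []]].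
  by rewrite tv tn /= => p1 vw; rewrite vw.
have l1P t : t \in l1 -> [/\ mon_ok t, (size t.2.2.2 < n.+1)%N, t.2.2.1 = v &
    exists e q, t.2.2.2 = e :: q].
  rewrite mem_filter => /andP[/andP[/eqP tv tn] tl]; split => //; [exact: gl|exact: ln|].
  by case: (t.2.2.2) tn => // e q _; exists e, q.
pose l0r : seq rterm := [seq (t.1, t.2.1) | t <- l0].
have E0 : \sum_(t <- l0) mon_val t = \sum_(t <- l0r) rval t.
  rewrite big_map; apply: eq_big_seq => t /l0P [tp tv tn].
  by rewrite /mon_val /rval /= tv tn gst_nil (pth_tgt TF tp).
have rl0 : real v l0r by move=> _ /mapP[t /l0P [tp _ _] ->].
(* The bound [0 < n] is kept because, after multiplication by an edge, the terms without ghost part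
   still have ghost length 0 and must satisfy the strict bound of the induction. *)
have [l1n|[e0 [n0 e0v]]] : l1 = [::] \/ exists e0, (0 < n)%N /\ ein e0 /\ s e0 = v.
- case: (l1) l1P => [|t l1'] h; first by left.
  have [[w [_ tw]] tn tv [e [q tE]]] := h t (mem_head _ _).
  right; exists e; move: tw tn; rewrite tE tv /= => -[pe se _].
  by rewrite !ltnS => /(leq_ltn_trans _) -> //.
- rewrite E0 l1n big_nil addr0 in Ex; rewrite Ex in nz1.
  apply: (@reducible_right v [::] v) => //.
  by rewrite pth_nil Ex; exact: (reducible_real rl0 nz1 vv).
have [[e [[pe se] nze]]|no] := pselect (exists e, (ein e /\ s e = v) /\ x * fe e <> 0).
  pose l2 : seq term := [seq (t.1, ((t.2.1.1, t.2.1.2 ++ [:: e]), (r e, [::]))) | t <- l0]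
    ++ [seq (t.1, (t.2.1, (r e, behead t.2.2.2))) | t <- [seq t <- l1 | ohead t.2.2.2 == Some e]].
  have pe1 : path v [:: e] (r e) by split.
  have Exe : x * fe e = \sum_(t <- l2) mon_val t.
    rewrite -(tf_se TF) se mulrA Ex mulrDl big_cat /=; congr (_ + _).
      rewrite big_map mulr_suml; apply: eq_big_seq => t /l0P [tp tv tn].
      rewrite /mon_val /= tv tn !gst_nil (pth_tgt TF tp) (pth_cat TF _ tp) -se (pth_cons TF).
      by rewrite pth_nil -!mulrA (fvv TF) (tf_er TF).
    rewrite big_map [RHS]big_filter mulr_suml [RHS]big_mkcond /=; apply: eq_big_seq => t.
    move=> /l1P [[w [_ tw]] _ tv [f [q tE]]]; move: tw; rewrite tE tv /= => -[_ sf fq].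
    rewrite /mon_val /= tv tE -sf (gst_cons TF) -!mulrA (tf_sfe TF).
    case: (eqVneq f e) => [->|nef]; first by rewrite eqxx (gst_src TF).
    by rewrite !mulr0 (_ : Some f == Some e = (f == e)) // (negbTE nef).
  have red2 : reducible (x * fe e).
    rewrite Exe; apply: IH; last by rewrite -Exe.
      move=> t; rewrite mem_cat => /orP[] /mapP[t'].
        by move=> /l0P [tp _ _] -> /=; exists (r e); split => //=; apply: path_catI tp pe1.
      rewrite mem_filter => /andP[/eqP th /l1P [[w [tp tw]] _ tv [f [q tE]]]] -> /=.
      move: th tw; rewrite tE /= => -[->] [_ _ eq]; by exists w.
    move=> t; rewrite mem_cat => /orP[] /mapP[t'].
      by move=> _ -> /=.
    rewrite mem_filter => /andP[_ /l1P [_ + _ [f [q tE]]]] -> /=.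
    by rewrite tE.
  apply: (reducible_right pe1); rewrite -se (pth_cons TF) pth_nil (tf_er TF) //.
have allz e : ein e -> s e = v -> x * fe e = 0.
  by move=> pe se; apply: contrapT => h; apply: no; exists e.
have X1e e : e \notin [seq head e0 t.2.2.2 | t <- l1] -> (\sum_(t <- l1) mon_val t) * fe e = 0.
  move=> he; rewrite mulr_suml big_seq big1 // => t tl.
  have [[w [_ tw]] _ tv [f [q tE]]] := l1P _ tl.
  rewrite /mon_val -!mulrA (gst_fe TF tw) ?mulr0 ?tE // => -[hfe]; case/negP: he.
  by apply/mapP; exists t => //; rewrite tE.
(* At a vertex emitting finitely many edges, [fv v] is the sum of the e e^* , and then [x * fv v]
   would vanish. *)
have nfin : ~ emits_finitely (G := G) v.
  move=> /emits_finitelyP [lv ul lvP]; apply: nz1.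
  rewrite (lf_ck2 LF ul _ lvP); last by move=> l0n; have := (lvP e0).2 e0v; rewrite l0n.
  by rewrite mulr_sumr big_seq big1 // => e /lvP [pe se]; rewrite mulrA allz ?mul0r.
(* If the ghost-free part vanished, only terms with a ghost edge would remain, and some e e^* would
   preserve part of them, so that x e is nonzero. *)
have X0n : \sum_(t <- l0r) rval t <> 0.
  move=> X00; rewrite E0 X00 add0r in Ex; rewrite Ex in nz1.
  have [|t tl] := support_right (feM TF) (l := l1) (F := mon_val) (c := fun t => head e0 t.2.2.2) _ nz1.
    move=> t /l1P [[w [_ tw]] _ tv [f [q tE]]]; move: tw; rewrite tE tv /= => -[_ sf fq].
    rewrite /mon_val /= tv tE -sf (gst_cons TF) -!mulrA (mulrA (fs f)) (tf_sfe TF) eqxx.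
    by rewrite (tf_rs TF).
  have [[w [_ tw]] _ tv [f [q tE]]] := l1P _ tl; move: tw; rewrite tE tv /= => -[pf sf _].
  by rewrite -Ex mulrA -(mulrA x) -sf (tf_se TF) allz ?mul0r.
have [|u [p [k [l' [up kn nz' hl' E2]]]]] :=
  @real_normal_form (\max_(t <- l0r) size t.2.2).+1 v l0r rl0 _ X0n.
  by move=> t tl; rewrite ltnS; apply: (leq_bigmax_seq (F := fun t : rterm => size t.2.2) _ tl).
(* [f] is neither the first ghost edge of a term of [l1] nor the first edge of a closed path in the
   normal form, so compression by [f] leaves the scalar term alone. *)
have [f [pf [sf fn]]] : exists f, ein f /\ s f = v /\
    f \notin [seq head e0 t.2.2.2 | t <- l1] ++ [seq head e0 t.2.2 | t <- l'].
  apply: contrapT => nof; apply: nfin.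
  exists ([seq head e0 t.2.2.2 | t <- l1] ++ [seq head e0 t.2.2 | t <- l']) => f pf sf.
  by apply/InP; apply: contrapT => /negP fn; apply: nof; exists f.
move: fn; rewrite mem_cat negb_or => /andP[f1 f2].
have vf : path v [:: f] (r f) by split.
exists u, (p ++ [:: f]), (r f), v, [:: f].
suff E3 : gst u (p ++ [:: f]) * x * pth v [:: f] = kap k * fv (r f).
  rewrite E3; split => //; [exact: path_catI vf| |by left; exists k].
  exact: (kap_fv_neq0 (path_vin vf vv) kn).
rewrite (gst_cat TF _ up) -sf (gst_cons TF) (pth_cons TF) gst_nil pth_nil (tf_rs TF) (tf_er TF).
have Exf : x * fe f = (\sum_(t <- l0r) rval t) * fe f.
  by rewrite -[in LHS](tf_se TF) sf (mulrA x) Ex mulrDl (X1e _ f1) addr0 E0.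
rewrite -mulrA Exf mulrA -(mulrA (fs f)) E2 mulrDr mulrDl mulr_sumr mulr_suml big_seq big1 ?addr0.
  by rewrite mulrA -kapC -!mulrA -{1}sf (tf_se TF) (tf_sfe TF) eqxx.
move=> t tl; have [tv [tN tp]] := hl' _ tl.
rewrite /rval mulrA -kapC -!mulrA (mulrA (fs f)) tv (fs_pth TF tp) ?mul0r ?mulr0 //.
case tE : t.2.2 tN => [//|a b] _ [af]; case/negP: f2; apply/mapP; exists t => //.
by rewrite tE.
Qed.

Lemma reducible_spanned x : spanned x -> x <> 0 -> reducible x.
Proof.
move=> [l gl ->]; apply: (@reducible_span (\max_(t <- l) size t.2.2.2).+1) => // t tl.
by rewrite ltnS; apply: (leq_bigmax_seq (F := fun t : term => size t.2.2.2) _ tl).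
Qed.
End Leavitt.

Section PolyFactor.
Variable K : fieldType.
Implicit Types f g h : {poly K}.

(** Generators of primes of K[x,1/x]. The value 0 is allowed; the condition on ['X] rules out the
    nonzero constants and the associates of ['X], which are invertible there. *)
Definition prime_poly g :=
  (forall f h, g %| f * h -> g %| f \/ g %| h) /\ ~ g %| 'X.

Lemma irreducible_dvd g f h : irreducible_poly g -> g %| f * h -> g %| f \/ g %| h.
Proof.
move=> ig gfh; have [|nf] := boolP (g %| f); first by left.
by right; rewrite -(Gauss_dvdpr _ (_ : coprimep g f)) // irreducible_poly_coprime.
Qed.

Lemma factorization g : (1 < size g)%N ->
  exists gs, [/\ gs <> [::], \prod_(h <- gs) h = g & forall h, h \in gs -> irreducible_poly h].
Proof.
have [n] := ubnP (size g); elim: n g => // n IH g gn g1.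
have [ig|nig] := pselect (irreducible_poly g).
  exists [:: g]; split => //; first by rewrite big_seq1.
  by move=> h; rewrite inE => /eqP ->.
have [q [q1 qg qng]] : exists q : {poly K}, [/\ size q != 1, q %| g & ~~ (q %= g)].
  apply: contrapT => no; apply: nig; split => // q q1 qg.
  by apply: contrapT => /negP qng; apply: no; exists q.
have g0 : g != 0 by rewrite -size_poly_gt0 (ltn_trans _ g1).
have [h Eg] := dvdpP _ _ qg.
have q0 : q != 0 by apply: contraNneq g0 => q0; rewrite Eg q0 mulr0.
have h0 : h != 0 by apply: contraNneq g0 => h0; rewrite Eg h0 mul0r.
have qs : (size q < size g)%N.
  by rewrite ltn_neqAle dvdp_leq // andbT dvdp_size_eqp.
have Es : (size g).+1 = (size h + size q)%N by rewrite Eg size_mul // prednK // addn_gt0 size_poly_gt0 h0.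
have sq0 : (0 < size q)%N by rewrite size_poly_gt0.
have h1 : (1 < size h)%N by lia.
have hs : (size h < n)%N by lia.
have qs' : (size q < n)%N by lia.
have q1' : (1 < size q)%N by lia.
have [gs1 [n1 p1 i1]] := IH _ hs h1; have [gs2 [n2 p2 i2]] := IH _ qs' q1'.
exists (gs1 ++ gs2); split.
- by case: (gs1) n1.
- by rewrite big_cat /= p1 p2.
- by move=> x; rewrite mem_cat => /orP[/i1|/i2].
Qed.
End PolyFactor.

Lemma seq_max (T : eqType) (F : T -> nat) (l : seq T) : l <> [::] ->
  exists2 t, t \in l & forall u, u \in l -> (F u <= F t)%N.
Proof.
elim: l => // a [|b l] IH _.
  by exists a; rewrite ?mem_head // => u; rewrite inE => /eqP ->.
have [//|t tl tm] := IH; have [ta|at_] := leqP (F a) (F t).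
  by exists t; [rewrite inE tl orbT|move=> u; rewrite inE => /orP[/eqP ->|/tm]].
exists a; first exact: mem_head.
move=> u; rewrite inE => /orP[/eqP -> //|/tm ut]; exact: leq_trans ut (ltnW at_).
Qed.

(** * The corner at a cyclic vertex and its primes *)

Section Primes.
Variables (K : fieldType) (B : pzRingType) (kap : {rmorphism K -> B}).
Hypothesis kapC : forall k x, kap k * x = x * kap k.
Variables (V E : choiceType) (vin : V -> Prop) (ein : E -> Prop).
Variables (s r : E -> V) (fv : V -> B) (fe fs : E -> B).
Hypothesis LF : leavitt_family vin ein s r fv fe fs.
Let TF := lf_toeplitz LF.
Let G := PGraph vin ein s r.
Local Notation path := (@path_from G).
Local Notation pth := (pth fv fe).
Local Notation gst := (gst fv fs).
Local Notation loop_el := (loop_el vin ein s r fv fe).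
Local Notation lpeval := (lpeval kap vin ein s r fv fe).
Local Notation mval := (mon_val kap fv fe fs).
Local Notation mok := (@mon_ok K V E vin ein s r).
Local Notation cyclic := (cyclic (G := G)).
Variable S : B -> Prop.
Hypothesis SS : is_ideal S S.
Hypothesis spanS : forall x, S x <-> spanned kap vin ein s r fv fe fs x.
Implicit Types (u v w : V) (p q : seq E) (f g h : {poly K}).

Lemma S_term k u p u' q w : path u p w -> path u' q w -> S (kap k * (pth u p * gst u' q)).
Proof.
move=> up uq; apply/spanS; exists [:: (k, ((u, p), (u', q)))]; last by rewrite big_seq1.
by move=> t; rewrite inE => /eqP ->; exists w.
Qed.

Lemma S_pth u p w : path u p w -> S (pth u p).
Proof.
move=> up; have := S_term 1 up (erefl w : path w [::] w).
by rewrite rmorph1 mul1r gst_nil (pth_tgt TF up).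
Qed.

Lemma S_gst u p w : path u p w -> S (gst u p).
Proof.
move=> up; have := S_term 1 (erefl w : path w [::] w) up.
by rewrite rmorph1 mul1r pth_nil (gst_tgt TF up).
Qed.

Lemma S_fv v : S (fv v).
Proof. by rewrite -(pth_nil fv fe); apply: (@S_pth v [::] v). Qed.

Lemma S_kap k x : S x -> S (kap k * x).
Proof.
move=> /spanS [l hl ->]; rewrite mulr_sumr; apply: (ideal_sum SS) => t /InP/hl [w [tp tq]].
by rewrite /mon_val mulrA -rmorphM; apply: S_term tp tq.
Qed.

Lemma S_mul x y : S x -> S y -> S (x * y).
Proof. exact: (ideal_mull SS). Qed.

(** Scalars need not belong to [S]; through a local unit [u] one has k x = (k u) x with k u in
    [S]. *)
Lemma ideal_kap I k x : is_ideal S I -> S (kap k * x) -> I x ->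
  (exists2 u, S u & u * x = x) -> I (kap k * x).
Proof.
move=> hI _ Ix [u Su <-]; rewrite mulrA; apply: (ideal_mull hI) => //; exact: S_kap.
Qed.

Lemma ideal_fv I k v : is_ideal S I -> k <> 0 -> I (kap k * fv v) -> I (fv v).
Proof.
move=> hI /eqP kn Ik.
rewrite -[fv v]mul1r -(rmorph1 kap) -(mulVf kn) rmorphM -mulrA.
apply: (ideal_kap hI) => //; first by rewrite mulrA -rmorphM; apply/S_kap/S_fv.
exists (fv v); first exact: S_fv.
by rewrite mulrA -kapC -mulrA (fvv TF).
Qed.

Lemma ideal_reach I v w : is_ideal S I -> reaches (G := G) v w -> I (fv v) -> I (fv w).
Proof.
move=> hI [p vp] Iv; rewrite -(gst_pth TF vp) -(pth_src TF).
apply: (ideal_mull hI) => //; first exact: S_gst vp.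
by apply: (ideal_mulr hI) => //; apply: S_pth vp.
Qed.

(** At a vertex emitting a single edge the sum relation has a single summand. *)
Lemma cyclic_edge e v : cyclic v -> ein e -> s e = v ->
  fe e * fs e = fv v /\ cyclic (r e).
Proof.
move=> cv pe se; have ve : reaches (G := G) v (r e) by exists [:: e].
split; last by case: (cyclic_reach cv ve).
rewrite (lf_ck2 LF (l := [:: e])) ?big_seq1 // => f; rewrite inE; split.
  by move/eqP => ->.
by move=> [pf sf]; rewrite (cv.2 v (reaches_refl _) f e).
Qed.

Lemma cyclic_pth_gst v p w : cyclic v -> path v p w -> pth v p * gst v p = fv v.
Proof.
elim: p v => [|e p IH] v cv /=; first by move=> _; rewrite pth_nil gst_nil (fvv TF).
case=> pe se ep; have [ee ce] := cyclic_edge cv pe se.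
rewrite -se (pth_cons TF) (gst_cons TF) -mulrA (mulrA (pth _ _)) IH //.
by rewrite (tf_rs TF) ee se.
Qed.

Lemma loop_path v : cyclic v -> path v (loop (G := G) v) v.
Proof. by move=> /cyclic_loop [[]]. Qed.

Lemma lpeval_fvl v f : cyclic v -> fv v * lpeval v f = lpeval v f.
Proof. by move=> /loop_path; apply: (lpeval_src kapC TF). Qed.

Lemma lpeval_fvr v f : lpeval v f * fv v = lpeval v f.
Proof. exact: lpeval_tgt TF _ _. Qed.

Lemma lpevalM v f g : cyclic v -> lpeval v (f * g) = lpeval v f * lpeval v g.
Proof. by move=> /loop_path; apply: (lpeval_mul kapC TF). Qed.

Lemma lpevalB v f g : lpeval v (f - g) = lpeval v f - lpeval v g.
Proof. by apply: (addIr (lpeval v g)); rewrite -lpevalD !subrK. Qed.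

Lemma lpevalC v k : lpeval v k%:P = kap k * fv v.
Proof. by rewrite lpeval.unlock pevalC. Qed.

Lemma lpeval1 v : lpeval v 1 = fv v.
Proof. by rewrite -[1]/(1%:P) lpevalC rmorph1 mul1r. Qed.

Lemma lpeval0 v : lpeval v 0 = 0.
Proof. by rewrite -[0]/(0%:P) lpevalC rmorph0 mul0r. Qed.

Lemma lpevalXn v n : cyclic v -> lpeval v 'X^n = pth v (flatten (nseq n (loop (G := G) v))).
Proof. by move=> cv; rewrite (loop_power LF _ (loop_path cv)) lpeval.unlock pevalXn. Qed.

(** By [loop_rotate], the path [p] intertwines the loops at its two ends, hence all polynomials in
    them. *)
Lemma lpeval_rotate v p w f : cyclic v -> path v p w ->
  lpeval v f * pth v p = pth v p * lpeval w f.
Proof.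
move=> cv vp; have [cw _] := cyclic_reach cv (ex_intro _ p vp : reaches (G := G) v w).
rewrite -(lpeval_fvl f cw) mulrA (pth_tgt TF vp) lpeval.unlock -mulrA (pth_src TF).
rewrite mulrA -[RHS]mulrA.
rewrite (@peval_conj _ _ kap kapC (loop_el v) (loop_el w)); last first.
  rewrite /loop_el -(pth_cat TF _ (loop_path cv)) -(pth_cat TF _ vp).
  by rewrite (loop_rotate cv vp).
rewrite -[in LHS](pth_tgt TF vp) -!mulrA; congr (_ * _).
by rewrite (peval_com kapC) // (loop_el_comm TF) //; apply: loop_path.
Qed.

Lemma lpeval_rotateK v p w f : cyclic v -> path v p w ->
  gst v p * lpeval v f * pth v p = lpeval w f.
Proof.
move=> cv vp; have [cw _] := cyclic_reach cv (ex_intro _ p vp : reaches (G := G) v w).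
by rewrite -mulrA (lpeval_rotate f cv vp) mulrA (gst_pth TF vp) lpeval_fvl.
Qed.

Lemma S_lpeval v f : cyclic v -> S (lpeval v f).
Proof.
move=> cv; elim/poly_ind: f => [|f k IH]; first by rewrite lpeval0; apply: (ideal0 SS).
rewrite lpevalD lpevalC; apply: (idealD SS); last exact/S_kap/S_fv.
rewrite (lpevalM _ _ cv); apply: S_mul => //.
by rewrite -['X]expr1 (lpevalXn 1 cv); apply: S_pth (iter_loop_path 1 (loop_path cv)).
Qed.

(* At a cyclic vertex a monomial may be completed by a path back to that vertex. *)
Lemma cyclic_term_closed v p w u q : cyclic v -> path v p w -> path u q w ->
  exists p' q', [/\ path v p' v, path u q' v & pth v p * gst u q = pth v p' * gst u q'].
Proof.
move=> cv vp uq; have vw : reaches (G := G) v w by exists p.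
have [cw [t wt]] := cyclic_reach cv vw.
exists (p ++ t), (q ++ t); split; [exact: path_catI vp wt|exact: path_catI uq wt|].
rewrite (pth_cat TF _ vp) (gst_cat TF _ uq) -mulrA (mulrA (pth w t)) (cyclic_pth_gst cw wt).
by rewrite (gst_tgt TF uq).
Qed.

Lemma cyclic_corner_terms v x : cyclic v -> S x -> fv v * x = x ->
  exists2 l : seq (term K V E),
    forall t, t \in l -> [/\ t.2.1.1 = v, path v t.2.1.2 v & path t.2.2.1 t.2.2.2 v] &
    x = \sum_(t <- l) mval t.
Proof.
move=> cv /spanS [l hl Ex] vx.
have {}Ex : x = \sum_(t <- [seq t <- l | t.2.1.1 == v]) mval t.
  rewrite -vx Ex big_filter; apply: (sum_corner LF v) => t _.
  exact: (mon_val_src kapC LF).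
have {}hl t : t \in [seq t <- l | t.2.1.1 == v] -> t.2.1.1 = v /\ mok t.
  by rewrite mem_filter => /andP[/eqP tv /hl].
elim: [seq t <- l | _] x {vx} Ex hl => [|t l' IH] x.
  by rewrite big_nil => ->; exists [::]; rewrite ?big_nil.
rewrite big_cons => -> hl; have [|l2 h2 ->] := IH _ erefl.
  by move=> t' t'l; apply: hl; rewrite inE t'l orbT.
have [] := hl t (mem_head _ _); case: t {hl} => k [[u p] [u' q]] /= -> [w /= [vp uq]].
have [p' [q' [vp' uq' E0]]] := cyclic_term_closed cv vp uq.
exists ((k, ((v, p'), (u', q'))) :: l2); last by rewrite big_cons /mon_val /= E0.
by move=> t'; rewrite inE => /orP[/eqP ->|/h2].
Qed.

(* The ghost paths ending at [v] form a dual basis of the right ideal generated by a cyclic vertex [v]. *)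
Lemma cyclic_dual_basis v (Y : B -> Prop) x : cyclic v -> S x -> fv v * x = x ->
  Y 0 -> (forall y z, Y y -> Y z -> Y (y - z)) -> (forall y a, Y y -> S a -> Y (y * a)) ->
  (forall u q, path u q v -> Y (x * pth u q)) -> Y x.
Proof.
move=> cv Sx vx Y0 YB YM; have [l hl Ex] := cyclic_corner_terms cv Sx vx.
have YN y : Y y -> Y (- y) by move=> Yy; rewrite -sub0r; apply: YB.
have YD y z : Y y -> Y z -> Y (y + z).
  by move=> Yy Yz; rewrite -[z]opprK; apply: YB => //; apply: YN.
elim: {l}(size l).+1 {-2}l (ltnSn (size l)) x {Sx vx} Ex hl => // n IH l ln x Ex hl hY.
have [l0|lN] := pselect (l = [::]); first by rewrite Ex l0 big_nil.
have [t1 t1l tmax] : exists2 t, t \in l & forall t', t' \in l ->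
    (size t'.2.2.2 <= size t.2.2.2)%N.
  exact: (@seq_max _ (fun t : term K V E => size t.2.2.2)).
have [] := hl _ t1l.
set u1 := t1.2.2.1; set q1 := t1.2.2.2 => _ _ uq1.
(* As [q1] has maximal length and [v] is cyclic, right multiplication by q1 q1^* fixes the terms
   whose ghost path is a prefix of [q1] and kills the others. Subtracting the product removes the
   former, among them the term of [q1] itself. *)
pose P (t : term K V E) := (t.2.2.1 == u1) && prefix t.2.2.2 q1.
have PE (t : term K V E) : t \in l -> mval t * (pth u1 q1 * gst u1 q1) = if P t then mval t else 0.
  move=> tl; have [tv vt tq] := hl _ tl; rewrite /P; case: eqP => [tu|tu] /=; last first.
    by rewrite /mon_val -!mulrA (mulrA (gst _ _)) (gst_pth_neq TF) // mul0r !mulr0.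
  rewrite /mon_val tu in tq *.
  have [h|[z Ez]|[z Ez]] := gst_pth_cases TF tq uq1.
  - case: prefixP => [[z Ez]|_]; last by rewrite -!mulrA (mulrA (gst _ _)) h mul0r !mulr0.
    have z0 : fv v * gst u1 q1 = 0.
      rewrite Ez in uq1 h *; have vz := path_catl tq uq1.
      move: h; rewrite (gst_pth_catr TF _ tq) => h.
      by rewrite (gst_cat TF _ tq) -(cyclic_pth_gst cv vz) h !mul0r.
    have v0 : fv v = 0 by rewrite -(gst_pth TF uq1) -(gst_tgt TF uq1) z0 mul0r.
    by rewrite -(gst_tgt TF tq) v0 mul0r !mulr0 mul0r.
  - have -> : prefix t.2.2.2 q1 by apply/prefixP; exists z.
    rewrite Ez in uq1 *; have vz := path_catl tq uq1.
    rewrite -!mulrA (mulrA (gst _ _)) (gst_pth_catr TF _ tq) (gst_cat TF _ tq).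
    by rewrite (mulrA (pth v z)) (cyclic_pth_gst cv vz) (gst_tgt TF tq).
  - have z0 : z = [::].
      have := tmax _ tl; rewrite Ez -/q1 size_cat -{2}(addn0 (size q1)) leq_add2l.
      by case: (z).
    rewrite Ez z0 cats0 prefix_refl -!mulrA (mulrA (gst _ _)) (gst_pth TF uq1).
    by rewrite (gst_tgt TF uq1).
have Sq := S_gst uq1; have Yq := hY _ _ uq1.
pose y := x - x * (pth u1 q1 * gst u1 q1).
suff Yy : Y y by rewrite -(subrK (x * (pth u1 q1 * gst u1 q1)) x); apply: YD => //; rewrite mulrA; apply: YM.
apply: (IH [seq t <- l | ~~ P t]).
- rewrite size_filter; apply: (@leq_trans (size l)); last by rewrite -ltnS.
  rewrite -(count_predC P l) -[X in (X < _)%N]add0n ltn_add2r -has_count.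
  by apply/hasP; exists t1 => //; rewrite /P eqxx prefix_refl.
- rewrite /y Ex mulr_suml big_filter [RHS]big_mkcond -sumrB /=.
  apply: eq_big_seq => t tl; rewrite PE //; case: (P t) => /=; first by rewrite subrr.
  by rewrite subr0.
- by move=> t; rewrite mem_filter => /andP[_ /hl].
- move=> u q uq; rewrite /y mulrBl; apply: YB; first exact: hY.
  rewrite mulrA -[x * _ * _ * _]mulrA; apply: YM => //.
  by apply: S_mul => //; apply: S_pth uq.
Qed.

(** Closed paths at [v] are powers of the loop and their ghosts are inverse powers, so [x] is a
    Laurent polynomial; a high power of the loop clears its denominators. *)
Lemma cyclic_corner v x : cyclic v -> S x -> fv v * x = x -> x * fv v = x ->
  exists n f, x * pth v (flatten (nseq n (loop (G := G) v))) = lpeval v f.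
Proof.
move=> cv Sx vx xv; have [l hl Ex] := cyclic_corner_terms cv Sx vx.
pose a := loop (G := G) v; rewrite -/a.
have {}Ex : x = \sum_(t <- [seq t <- l | t.2.2.1 == v]) mval t.
  rewrite -xv Ex mulr_suml big_filter [RHS]big_mkcond /=; apply: eq_bigr => t _.
  rewrite -(mon_val_tgt kap LF) -mulrA (tf_vv TF); case: eqP; rewrite ?mulr0 ?(mon_val_tgt kap LF) //.
have {}hl t : t \in [seq t <- l | t.2.2.1 == v] ->
   [/\ t.2.1.1 = v, t.2.2.1 = v, path v t.2.1.2 v & path v t.2.2.2 v].
  by rewrite mem_filter => /andP[/eqP tv /hl [-> ?]]; rewrite tv.
rewrite {}Ex; elim: [seq t <- l | _] hl => [|t l' IH] hl.
  by exists 0, 0; rewrite big_nil mul0r lpeval0.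
have [|n [f Ef]] := IH; first by move=> t' t'l; apply: hl; rewrite inE t'l orbT.
have va := iter_loop_path _ (loop_path cv).
have [tv tu vp vq] := hl _ (mem_head _ _).
have [i Ei] := cyclic_closed_power cv vp; have [j Ej] := cyclic_closed_power cv vq.
exists (j + n)%N, ('X^j * f + t.1%:P * 'X^(i + n)).
rewrite big_cons mulrDl addrC lpevalD; congr (_ + _).
  rewrite addnC nseqD flatten_cat (pth_cat TF _ (va n)) mulrA Ef -(lpevalXn _ cv).
  by rewrite -(lpevalM _ _ cv) mulrC.
rewrite /mon_val tv tu Ei Ej -/a nseqD flatten_cat -!mulrA.
rewrite (gst_pth_catr TF _ (va j)) -(pth_cat TF _ (va i)) -flatten_cat -nseqD.
by rewrite (lpevalM _ _ cv) lpevalC (lpevalXn _ cv) -mulrA (pth_src TF).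
Qed.

(* The elements whose compressions to the corner at [v], a (Laurent) polynomial ring in the loop at [v], are divisible by [g]. *)
Definition loop_prime v g : B -> Prop := fun x =>
  S x /\ forall a, S a -> exists2 b, S b & fv v * a * x = lpeval v g * b.

Lemma loop_prime_ideal v g : cyclic v -> is_ideal S (loop_prime v g).
Proof.
move=> cv; have S0 := ideal0 SS; split.
- by move=> x [].
- by split => // a _; exists 0; rewrite ?mulr0.
- move=> x y [Sx hx] [Sy hy]; split; first exact: (idealB SS).
  move=> a Sa; have [b Sb Eb] := hx _ Sa; have [c Sc Ec] := hy _ Sa.
  by exists (b - c); [apply: (idealB SS)|rewrite !mulrBr Eb Ec].
- move=> a x Sa [Sx hx]; split; split; [exact: S_mul| |exact: S_mul|].
    by move=> c Sc; have [b Sb Eb] := hx _ (S_mul Sc Sa); exists b => //; rewrite -Eb !mulrA.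
  move=> c Sc; have [b Sb Eb] := hx _ Sc; exists (b * a); first exact: S_mul.
  by rewrite mulrA Eb mulrA.
Qed.

Lemma prime_poly_Xn g f n : prime_poly g -> g %| f * 'X^n -> g %| f.
Proof.
move=> [gp gX]; elim: n => [|n IH]; first by rewrite expr0 mulr1.
by rewrite exprSr mulrA => /gp [/IH|/gX].
Qed.

(** After compression [b] is a Laurent polynomial h / x^n, so f x^n - h g vanishes at the loop and
    is divisible by [g]. Then [g] divides f x^n, and being prime and no divisor of ['X] it divides
    [f]. *)
Lemma lpeval_multiple v g f b : cyclic v -> prime_poly g ->
  (forall f, lpeval v f = 0 -> g %| f) -> S b -> lpeval v f = lpeval v g * b -> g %| f.
Proof.
move=> cv pg gN Sb Ef; pose b' := fv v * b * fv v.
have Sb' : S b' by do 2?apply: S_mul; rewrite ?S_fv //; apply: S_fv.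
have [||n [h Eh]] := cyclic_corner cv Sb'; rewrite /b' ?mulrA ?(fvv TF) //.
  by rewrite -!mulrA (fvv TF).
apply: (@prime_poly_Xn g f n pg); rewrite -(dvdp_subl _ (dvdp_mulr h (dvdpp g))).
apply: gN; rewrite lpevalB !(lpevalM _ _ cv) -Eh (lpevalXn _ cv) /b' !mulrA lpeval_fvr.
by rewrite -Ef lpeval_fvr subrr.
Qed.

(** By the dual basis, [fv v * a * x] is a multiple of g(c) once all its products with paths ending
    at [v] are; so failure of membership shows up in the corner as a polynomial not divisible by
    [g]. *)
Lemma notin_loop_prime v g x : cyclic v -> S x -> ~ loop_prime v g x ->
  exists a u q n f, [/\ S a, path u q v, ~ g %| f &
    fv v * a * x * (pth u q * pth v (flatten (nseq n (loop (G := G) v)))) = lpeval v f].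
Proof.
move=> cv Sx nx; apply: contrapT => no; apply: nx; split => // a Sa.
have Sy : S (fv v * a * x) by do 2?apply: S_mul => //; apply: S_fv.
apply: (@cyclic_dual_basis v (fun y => exists2 b, S b & y = lpeval v g * b)) => //.
- by rewrite !mulrA (fvv TF).
- by exists 0; rewrite ?mulr0 //; apply: (ideal0 SS).
- move=> _ _ [b Sb ->] [c Sc ->]; exists (b - c); last by rewrite mulrBr.
  exact: (idealB SS).
- move=> _ c [b Sb ->] Sc; exists (b * c); last by rewrite mulrA.
  exact: S_mul.
move=> u q uq; set z := _ * pth u q.
have zv : z * fv v = z by rewrite /z -!mulrA (pth_tgt TF uq).
have vz : fv v * z = z by rewrite /z !mulrA (fvv TF).
have Sz : S z by apply: S_mul => //; apply: S_pth uq.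
have [n [f Ef]] := cyclic_corner cv Sz vz zv.
have [gf|gf] := pselect (g %| f); last first.
  by case: no; exists a, u, q, n, f; rewrite mulrA.
have va := iter_loop_path n (loop_path cv).
have [h Eh] := dvdpP _ _ gf; exists (lpeval v h * gst v (flatten (nseq n (loop (G := G) v)))).
  by apply: S_mul; [apply: S_lpeval|apply: S_gst va].
rewrite -[LHS]zv -(cyclic_pth_gst cv va) mulrA Ef Eh mulrC (lpevalM _ _ cv).
by rewrite mulrA.
Qed.

Lemma loop_prime_fv v g : cyclic v -> prime_poly g ->
  (forall f, lpeval v f = 0 -> g %| f) -> ~ loop_prime v g (fv v).
Proof.
move=> cv pg gN [_ /(_ _ (S_fv v)) [b Sb]]; rewrite !(fvv TF) -lpeval1.
by move=> /(lpeval_multiple cv pg gN Sb) g1; apply: pg.2; apply: dvdp_trans g1 (dvd1p _).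
Qed.

Lemma loop_prime_prime v g : cyclic v -> prime_poly g ->
  (forall f, lpeval v f = 0 -> g %| f) -> is_prime S (loop_prime v g).
Proof.
move=> cv pg gN; apply: (prime_of_elements (loop_prime_ideal g cv)).
  by exists (fv v); split; [apply: S_fv|apply: loop_prime_fv].
move=> x y Sx Sy /(notin_loop_prime cv Sx) [a [u [q [n [f [Sa uq nf Ef]]]]]].
move=> /(notin_loop_prime cv Sy) [a' [u' [q' [n' [f' [Sa' uq' nf' Ef']]]]]].
have va m := iter_loop_path m (loop_path cv).
pose w m := pth v (flatten (nseq m (loop (G := G) v))).
have Sw m : S (w m) by apply: S_pth (va m).
(* This joins the data of [x] and [y], so that the product compresses to the value of [f * f'],
   which the prime [g] does not divide. *)
exists (pth u q * w n * (fv v * a')).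
  by do !apply: S_mul => //; [apply: S_pth uq|apply: S_fv].
move=> [_ /(_ _ Sa) [b Sb Eb]].
have : lpeval v (f * f') = lpeval v g * (b * (pth u' q' * w n')).
  rewrite (lpevalM _ _ cv) -Ef -Ef' [RHS]mulrA -Eb /w !mulrA.
  by [].
move/(lpeval_multiple cv pg gN) => h.
have /h/pg.1 [/nf|/nf'] // : S (b * (pth u' q' * w n')).
by do !apply: S_mul => //; apply: S_pth uq'.
Qed.

Lemma loop_prime_reach u v g : cyclic v -> prime_poly g ->
  (forall f, lpeval v f = 0 -> g %| f) -> reaches (G := G) u v -> ~ loop_prime v g (fv u).
Proof.
move=> cv pg gN uv h; apply: (loop_prime_fv cv pg gN).
exact: (ideal_reach (loop_prime_ideal g cv) uv h).
Qed.

(** The compression [z] of [a] is a Laurent polynomial in the loop and commutes with g(c), so [z]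
    itself is the cofactor. *)
Lemma loop_prime_lpeval v g : cyclic v -> loop_prime v g (lpeval v g).
Proof.
move=> cv; split; first exact: S_lpeval.
move=> a Sa; pose z := fv v * a * fv v.
have Sz : S z by do !apply: S_mul => //; apply: S_fv.
have zv : z * fv v = z by rewrite /z -!mulrA (fvv TF).
have vz : fv v * z = z by rewrite /z !mulrA (fvv TF).
have [n [f Ef]] := cyclic_corner cv Sz vz zv.
exists z => //; have va := iter_loop_path n (loop_path cv).
set p := flatten _ in Ef va.
have E1 : lpeval v g = pth v p * lpeval v g * gst v p.
  rewrite -(lpevalXn n cv) -(lpevalM _ _ cv) mulrC (lpevalM _ _ cv) (lpevalXn n cv).
  by rewrite -mulrA (cyclic_pth_gst cv va) lpeval_fvr.
have -> : fv v * a * lpeval v g = z * lpeval v g by rewrite /z -!mulrA lpeval_fvl.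
clearbody z; rewrite {1}E1 !mulrA Ef -(lpevalM _ _ cv) mulrC (lpevalM _ _ cv) -Ef -!mulrA.
by rewrite (cyclic_pth_gst cv va) zv.
Qed.

(** The cofactor produced by the first prime is absorbed by the product of the remaining ones, to
    which the induction applies. *)
Lemma product_loop_primes v gs x : cyclic v -> gs <> [::] ->
  idprodl S (map (loop_prime v) gs) x ->
  exists2 b, S b & fv v * x = lpeval v (\prod_(g <- gs) g) * b.
Proof.
move=> cv; elim: gs x => // g [|g' gs] IH x _.
  rewrite big_seq1 => -[_ /(_ _ (S_fv v)) [b Sb Eb]].
  by exists b => //; rewrite -Eb (fvv TF).
case=> l [hl ->]; rewrite mulr_sumr big_cons (lpevalM _ _ cv).
have hI : is_ideal S (idprodl S (map (loop_prime v) (g' :: gs))).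
  by apply: (idprodl_ideal SS) => Q /InP_map [h [<- _]]; apply: loop_prime_ideal.
suff h (p : B * B) : List.In p l -> exists2 b, S b & fv v * (p.1 * p.2) =
    lpeval v g * lpeval v (\prod_(h <- g' :: gs) h) * b.
  elim: {hl} l h => [|p l IHl] h.
    by exists 0; rewrite ?big_nil ?mulr0 //; apply: (ideal0 SS).
  have [b Sb Eb] := h _ (or_introl erefl).
  have [c Sc Ec] := IHl (fun (p : B * B) pl => h p (or_intror pl)).
  by exists (b + c); [apply: (idealD SS)|rewrite [in LHS]big_cons Eb Ec -mulrDr].
move=> /hl [[_ /(_ _ (S_fv v)) [b Sb Eb]] h2]; rewrite (fvv TF) in Eb.
have gN : g' :: gs <> [::] by [].
have [c Sc Ec] := IH _ gN (ideal_mull hI Sb h2).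
by exists c => //; rewrite -mulrA -Ec !mulrA lpeval_fvr Eb.
Qed.

(** The polynomials vanishing at the loop form an ideal of K[x]; [gs] factors a generator of it. *)
Lemma loop_prime_factors v : vin v -> cyclic v -> exists gs,
  [/\ gs <> [::], forall g, g \in gs -> prime_poly g,
      forall g f, g \in gs -> lpeval v f = 0 -> g %| f,
      lpeval v (\prod_(g <- gs) g) = 0 &
      forall f, lpeval v f = 0 -> \prod_(g <- gs) g %| f].
Proof.
move=> vv cv; have [allN|/existsNP [g0 /not_implyP [g0N /eqP g00]]] :=
    pselect (forall f, lpeval v f = 0 -> f = 0).
  (* When no nonzero polynomial vanishes at the loop, the generator is 0, which is prime since K[x]
     is a domain. *)
  exists [:: 0]; rewrite big_seq1 lpeval0; split => // [g|g f|f].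
  - rewrite inE => /eqP ->; split; last by rewrite dvd0p polyX_eq0.
    by move=> f h; rewrite !dvd0p mulf_eq0 => /orP.
  - by rewrite inE => /eqP -> /allN ->; rewrite dvdpp.
  - by move=> /allN ->; rewrite dvdpp.
have [g [gN gn0 gmin]] : exists g, [/\ lpeval v g = 0, g != 0 &
    forall f, lpeval v f = 0 -> f != 0 -> (size g <= size f)%N].
  have [n] := ubnP (size g0); elim: n g0 g0N g00 => // n IH g gN gn0 gn.
  have [h|/existsNP [f /not_implyP [fN /not_implyP [f0 /negP fg]]]] :=
    pselect (forall f, lpeval v f = 0 -> f != 0 -> (size g <= size f)%N).
    by exists g.
  by apply: (IH f) => //; rewrite -ltnNge in fg; apply: leq_trans fg _.
have gdvd f : lpeval v f = 0 -> g %| f.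
  move=> fN; apply/modp_eq0P; apply/eqP; apply: contraT => m0.
  have mN : lpeval v (f %% g) = 0.
    have -> : f %% g = f - (f %/ g) * g by rewrite {2}(divp_eq f g) addrC addKr.
    by rewrite lpevalB (lpevalM _ _ cv) gN mulr0 fN subr0.
  by have := gmin _ mN m0; rewrite leqNgt ltn_modp gn0.
have g1 : (1 < size g)%N.
  rewrite ltnNge; apply/negP => g1; have gC := size1_polyC g1.
  apply: (kap_fv_neq0 (kap := kap) LF vv (k := g`_0)).
    by move=> k0; case/eqP: gn0; rewrite gC k0.
  by rewrite -lpevalC -gC.
have [gs [gsN gsE gsI]] := factorization g1.
exists gs; rewrite gsE; split => // [h hgs|h f hgs fN].
  split; first by move=> f f'; apply: irreducible_dvd; apply: gsI.
  move=> hX; have hg : h %| g by rewrite -gsE (big_rem h hgs) dvdp_mulIl.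
  have Xg : 'X %| g.
    have [h1 irr] := gsI _ hgs; apply: dvdp_trans hg.
    have : h %= 'X.
      rewrite -dvdp_size_eqp // size_polyX eqn_leq h1 andbT.
      by have := dvdp_leq (negbT (polyX_eq0 _)) hX; rewrite size_polyX.
    by rewrite eqp_sym => /andP[].
  have [k Ek] := dvdpP _ _ Xg.
  (* The ghost of the loop is its inverse in the corner, so a factor ['X] could be cancelled from
     [g], against the minimality of its degree. *)
  have kN : lpeval v k = 0.
    have va := iter_loop_path 1 (loop_path cv).
    rewrite -lpeval_fvr -(cyclic_pth_gst cv va) mulrA -(lpevalXn 1 cv) expr1.
    by rewrite -(lpevalM _ _ cv) -Ek gN mul0r.
  have k0 : k != 0 by apply: contraNneq gn0 => k0; rewrite Ek k0 mul0r.
  have := gmin _ kN k0; rewrite Ek size_mulX // ltnn //.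
by apply: dvdp_trans (gdvd _ fN); rewrite -gsE (big_rem h hgs) dvdp_mulIl.
Qed.

(** This is the origin of (MT3). Expand the element [a] given by primality: a term p q^* survives
    between [u] and [w] only if p starts at [u] and q at [w], and it factors through their common
    end. *)
Lemma prime_downward P u w : is_prime S P -> ~ P (fv u) -> ~ P (fv w) ->
  exists z, [/\ reaches (G := G) u z, reaches (G := G) w z & ~ P (fv z)].
Proof.
move=> pP nu nw; have hP := prime_ideal pP.
have [a Sa na] := prime_elements SS pP (S_fv u) (S_fv w) nu nw.
apply: contrapT => no; apply: na; have [l hl ->] := (spanS a).1 Sa.
rewrite mulr_sumr mulr_suml; apply: (ideal_sum hP) => -[k [[u' p] [w' q]]] /InP/hl.
move=> [z /= [up wq]]; rewrite /mon_val /=.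
have [uu|uu] := pselect (u = u'); last first.
  by rewrite mulrA -kapC -(pth_src TF) -!mulrA (mulrA (fv u)) (fvw TF) // mul0r mulr0;
    apply: (ideal0 hP).
have [ww|ww] := pselect (w = w'); last first.
  by rewrite -(gst_src TF) -!mulrA (fvw TF) ?mulr0; [apply: (ideal0 hP)|apply: nesym].
rewrite -{}uu -{}ww in up wq *.
have Pz : P (fv z).
  by apply: contrapT => nz; apply: no; exists z; split => //; [exists p|exists q].
rewrite -(pth_tgt TF up) -!mulrA.
apply: (ideal_mull hP); first exact: S_fv.
rewrite kapC -!mulrA; apply: (ideal_mull hP); first exact: S_pth up.
apply: (ideal_mulr hP) => //; rewrite mulrA -kapC; apply: S_kap.
by apply: S_mul; [apply: S_gst wq|apply: S_fv].
Qed.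
End Primes.

Local Open Scope quotient_scope.

(** * Quotients of Leavitt path algebras *)

Record tsideal (A : pzRingType) := TSIdeal {
  ts_set :> A -> Prop;
  ts_0 : ts_set 0;
  ts_B : forall x y, ts_set x -> ts_set y -> ts_set (x - y);
  ts_Ml : forall a x, ts_set x -> ts_set (a * x);
  ts_Mr : forall a x, ts_set x -> ts_set (x * a) }.

Section QuotientRing.
Variables (A : pzRingType) (I : tsideal A).

Definition ts_pred : pred A := fun x => `[< I x >].

Lemma ts_zmod_closed : zmod_closed ts_pred.
Proof.
split; first by apply/asboolP/ts_0.
by move=> x y /asboolP Ix /asboolP Iy; apply/asboolP/ts_B.
Qed.

HB.instance Definition _ := GRing.isZmodClosed.Build A ts_pred ts_zmod_closed.

Definition ts_zmod := GRing.ZmodClosed.clone A ts_pred _.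
Definition qring := Quotient.quot ts_zmod.
HB.instance Definition _ := Choice.on qring.
HB.instance Definition _ := GRing.Zmodule.on qring.

Definition qring_one : qring := lift_cst qring 1.
Definition qring_mul := lift_op2 qring *%R.
Canonical qring_one_morph := PiConst qring_one.

Lemma qring_pi_mul : {morph \pi_qring : x y / x * y >-> qring_mul x y}.
Proof.
move=> x y; unlock qring_mul; apply/eqP; rewrite piE Quotient.equivE.
set x' := repr (\pi_qring x); set y' := repr (\pi_qring y).
have /asboolP hx : x - x' \in ts_zmod by rewrite Quotient.idealrBE reprK.
have /asboolP hy : y - y' \in ts_zmod by rewrite Quotient.idealrBE reprK.
have -> : x * y - x' * y' = x * (y - y') - (x' - x) * y'.
  by rewrite mulrBr mulrBl opprB addrA addrNK.
apply: rpredB; apply/asboolP; first exact: ts_Ml.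
by apply: ts_Mr; rewrite -opprB -sub0r; apply: ts_B => //; apply: ts_0.
Qed.
Canonical qring_pi_mul_morph := PiMorph2 qring_pi_mul.

Lemma qring_mulA : associative qring_mul.
Proof. by move=> x y z; rewrite -[x]reprK -[y]reprK -[z]reprK !piE mulrA. Qed.
Lemma qring_mul1 : left_id qring_one qring_mul.
Proof. by move=> x; rewrite -[x]reprK !piE mul1r. Qed.
Lemma qring_mulr1 : right_id qring_one qring_mul.
Proof. by move=> x; rewrite -[x]reprK !piE mulr1. Qed.
Lemma qring_mulDl : left_distributive qring_mul +%R.
Proof.
move=> x y z; rewrite -[x]reprK -[y]reprK -[z]reprK.
by apply/eqP; rewrite piE /= mulrDl Quotient.equivE subrr rpred0.
Qed.
Lemma qring_mulDr : right_distributive qring_mul +%R.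
Proof.
move=> x y z; rewrite -[x]reprK -[y]reprK -[z]reprK.
by apply/eqP; rewrite piE /= mulrDr Quotient.equivE subrr rpred0.
Qed.
HB.instance Definition _ := GRing.Zmodule_isPzRing.Build qring
  qring_mulA qring_mul1 qring_mulr1 qring_mulDl qring_mulDr.

Definition qpi : A -> qring := \pi_qring.

Lemma qpi_zmod_morphism : zmod_morphism qpi.
Proof. by move=> x y; rewrite /qpi raddfB. Qed.
HB.instance Definition _ := GRing.isZmodMorphism.Build A qring qpi qpi_zmod_morphism.
Lemma qpi_monoid_morphism : monoid_morphism qpi.
Proof. by split=> [|x y]; rewrite /qpi ?piE. Qed.
HB.instance Definition _ := GRing.isMonoidMorphism.Build A qring qpi qpi_monoid_morphism.

Lemma qpi_eq0 x : qpi x = 0 <-> I x.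
Proof.
rewrite -(rmorph0 qpi) /qpi; split.
  by move/eqP; rewrite -Quotient.idealrBE subr0 => /asboolP.
by move=> Ix; apply/eqP; rewrite -Quotient.idealrBE subr0; apply/asboolP.
Qed.

Lemma qpi_surj y : exists x, y = qpi x.
Proof. by exists (repr y); rewrite /qpi reprK. Qed.
End QuotientRing.

(** * Scalars, words and local units in the ambient ring *)

Section LPAbasics.
Variables (K : fieldType) (V Ed : choiceType) (s r : Ed -> V).
Local Notation gen := ((V + Ed) + Ed)%type.
Local Notation freealg := {malg K[fmonom gen]}.
Local Notation A := (lpa_amb K s r).
Local Notation L := (@LPA K V Ed s r).

Definition lpi : freealg -> A := \pi_A.

Lemma lpi_zmod_morphism : zmod_morphism lpi.
Proof. by move=> x y; rewrite /lpi raddfB. Qed.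
HB.instance Definition _ := GRing.isZmodMorphism.Build freealg A lpi lpi_zmod_morphism.
Lemma lpi_monoid_morphism : monoid_morphism lpi.
Proof. by split=> [|x y]; rewrite /lpi ?piE. Qed.
HB.instance Definition _ := GRing.isMonoidMorphism.Build freealg A lpi lpi_monoid_morphism.

Lemma lpi_eq0 x : lpi x = 0 <-> relideal s r x.
Proof.
rewrite -(rmorph0 lpi) /lpi; split.
  by move/eqP; rewrite -Quotient.idealrBE subr0 => /relidealbP.
by move=> Ix; apply/eqP; rewrite -Quotient.idealrBE subr0; apply/relidealbP.
Qed.

Lemma lpi_surj y : exists x, y = lpi x.
Proof. by exists (repr y); rewrite /lpi reprK. Qed.

Lemma lpi_rel x : leavitt_rel s r x -> lpi x = 0.
Proof.
move=> hx; apply/lpi_eq0; exists [:: (1, x, 1)]; split; first by move=> t [<-|].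
by rewrite big_seq1 /= mul1r mulr1.
Qed.

Definition av v : A := lpi (gv K Ed v).
Definition ae e : A := lpi (ge K V e).
Definition as_ e : A := lpi (gs K V e).

Lemma lpi_relB x y : leavitt_rel s r (x - y) -> lpi x = lpi y.
Proof. by move=> /lpi_rel; rewrite raddfB => /eqP; rewrite subr_eq0 => /eqP. Qed.

Lemma avM v w : av v * av w = if v == w then av v else 0.
Proof.
transitivity (lpi (if v == w then gv K Ed v else 0)).
  by rewrite -rmorphM; apply: lpi_relB; left; exists v, w.
by case: eqP; rewrite ?raddf0.
Qed.

Lemma av_ae e : av (s e) * ae e = ae e.
Proof. by rewrite -rmorphM; apply: lpi_relB; right; left; exists e. Qed.

Lemma ae_av e : ae e * av (r e) = ae e.
Proof. by rewrite -rmorphM; apply: lpi_relB; do 2?right; left; exists e. Qed.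

Lemma av_as e : av (r e) * as_ e = as_ e.
Proof. by rewrite -rmorphM; apply: lpi_relB; do 3?right; left; exists e. Qed.

Lemma as_av e : as_ e * av (s e) = as_ e.
Proof. by rewrite -rmorphM; apply: lpi_relB; do 4?right; left; exists e. Qed.

Lemma as_ae e f : as_ e * ae f = if e == f then av (r e) else 0.
Proof.
transitivity (lpi (if e == f then gv K Ed (r e) else 0)).
  by rewrite -rmorphM; apply: lpi_relB; do 5?right; left; exists e, f.
by case: eqP; rewrite ?raddf0.
Qed.

Lemma av_ck2 v l : l != [::] -> uniq l -> (forall e, s e = v <-> e \in l) ->
  av v = \sum_(e <- l) ae e * as_ e.
Proof.
move=> ln ul hl; transitivity (lpi (\sum_(e <- l) ge K V e * gs K V e)).
  by apply: lpi_relB; do 6?right; exists v, l.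
by rewrite raddf_sum /=; apply: eq_bigr => e _; rewrite rmorphM.
Qed.

Definition kapA (k : K) : A := lpi (malgC k).

Lemma kapA_zmod_morphism : zmod_morphism kapA.
Proof. by move=> x y; rewrite /kapA !raddfB. Qed.
HB.instance Definition _ := GRing.isZmodMorphism.Build K A kapA kapA_zmod_morphism.
Lemma kapA_monoid_morphism : monoid_morphism kapA.
Proof.
by split=> [|x y]; [rewrite /kapA mpolyC1E rmorph1|rewrite /kapA mpolyCM rmorphM].
Qed.
HB.instance Definition _ := GRing.isMonoidMorphism.Build K A kapA kapA_monoid_morphism.

Lemma malgC_central (k : K) (x : freealg) : malgC k * x = x * malgC k.
Proof.
rewrite mul_malgC malgM_def fgmulgU malgZ_def; apply: eq_bigr => m _.
by rewrite mulm1 mulrC.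
Qed.

Lemma kapA_central k x : kapA k * x = x * kapA k.
Proof. by have [y ->] := lpi_surj x; rewrite /kapA -!rmorphM malgC_central. Qed.

Definition gen_el (g : gen) : A := match g with
  | inl (inl v) => av v | inl (inr e) => ae e | inr e => as_ e end.

Definition word_el (w : seq gen) : A := \prod_(g <- w) gen_el g.

Lemma lpi_word (w : seq gen) : lpi << FMonom w >> = word_el w.
Proof.
elim: w => [|g w IH]; rewrite /word_el ?big_nil ?big_cons.
  by rewrite -fmoneE; apply: rmorph1.
rewrite -[X in _ * X]/(word_el w) -IH.
have -> : gen_el g = lpi << fmu g >> by case: g => [[v|e]|e].
rewrite -(rmorphM lpi); congr (lpi _).
rewrite malgM_def fgmulUU mulr1; congr (<< _ *g _ >>).
by apply/eqP; rewrite -val_eqE /= fmM fmU.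
Qed.

Lemma lpi_mono k (m : fmonom gen) : lpi << k *g m >> = kapA k * word_el m.
Proof.
rewrite -lpi_word -(rmorphM lpi) malgM_def fgmulUU mulr1; congr (lpi << _ *g _ >>).
by apply/eqP; rewrite -val_eqE /= fmM fm1.
Qed.

(** An element of [L] has a representative with zero constant coefficient, so only nonempty words
    occur; hence the separate first letter [g]. *)
Lemma LPA_ind (P : A -> Prop) : P 0 -> (forall x y, P x -> P y -> P (x + y)) ->
  (forall k g w, P (kapA k * (gen_el g * word_el w))) -> forall x, L x -> P x.
Proof.
move=> P0 PD Pw _ [f f1 ->]; rewrite -/(lpi f) [f]monalgE raddf_sum /= big_seq.
apply: (big_ind P) => // m mf; rewrite lpi_mono.
case: m mf => -[|g w] mf; last by rewrite /word_el big_cons; apply: Pw.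
by move: mf; rewrite -mcoeff_neq0 -fmoneE f1 eqxx.
Qed.

Lemma LPA_ideal : [/\ L 0, forall x y, L x -> L y -> L (x - y) &
  forall a x, L x -> L (a * x) /\ L (x * a)].
Proof.
have m1 (f : freealg) : f@_(@fmone gen) = mcoeff (@mone (fmonom gen)) f by [].
split; first by exists 0; rewrite ?mcoeff0 // -/(lpi 0) raddf0.
- move=> _ _ [f f1 ->] [g g1 ->]; exists (f - g); last by rewrite -!/(lpi _) raddfB.
  by rewrite mcoeffB f1 g1 subr0.
move=> a _ [f f1 ->]; have [g ->] := lpi_surj a; have [mM _] := mcoeff1g_is_multiplicative (fmonom gen) K.
split.
  exists (g * f); last by rewrite -!/(lpi _) rmorphM.
  by rewrite m1 mM -!m1 f1 mulr0.
exists (f * g); last by rewrite -!/(lpi _) rmorphM.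
by rewrite m1 mM -!m1 f1 mul0r.
Qed.

Lemma LPA_SS : is_ideal L L.
Proof. by have [L0 LB LM] := LPA_ideal; split => // a x _; apply: LM. Qed.

Lemma LPA_gen g : L (gen_el g).
Proof.
have -> : gen_el g = lpi << fmu g >> by case: g => [[v|e]|e].
by exists << fmu g >> => //; rewrite mcoeffU (_ : fmu g == @fmone gen = false) //
  -val_eqE /= fmU fmoneE.
Qed.

Lemma LPA_av v : L (av v). Proof. exact: (LPA_gen (inl (inl v))). Qed.
Lemma LPA_ae e : L (ae e). Proof. exact: (LPA_gen (inl (inr e))). Qed.
Lemma LPA_as e : L (as_ e). Proof. exact: (LPA_gen (inr e)). Qed.

Lemma amb_decomp a : exists k x, L x /\ a = kapA k + x.
Proof.
have [f ->] := lpi_surj a; exists (f@_(@fmone gen)), (lpi (f - malgC (f@_(@fmone gen)))).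
split; last by rewrite raddfB addrC subrK.
by exists (f - malgC f@_(@fmone gen)) => //; rewrite mcoeffB mcoeffC eqxx mulr1n subrr.
Qed.

Lemma local_unit x : L x -> exists2 u, L u & u * x = x.
Proof.
(* Quantifying over all larger lists makes the property stable under addition: one list then serves
   both summands. *)
pose P x := exists l : seq V, forall l', uniq l' -> {subset l <= l'} ->
  (\sum_(v <- l') av v) * x = x.
have /LPA_ind h : P 0 by exists [::] => l' _ _; rewrite mulr0.
move=> Lx; have [||l hl] := h _ _ x Lx.
- move=> {x Lx h} x y [l1 h1] [l2 h2]; exists (l1 ++ l2) => l' ul' sub.
  by rewrite mulrDr h1 ?h2 // => v vl; apply: sub; rewrite mem_cat vl ?orbT.
- move=> k g w; have [v Ev] : exists v, av v * gen_el g = gen_el g.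
    case: g => [[v|e]|e]; [exists v|exists (s e)|exists (r e)]; rewrite ?av_ae ?av_as //=.
    by rewrite avM eqxx.
  exists [:: v] => l' ul' sub; rewrite mulrA -kapA_central -mulrA; congr (_ * _).
  rewrite -Ev !mulrA (orth_suml avM ul') //.
  by apply: sub; rewrite mem_head.
exists (\sum_(v <- undup l) av v).
  by apply: (ideal_sum LPA_SS) => v _; apply: LPA_av.
by apply: hl; rewrite ?undup_uniq // => v; rewrite mem_undup.
Qed.

(** The ambient ring is spanned by the scalars and [L], and local units give stability under
    scalars. So an ideal of [L] is an ideal of the ambient ring, and quotients can be formed there
    with unit. *)
Lemma ideal_two_sided I : is_ideal L I -> forall a x, I x -> I (a * x) /\ I (x * a).
Proof.
move=> hI a x Ix; have [k [y [Ly ->]]] := amb_decomp a.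
have Lx := ideal_sub hI Ix; have [u Lu ux] := local_unit Lx.
have kx : I (kapA k * x).
  rewrite -ux mulrA; apply: (ideal_mull hI) => //.
  by have [_ _ /(_ (kapA k) u Lu) []] := LPA_ideal.
rewrite mulrDl mulrDr -kapA_central; split; apply: (idealD hI) => //.
  exact: (ideal_mull hI).
exact: (ideal_mulr hI).
Qed.

Definition ideal_ts I (hI : is_ideal L I) : tsideal A.
Proof.
exists I; [exact: (ideal0 hI)|by move=> x y; apply: (idealB hI)| |].
  by move=> a x Ix; case: (ideal_two_sided hI a Ix).
by move=> a x Ix; case: (ideal_two_sided hI a Ix).
Defined.
End LPAbasics.

Local Close Scope quotient_scope.

Section SpannedClosure.
Variables (K : fieldType) (B : pzRingType) (kap : {rmorphism K -> B}).
Hypothesis kapC : forall k x, kap k * x = x * kap k.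
Variables (V E : choiceType) (vin : V -> Prop) (ein : E -> Prop).
Variables (s r : E -> V) (fv : V -> B) (fe fs : E -> B).
Hypothesis LF : leavitt_family vin ein s r fv fe fs.
Let TF := lf_toeplitz LF.
Let G := PGraph vin ein s r.
Local Notation path := (@path_from G).
Local Notation spanned := (spanned kap vin ein s r fv fe fs).
Local Notation mval := (mon_val kap fv fe fs).
Implicit Types (u v w : V) (e : E) (p q : seq E) (t : term K V E).

Lemma spanned0 : spanned 0.
Proof. by exists [::]; rewrite ?big_nil. Qed.

Lemma spannedD x y : spanned x -> spanned y -> spanned (x + y).
Proof.
move=> [l1 h1 ->] [l2 h2 ->]; exists (l1 ++ l2); last by rewrite big_cat.
by move=> t; rewrite mem_cat => /orP[/h1|/h2].
Qed.

Lemma spanned_sum (l : seq (term K V E)) (F : term K V E -> B) :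
  (forall t, t \in l -> spanned (F t)) -> spanned (\sum_(t <- l) F t).
Proof.
elim: l => [|t l IH] h; first by rewrite big_nil; apply: spanned0.
rewrite big_cons; apply: spannedD; first by apply: h; rewrite mem_head.
by apply: IH => t' t'l; apply: h; rewrite inE t'l orbT.
Qed.

Lemma spanned_mon k u p u' q w : path u p w -> path u' q w ->
  spanned (kap k * (pth fv fe u p * gst fv fs u' q)).
Proof.
move=> up uq; exists [:: (k, ((u, p), (u', q)))]; last by rewrite big_seq1.
by move=> t; rewrite inE => /eqP ->; exists w.
Qed.

Lemma spannedZ k x : spanned x -> spanned (kap k * x).
Proof.
move=> [l hl ->]; rewrite mulr_sumr; apply: spanned_sum => t /hl [w [tp tq]].
by rewrite /mon_val mulrA -rmorphM; apply: spanned_mon tp tq.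
Qed.

Lemma fv_nin v : ~ vin v -> fv v = 0.
Proof. by move=> nv; apply: contrapT => /(lf_vin LF). Qed.

Lemma fe_nin e : ~ ein e -> fe e = 0.
Proof. by move=> /(lf_ein LF) ne; rewrite -(tf_er TF) fv_nin ?mulr0. Qed.

Lemma fs_nin e : ~ ein e -> fs e = 0.
Proof. by move=> /(lf_ein LF) ne; rewrite -(tf_rs TF) fv_nin ?mul0r. Qed.

Lemma spanned_fv v : spanned (fv v).
Proof.
have := @spanned_mon 1 v [::] v [::] v erefl erefl.
by rewrite rmorph1 mul1r pth_nil gst_nil (fvv TF).
Qed.

Lemma spanned_fe e : spanned (fe e).
Proof.
have [pe|/fe_nin ->] := pselect (ein e); last exact: spanned0.
have := @spanned_mon 1 (s e) [:: e] (r e) [::] (r e) (And3 pe erefl erefl) erefl.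
by rewrite rmorph1 mul1r (pth_cons TF) pth_nil gst_nil !(tf_er TF).
Qed.

Lemma spanned_fs e : spanned (fs e).
Proof.
have [pe|/fs_nin ->] := pselect (ein e); last exact: spanned0.
have := @spanned_mon 1 (r e) [::] (s e) [:: e] (r e) erefl (And3 pe erefl erefl).
by rewrite rmorph1 mul1r (gst_cons TF) pth_nil gst_nil !(tf_rs TF).
Qed.

Lemma spanned_left (a : B) x : (forall u p u' q w, path u p w -> path u' q w ->
    spanned (a * (pth fv fe u p * gst fv fs u' q))) -> spanned x -> spanned (a * x).
Proof.
move=> h [l hl ->]; rewrite mulr_sumr; apply: spanned_sum => t /hl [w [tp tq]].
by rewrite mulrA -kapC -mulrA; apply: spannedZ; apply: h tp tq.
Qed.

Lemma spanned1 u p u' q w : path u p w -> path u' q w ->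
  spanned (pth fv fe u p * gst fv fs u' q).
Proof. by move=> up uq; rewrite -[X in spanned X]mul1r -(rmorph1 kap); apply: spanned_mon up uq. Qed.

Lemma spanned_fvl v x : spanned x -> spanned (fv v * x).
Proof.
apply: spanned_left => u p u' q w up uq; have [->|vu] := pselect (v = u).
  by rewrite mulrA (pth_src TF); apply: spanned1 up uq.
by rewrite mulrA -(pth_src TF) (mulrA (fv v)) (fvw TF vu) !mul0r; apply: spanned0.
Qed.

Lemma spanned_fel e x : spanned x -> spanned (fe e * x).
Proof.
have [pe|/fe_nin ->] := pselect (ein e); last by rewrite mul0r => _; apply: spanned0.
apply: spanned_left => u p u' q w up uq; have [ru|ru] := pselect (r e = u).
  by rewrite mulrA -{1}ru -(pth_cons TF); apply: spanned1 uq; split; rewrite /= ?ru.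
rewrite mulrA -(tf_er TF) -(pth_src TF) -(mulrA (fe e)) (mulrA (fv _)) (fvw TF ru).
by rewrite mul0r mulr0 mul0r; apply: spanned0.
Qed.

(** Against a nonempty path the ghost edge cancels or kills; against an empty one it lengthens the
    ghost part. *)
Lemma spanned_fsl e x : spanned x -> spanned (fs e * x).
Proof.
have [pe|/fs_nin ->] := pselect (ein e); last by rewrite mul0r => _; apply: spanned0.
apply: spanned_left => u p u' q w up uq; have [su|su] := pselect (s e = u); last first.
  rewrite mulrA -(tf_ss TF) -(pth_src TF) -(mulrA (fs e)) (mulrA (fv _)) (fvw TF su).
  by rewrite mul0r mulr0 mul0r; apply: spanned0.
case: p up => [|f p] /= up.
  rewrite -up in uq *; rewrite -su in uq *.
  have ue : path u' (q ++ [:: e]) (r e) by apply: path_catI uq _.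
  have := spanned1 (erefl (r e) : path (r e) [::] (r e)) ue.
  rewrite !pth_nil (gst_cat TF _ uq) (gst_cons TF) gst_nil !mulrA.
  by rewrite !(fvv TF) !(tf_rs TF) (tf_ss TF).
case: up => pf sf fp; rewrite -sf (pth_cons TF) !mulrA (tf_sfe TF).
case: eqP => [->|_]; last by rewrite !mul0r; apply: spanned0.
by rewrite (pth_src TF); apply: spanned1 fp uq.
Qed.
End SpannedClosure.

Lemma map_pth (B B' : pzRingType) (f : {rmorphism B -> B'}) (V E : Type)
  (fv : V -> B) (fe : E -> B) u p :
  f (pth fv fe u p) = pth (f \o fv) (f \o fe) u p.
Proof.
rewrite !pth.unlock rmorphM; congr (_ * _).
by elim: p => [|e p IH] /=; rewrite ?rmorph1 // rmorphM IH.
Qed.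

Lemma map_gst (B B' : pzRingType) (f : {rmorphism B -> B'}) (V E : Type)
  (fv : V -> B) (fs : E -> B) u p :
  f (gst fv fs u p) = gst (f \o fv) (f \o fs) u p.
Proof.
rewrite !gst.unlock rmorphM; congr (_ * _).
by elim: p => [|e p IH] /=; rewrite ?rmorph1 // rmorphM IH.
Qed.

Lemma map_lpeval (K : fieldType) (B B' : pzRingType) (f : {rmorphism B -> B'})
  (kap : {rmorphism K -> B}) (kap' : {rmorphism K -> B'}) (V E : Type)
  (vin : V -> Prop) (ein : E -> Prop) (s r : E -> V) (fv : V -> B) (fe : E -> B) w g :
  (forall k, f (kap k) = kap' k) ->
  f (lpeval kap vin ein s r fv fe w g) =
  lpeval kap' vin ein s r (f \o fv) (f \o fe) w g.
Proof.
move=> fk; rewrite !lpeval.unlock rmorphM; congr (_ * _).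
rewrite /peval rmorph_sum; apply: eq_bigr => i _.
by rewrite rmorphM rmorphXn fk /loop_el map_pth.
Qed.

(** * The quotient graph realised in a quotient of [L] *)

Section QuotientFamily.
Variables (K : fieldType) (V Ed : choiceType) (s r : Ed -> V) (H S : V -> Prop).
Local Notation A := (lpa_amb K s r).
Local Notation L := (@LPA K V Ed s r).
Local Notation av := (@av K V Ed s r).
Local Notation ae := (@ae K V Ed s r).
Local Notation as_ := (@as_ K V Ed s r).
Local Notation Eg := (fullgraph s r).
Local Notation Q := (quotient_graph s r H S).
Hypothesis adm : admissible_pair (G := Eg) H S.

Definition brk v : Prop := breaking_vertex (G := Eg) H v /\ ~ S v.

(** The default [[::]] occurs only when infinitely many edges from [v] end outside [H], which
    excludes breaking vertices. *)
Definition outs (v : V) : seq Ed :=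
  match pselect (exists l : seq Ed, uniq l /\ forall e, e \in l <-> s e = v /\ ~ H (r e)) with
  | left h => sval (cid h) | right _ => [::] end.

Definition outsum v : A := \sum_(e <- outs v) ae e * as_ e.
(** For a breaking vertex this is the element usually written v^H. *)
Definition gap v : A := av v - outsum v.

(* For [v] in [B_H \ S], the sum of the [e e*] over the edges [e] from [v] to vertices outside [H] plays the role of [v], and its complement that of [v']. *)
Definition qv (x : V + V) : A := match x with
  | inl v => if `[< H v >] then 0 else if `[< brk v >] then outsum v else av v
  | inr v => if `[< brk v >] then gap v else 0 end.
Arguments qv : simpl never.
Definition uv (x : V + V) : V := match x with inl v => v | inr v => v end.
Definition ue (x : Ed + Ed) : Ed := match x with inl e => e | inr e => e end.
Definition qe (x : Ed + Ed) : A := ae (ue x) * qv (prng (p := Q) x).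
Definition qs (x : Ed + Ed) : A := qv (prng (p := Q) x) * as_ (ue x).

Lemma H_edge e : H (s e) -> H (r e).
Proof. by case: adm => hH _ _ Hs; apply: (hH _ _ Hs); exists [:: e]. Qed.

Lemma outsP v : breaking_vertex (G := Eg) H v ->
  uniq (outs v) /\ forall e, e \in outs v <-> s e = v /\ ~ H (r e).
Proof.
case=> _ _ _ [l hl] _; rewrite /outs; case: pselect => [h|[]]; first by case: (cid h).
exists (undup [seq e <- l | `[< s e = v /\ ~ H (r e) >]]); split; first exact: undup_uniq.
move=> e; rewrite mem_undup mem_filter; split; first by case/andP => /asboolP.
by move=> [se He]; apply/andP; split; [apply/asboolP|apply/InP/hl].
Qed.

Lemma outs_uniq v : uniq (outs v).
Proof. by rewrite /outs; case: pselect => // h; case: (cid h) => l []. Qed.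

Lemma outs_src e v : e \in outs v -> s e = v.
Proof. by rewrite /outs; case: pselect => // h; case: (cid h) => l [_ hl] /= /hl []. Qed.

Lemma av_outsum v : av v * outsum v = outsum v.
Proof.
rewrite mulr_sumr; apply: eq_big_seq => e /outs_src <-.
by rewrite mulrA av_ae.
Qed.

Lemma outsum_av v : outsum v * av v = outsum v.
Proof.
rewrite mulr_suml; apply: eq_big_seq => e /outs_src <-.
by rewrite -mulrA as_av.
Qed.

Lemma outsum_ae e v : outsum v * ae e = if e \in outs v then ae e else 0.
Proof.
rewrite mulr_suml; case: ifP => eo.
  rewrite (bigD1_seq e eo (outs_uniq v)) /= -mulrA as_ae eqxx ae_av big1 ?addr0 //.
  by move=> f fe; rewrite -mulrA as_ae (negbTE fe) mulr0.
rewrite big_seq big1 // => f fo; rewrite -mulrA as_ae.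
by case: eqP fo => [->|]; rewrite ?eo ?mulr0.
Qed.

Lemma as_outsum e v : as_ e * outsum v = if e \in outs v then as_ e else 0.
Proof.
rewrite mulr_sumr; case: ifP => eo.
  rewrite (bigD1_seq e eo (outs_uniq v)) /= mulrA as_ae eqxx av_as big1 ?addr0 //.
  by move=> f fe; rewrite mulrA as_ae eq_sym (negbTE fe) mul0r.
rewrite big_seq big1 // => f fo; rewrite mulrA as_ae.
by case: eqP fo => [<-|]; rewrite ?eo ?mul0r.
Qed.

Lemma outsumM v : outsum v * outsum v = outsum v.
Proof.
rewrite {2}/outsum mulr_sumr; apply: eq_big_seq => e eo.
by rewrite mulrA outsum_ae eo.
Qed.

Lemma gapM v : gap v * gap v = gap v.
Proof.
rewrite mulrBl !mulrBr avM eqxx av_outsum outsum_av outsumM.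
by rewrite subrr subr0.
Qed.

Lemma outsum_gap v : outsum v * gap v = 0.
Proof. by rewrite mulrBr outsum_av outsumM subrr. Qed.

Lemma gap_outsum v : gap v * outsum v = 0.
Proof. by rewrite mulrBl av_outsum outsumM subrr. Qed.

Lemma qv_cases v :
  [\/ [/\ H v, qv (inl v) = 0 & qv (inr v) = 0],
      [/\ ~ H v, brk v, qv (inl v) = outsum v & qv (inr v) = gap v] |
      [/\ ~ H v, ~ brk v, qv (inl v) = av v & qv (inr v) = 0]].
Proof.
rewrite /qv; have [b|nb] := pselect (brk v).
  have nH : ~ H v by case: b => -[].
  by apply: Or32; rewrite (asboolF nH) (asboolT b).
have [h|nH] := pselect (H v); last by apply: Or33; rewrite (asboolF nH) (asboolF nb).
by apply: Or31; rewrite (asboolT h) (asboolF nb).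
Qed.

Lemma av_qv x : av (uv x) * qv x = qv x.
Proof.
by case: x => v; have [[_ e1 e2]|[_ _ e1 e2]|[_ _ e1 e2]] := qv_cases v;
  rewrite ?e1 ?e2 ?mulr0 // ?mulrBr ?av_outsum ?avM ?eqxx.
Qed.

Lemma qv_av x : qv x * av (uv x) = qv x.
Proof.
by case: x => v; have [[_ e1 e2]|[_ _ e1 e2]|[_ _ e1 e2]] := qv_cases v;
  rewrite ?e1 ?e2 ?mul0r // ?mulrBl ?outsum_av ?avM ?eqxx.
Qed.

Lemma qvM x y : qv x * qv y = if x == y then qv x else 0.
Proof.
have [uxy|uxy] := eqVneq (uv x) (uv y); last first.
  rewrite -qv_av -(av_qv y) -mulrA (mulrA (av _)) avM (negbTE uxy) mul0r mulr0.
  by case: (x =P y) uxy => [->|//]; rewrite eqxx.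
case: x y uxy => v [] w uxy; have {uxy}vw : v = w := uxy; rewrite -{w}vw;
  have [[_ e1 e2]|[_ _ e1 e2]|[_ _ e1 e2]] := qv_cases v; rewrite ?e1 ?e2 ?mulr0 ?mul0r
  ?outsumM ?gapM ?outsum_gap ?gap_outsum ?avM ?eqxx //=; by rewrite ?if_same.
Qed.

Lemma qv_H x : H (uv x) -> qv x = 0.
Proof. by case: x => v /= h; have [[_ ? ?]|[]|[]] := qv_cases v. Qed.

Lemma uv_rng (x : Ed + Ed) : uv (prng (p := Q) x) = r (ue x).
Proof. by case: x. Qed.

Lemma qv_ae x : qv (psrc (p := Q) x) * qe x = qe x.
Proof.
have [h|nH] := pselect (H (r (ue x))).
  by rewrite /qe (@qv_H (prng (p := Q) x)) ?uv_rng // !mulr0.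
rewrite /qe mulrA; congr (_ * _).
have -> : psrc (p := Q) x = inl (s (ue x)) by case: x {nH}.
have [[h e1 _]|[_ b -> _]|[_ _ -> _]] := qv_cases (s (ue x)).
- by case: nH; apply: H_edge.
- by rewrite outsum_ae (_ : _ \in _) //; apply/(outsP b.1).2.
- by rewrite av_ae.
Qed.

Lemma as_qv x : qs x * qv (psrc (p := Q) x) = qs x.
Proof.
have [h|nH] := pselect (H (r (ue x))).
  by rewrite /qs (@qv_H (prng (p := Q) x)) ?uv_rng // !mul0r.
rewrite /qs -mulrA; congr (_ * _).
have -> : psrc (p := Q) x = inl (s (ue x)) by case: x {nH}.
have [[h e1 _]|[_ b -> _]|[_ _ -> _]] := qv_cases (s (ue x)).
- by case: nH; apply: H_edge.
- by rewrite as_outsum (_ : _ \in _) //; apply/(outsP b.1).2.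
- by rewrite as_av.
Qed.

Lemma q_toeplitz : toeplitz_family (psrc (p := Q)) (prng (p := Q)) qv qe qs.
Proof.
split; [exact: qvM|exact: qv_ae| | |exact: as_qv|].
- by move=> e; rewrite /qe -mulrA qvM eqxx.
- by move=> e; rewrite /qs mulrA qvM eqxx.
move=> e f; rewrite /qs /qe -mulrA (mulrA (as_ _)) as_ae.
case: (eqVneq (ue e) (ue f)) => [uef|uef]; last first.
  by rewrite mul0r mulr0; case: (e =P f) uef => [->|//]; rewrite eqxx.
have -> : av (r (ue e)) * qv (prng (p := Q) f) = qv (prng (p := Q) f).
  by rewrite uef -[RHS]av_qv; case: (f).
rewrite qvM; case: e f uef => e [] f euf; have {euf}ef : e = f := euf;
  by rewrite -?ef ?eqxx.
Qed.

Lemma av_split v : ~ H v -> av v = qv (inl v) + qv (inr v).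
Proof.
move=> nH; have [[//]|[_ _ -> ->]|[_ _ -> ->]] := qv_cases v; last by rewrite addr0.
by rewrite addrC subrK.
Qed.

Lemma ae_split e : ~ H (r e) -> ae e = qe (inl e) + qe (inr e).
Proof. by move=> nH; rewrite -mulrDr -av_split //= ae_av. Qed.

Lemma as_split e : ~ H (r e) -> as_ e = qs (inl e) + qs (inr e).
Proof. by move=> nH; rewrite -mulrDl -av_split //= av_as. Qed.

Lemma ae_as_split e : ~ H (r e) ->
  ae e * as_ e = qe (inl e) * qs (inl e) + qe (inr e) * qs (inr e).
Proof.
move=> nH; rewrite {1}(ae_split nH) {1}(as_split nH) mulrDl !mulrDr.
have h (x y : Ed + Ed) : prng (p := Q) x <> prng (p := Q) y -> qe x * qs y = 0.
  by move=> /eqP nxy; rewrite /qe /qs -mulrA (mulrA (qv _)) qvM (negbTE nxy) mul0r mulr0.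
by rewrite (h (inl e) (inr e)) // (h (inr e) (inl e)) // addr0 add0r.
Qed.

Lemma LPA_qv x : L (qv x).
Proof.
have LS := LPA_SS K s r; have L0 := ideal0 LS.
have Lo v : L (outsum v).
  by apply: (ideal_sum LS) => e _; apply: (ideal_mull LS); [apply: LPA_ae|apply: LPA_as].
have Lg v : L (gap v) by apply: (idealB LS) => //; apply: LPA_av.
by case: x => v; have [[_ e1 e2]|[_ _ e1 e2]|[_ _ e1 e2]] := qv_cases v;
  rewrite ?e1 ?e2 //; apply: LPA_av.
Qed.

Variable I : tsideal A.
Hypothesis IH : forall v, H v -> I (av v).
Hypothesis IS : forall v, S v -> I (gap v).
Hypothesis InH : forall v, ~ H v -> ~ I (av v).
Hypothesis InS : forall v, brk v -> ~ I (gap v).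

(** An edge e of [E] gives the edge e of [Q] and possibly e'. Their ranges are orthogonal, so cross
    terms vanish and the pair contributes exactly e e^* . *)
Lemma sum_edge_pairs v (l : seq (Ed + Ed)) : uniq l ->
  (forall e, e \in l <-> pein (p := Q) e /\ psrc (p := Q) e = inl v) ->
  exists l0 : seq Ed, [/\ uniq l0, forall e, e \in l0 <-> s e = v /\ ~ H (r e),
   (l0 = [::] -> l = [::]) &
   \sum_(e <- l) qe e * qs e = \sum_(e <- l0) ae e * as_ e].
Proof.
move=> ul hl; pose l0 := undup (map ue l).
have brkH w : brk w -> ~ H w by case=> -[].
have inP e : e \in l0 <-> s e = v /\ ~ H (r e).
  rewrite mem_undup; split.
    case/mapP => -[f|f] /hl /= [pf [sf]] ->; split => //.
    exact: brkH.
  by move=> [se nH]; apply/mapP; exists (inl e) => //; apply/hl; rewrite /= se.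
have ul0 : uniq l0 by apply: undup_uniq.
exists l0; split => //.
  move=> l0n; case El: l => [//|x l'].
  have : ue x \in l0 by rewrite mem_undup map_f // El mem_head.
  by rewrite l0n.
pose l1 := [seq e <- l0 | `[< brk (r e) >]].
have inl_inj : injective (@inl Ed Ed) by move=> ? ? [].
have inr_inj : injective (@inr Ed Ed) by move=> ? ? [].
have inl_nin e (l2 : seq Ed) : (inl e \in map (@inr Ed Ed) l2) = false.
  by apply/negP => /mapP[].
have inr_nin e (l2 : seq Ed) : (inr e \in map (@inl Ed Ed) l2) = false.
  by apply/negP => /mapP[].
have pe : perm_eq l (map inl l0 ++ map inr l1).
  apply: uniq_perm => //.
    rewrite cat_uniq !map_inj_uniq // ul0 filter_uniq // andbT.
    by apply/hasPn => _ /mapP[e _ ->]; rewrite inr_nin.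
  move=> [e|e]; rewrite mem_cat ?inl_nin ?inr_nin ?orbF ?orFb.
    rewrite (mem_map inl_inj); apply/idP/idP => [/hl [pf [sf]]|/inP [se ne]].
      by apply/inP.
    by apply/hl; split => //; congr inl.
  rewrite (mem_map inr_inj) mem_filter; apply/idP/idP => [/hl [pf [sf]]|].
    apply/andP; split; first exact/asboolP.
    by apply/inP; split => //; apply: brkH.
  case/andP => /asboolP bf /inP [se _].
  by apply/hl; split => //; congr inl.
rewrite (perm_big _ pe) big_cat !big_map big_filter /= [X in _ + X]big_mkcond -big_split /=.
apply: eq_big_seq => e /inP [_ nH]; rewrite (ae_as_split nH); congr (_ + _).
case: asboolP => // nb; by rewrite /qe /= /qv (asboolF nb) mulr0 mul0r.
Qed.

Local Notation B := (qring I).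
Local Notation pi := (qpi I).

(** What is missing in [L] is the sum relation at regular vertices of [Q]. At a vertex of [brk] it
    holds by the choice of [outsum]; at a vertex of [S] because its gap lies in [I]; elsewhere
    because the edges into [H] vanish modulo [I]. *)
Lemma quotient_family : leavitt_family (pvin (p := Q)) (pein (p := Q))
  (psrc (p := Q)) (prng (p := Q)) (pi \o qv) (pi \o qe) (pi \o qs).
Proof.
have T := q_toeplitz; split.
- split=> [v w|e|e|e|e|e f]; rewrite /= -rmorphM.
  + by rewrite (tf_vv T); case: eqP; rewrite ?rmorph0.
  + by rewrite (tf_se T).
  + by rewrite (tf_er T).
  + by rewrite (tf_rs T).
  + by rewrite (tf_ss T).
  + by rewrite (tf_sfe T); case: eqP; rewrite ?rmorph0.
- case=> v /=; rewrite qpi_eq0; have [[h e1 e2]|[nH b e1 e2]|[nH b e1 e2]] := qv_cases v;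
  rewrite ?e1 ?e2.
  + by split=> // h'; case: h'; apply: ts_0.
  (* For an edge e counted in [outsum v], compressing [outsum v] by e yields r(e), which would lie
     in [I] although r(e) is outside [H]. *)
  + split=> // _ Io; have [[_ _ _ _ [e [_ /= se ne]]] _] := b.
    apply: (InH ne); have eo : e \in outs v by apply/(outsP b.1).2.
    have := ts_Ml (as_ e) (ts_Mr (ae e) Io); rewrite outsum_ae eo as_ae eqxx.
    by [].
  + by split=> // _; apply: InH.
  + split; first by case=> -[].
    by move=> h'; case: h'; apply: ts_0.
  + by split=> // _; apply: InS.
  + split=> // h'; case: h'; exact: ts_0.
- by case.
move=> [v|v] l ul ln hl; last first.
  case: l ln hl {ul} => // x l _ /(_ x); rewrite mem_head => -[/(_ isT) [_ +] _].
  by case: x.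
have [l0 [ul0 hl0 l0n El]] := sum_edge_pairs ul hl.
have {}El : \sum_(e <- l) (pi \o qe) e * (pi \o qs) e = pi (\sum_(e <- l0) ae e * as_ e).
  by rewrite -El (rmorph_sum pi); apply: eq_bigr => x _; rewrite (rmorphM pi).
rewrite {}El /=; have {ul hl ln} [e0 e0l] : exists e0, e0 \in l0.
  case: (l0) l0n => [h|e l' _]; first by case: ln; apply: h.
  by exists e; rewrite mem_head.
have [se0 ne0] := (hl0 e0).1 e0l.
have nHv : ~ H v by rewrite -se0 => /H_edge.
have Eo : brk v \/ S v -> outsum v = \sum_(e <- l0) ae e * as_ e.
  move=> bS; have bv : breaking_vertex (G := Eg) H v.
    by case: bS => [[]//|Sv]; case: adm => _ _; apply.
  apply: perm_big; apply: uniq_perm => //; first exact: outs_uniq.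
  by move=> e; apply/idP/idP => [/(outsP bv).2/hl0|/hl0/(outsP bv).2].
have [[//]|[_ b -> _]|[_ nb -> _]] := qv_cases v; first by rewrite Eo //; left.
have [Sv|nS] := pselect (S v).
  rewrite -Eo; last by right.
  by apply/eqP; rewrite -subr_eq0 -raddfB; apply/eqP/qpi_eq0/IS.
(* Finitely many edges, and at least one, end outside [H]; an infinite emitter with this property
   would be breaking, hence in [brk] or in [S]. *)
have fin : emits_finitely (G := Eg) v.
  apply: contrapT => nfin; apply: nb; split => //; split => //.
    by exists l0 => e _ /= se ne; apply/InP/hl0.
  by exists e0.
have [la [ula hla]] : exists la, uniq la /\ forall e, s e = v <-> e \in la.
  have [l1 hl1] := fin; exists (undup [seq e <- l1 | s e == v]).
  split; first exact: undup_uniq.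
  move=> e; rewrite mem_undup mem_filter; split; last by case/andP => /eqP.
  by move=> se; rewrite se eqxx; apply/InP/hl1.
have e0la : e0 \in la by apply/hla.
rewrite (@av_ck2 K V Ed s r v la _ ula hla); last by case: (la) e0la.
apply/eqP; rewrite -subr_eq0 -raddfB; apply/eqP/qpi_eq0.
rewrite (bigID (fun e => `[< ~ H (r e) >])) /= addrAC.
have -> : \sum_(e <- la | `[< ~ H (r e) >]) ae e * as_ e = \sum_(e <- l0) ae e * as_ e.
  rewrite -big_filter; apply: perm_big; apply: uniq_perm; rewrite ?filter_uniq //.
  move=> e; rewrite mem_filter; apply/idP/idP.
    by case/andP => /asboolP ne /hla se; apply/hl0.
  by move=> /hl0 [/hla -> /asboolP ->].
rewrite subrr add0r; apply: (big_ind I).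
- exact: ts_0.
- move=> x y Ix Iy; rewrite -[y]opprK; apply: ts_B => //.
  by rewrite -sub0r; apply: ts_B => //; apply: ts_0.
move=> e /asboolPn /contrapT he; rewrite -ae_av; apply: ts_Mr; apply: ts_Ml.
exact: IH.
Qed.

Definition kapB (k : K) : B := pi (kapA s r k).
Lemma kapB_zmod_morphism : zmod_morphism kapB.
Proof. by move=> x y; rewrite /kapB !raddfB. Qed.
HB.instance Definition _ := GRing.isZmodMorphism.Build K B kapB kapB_zmod_morphism.
Lemma kapB_monoid_morphism : monoid_morphism kapB.
Proof.
by split=> [|x y]; rewrite /kapB; [rewrite (rmorph1 (kapA s r)) rmorph1|
  rewrite (rmorphM (kapA s r)) rmorphM].
Qed.
HB.instance Definition _ := GRing.isMonoidMorphism.Build K B kapB kapB_monoid_morphism.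

Lemma kapB_central k x : kapB k * x = x * kapB k.
Proof. by have [y ->] := qpi_surj x; rewrite /kapB -!(rmorphM pi) kapA_central. Qed.

Local Notation SB := (image_of L pi).
Local Notation spannedB := (spanned kapB (pvin (p := Q)) (pein (p := Q))
  (psrc (p := Q)) (prng (p := Q)) (pi \o qv) (pi \o qe) (pi \o qs)).

Lemma qpi_hom : ring_hom_on L pi.
Proof. by move=> x y _ _; rewrite rmorphD rmorphM. Qed.

Lemma SB_ideal : is_ideal SB SB.
Proof. exact: (image_SS (LPA_SS K s r) qpi_hom). Qed.

Lemma spanned_gen g x : spannedB x -> spannedB (pi (gen_el K s r g) * x).
Proof.
move=> sx; have LF := quotient_family; have kC := kapB_central.
have z (b : A) : I b -> spannedB (pi b * x).
  by move=> /qpi_eq0 ->; rewrite mul0r; apply: spanned0.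
case: g => [[v|e]|e] /=.
- have [h|nH] := pselect (H v); first by apply: z; apply: IH.
  by rewrite (av_split nH) rmorphD mulrDl; apply: spannedD; apply: (spanned_fvl kC LF).
- have [h|nH] := pselect (H (r e)); first by apply: z; rewrite -ae_av; apply: ts_Ml; apply: IH.
  by rewrite (ae_split nH) rmorphD mulrDl; apply: spannedD; apply: (spanned_fel kC LF).
- have [h|nH] := pselect (H (r e)); first by apply: z; rewrite -av_as; apply: ts_Mr; apply: IH.
  by rewrite (as_split nH) rmorphD mulrDl; apply: spannedD; apply: (spanned_fsl kC LF).
Qed.

Lemma spanned_gen1 g : spannedB (pi (gen_el K s r g)).
Proof.
have LF := quotient_family.
have z (b : A) : I b -> spannedB (pi b) by move=> /qpi_eq0 ->; apply: spanned0.
case: g => [[v|e]|e] /=.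
- have [h|nH] := pselect (H v); first by apply: z; apply: IH.
  by rewrite (av_split nH) rmorphD; apply: spannedD; apply: (spanned_fv kapB LF).
- have [h|nH] := pselect (H (r e)); first by apply: z; rewrite -ae_av; apply: ts_Ml; apply: IH.
  by rewrite (ae_split nH) rmorphD; apply: spannedD; apply: (spanned_fe kapB LF).
- have [h|nH] := pselect (H (r e)); first by apply: z; rewrite -av_as; apply: ts_Mr; apply: IH.
  by rewrite (as_split nH) rmorphD; apply: spannedD; apply: (spanned_fs kapB LF).
Qed.

Lemma SB_spanned x : SB x <-> spannedB x.
Proof.
have LF := quotient_family; split.
  case=> y Ly ->; move: y Ly; apply: LPA_ind.
  - by rewrite rmorph0; apply: spanned0.
  - by move=> a b; rewrite rmorphD; apply: spannedD.
  move=> k g w; rewrite rmorphM; apply: (@spannedZ _ _ kapB).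
  elim: w g => [|h w IHw] g; first by rewrite /word_el big_nil mulr1; apply: spanned_gen1.
  by rewrite /word_el big_cons rmorphM; apply: spanned_gen; apply: IHw.
move=> [l _ ->]; apply: (ideal_sum SB_ideal) => -[k [[u p] [w q]]] _.
rewrite /mon_val /=; have [_ _ LM] := LPA_ideal K s r.
rewrite -(map_pth pi) -(map_gst pi).
have Lp : L (pth qv qe u p) by rewrite pth.unlock; apply: (LM _ _ (LPA_qv u)).2.
exists (kapA s r k * (pth qv qe u p * gst qv qs w q)); last by rewrite !(rmorphM pi).
by apply: (LM _ _ _).1; apply: (LM _ _ Lp).2.
Qed.
End QuotientFamily.

(** * Boundary paths and the ideal of an admissible pair *)

Section BoundaryPoints.
Variable Q : pgraph.
Implicit Types (u : pV Q).

(** The start vertex is recorded for the sake of paths of length zero; a finite path continues with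
    [None]. *)
Definition bpoint := (pV Q * (nat -> option (pE Q)))%type.
Implicit Types (x y : bpoint).

Definition btail x : bpoint :=
  if x.2 0 is Some e then (prng e, fun n => x.2 n.+1) else x.
Definition bcons (e : pE Q) x : bpoint :=
  (psrc e, fun n => if n is m.+1 then x.2 m else Some e).
Definition bhead_ok x := pvin x.1 /\
  (if x.2 0 is Some e then psrc e = x.1 /\ pein e
   else ~ regular x.1 /\ forall n, x.2 n = None).
(* The boundary paths of [Q]: infinite paths, and finite paths ending at a sink or an infinite emitter. *)
Definition boundary x := forall n, bhead_ok (iter n btail x).

Lemma boundary_tail x : boundary x -> boundary (btail x).
Proof. by move=> bx n; have := bx n.+1; rewrite iterSr. Qed.

Lemma btail_cons e x : x.1 = prng e -> btail (bcons e x) = x.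
Proof. by case: x => u f /= ->. Qed.

Lemma bcons_tail e x : boundary x -> x.2 0 = Some e -> bcons e (btail x) = x.
Proof.
move=> /(_ 0) [_] /=; case: x => u f /= + fe; rewrite fe /bcons /btail /= fe => -[-> _].
by congr (_, _); apply/funext; case.
Qed.

Lemma boundary_cons e x : boundary x -> x.1 = prng e -> pein e -> pvin (psrc e) ->
  boundary (bcons e x).
Proof.
move=> bx xe pe ps [|n]; first by split.
by rewrite iterSr btail_cons.
Qed.

Definition bnext u : option (pE Q) :=
  match pselect (exists e : pE Q, pein e /\ psrc e = u) with
  | left h => Some (sval (cid h)) | right _ => None end.
Definition bstep u := if bnext u is Some e then prng e else u.
Definition bpath u : bpoint := (u, fun n => bnext (iter n bstep u)).

(** [bpath] follows a chosen edge wherever there is one, so it can stop only at a sink, which is not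
    regular. *)
Lemma bpath_boundary u : (forall e : pE Q, pein e -> pvin (prng e)) -> pvin u ->
  boundary (bpath u).
Proof.
move=> eV pu.
have tE w : btail (bpath w) = bpath (bstep w).
  rewrite /btail /=; case E: (bnext w) => [e|].
    have sE : bstep w = prng e by rewrite /bstep E.
    by rewrite /bpath sE; congr (_, _); apply/funext => n; rewrite -sE -iterSr.
  by rewrite /bstep E.
have iE n : iter n btail (bpath u) = bpath (iter n bstep u).
  by elim: n => //= n ->; rewrite tE.
move=> n; rewrite {}iE; have : pvin (iter n bstep u).
  elim: n => //= n; move: (iter n bstep u) => w pw; rewrite /bstep /bnext.
  case: pselect => // h; case: (cid h) => e [pe se] /=; exact: eV.
move: (iter n bstep u) => w pw; split => //=.
case E: (bnext w) => [e|].
  by move: E; rewrite /bnext; case: pselect => // h [<-]; case: (cid h) => f [].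
split; last first.
  move=> m; have -> : iter m bstep w = w by elim: m => //= m ->; rewrite /bstep E.
  by [].
move=> [_ [e pe]]; move: E; rewrite /bnext; case: pselect => // -[]; by exists e.
Qed.
End BoundaryPoints.

Section Representation.
Variables (K : fieldType) (V Ed : choiceType) (s r : Ed -> V) (H S : V -> Prop).
Local Notation gen := ((V + Ed) + Ed)%type.
Local Notation freealg := {malg K[fmonom gen]}.
Local Notation A := (lpa_amb K s r).
Local Notation L := (@LPA K V Ed s r).
Local Notation Eg := (fullgraph s r).
Local Notation Q := (quotient_graph s r H S).
Local Notation X := (bpoint Q).
Hypothesis adm : admissible_pair (G := Eg) H S.
Implicit Types (x y : X) (g : X -> K) (a b : freealg) (o : option X).

(** A path is prolonged by e or by e' according to whether it starts at r(e) or at r(e)'; elsewhere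
    the edge acts as 0. *)
Definition lift_edge (e : Ed) x : option (Ed + Ed) :=
  match x.1 with
  | inl w => if w == r e then Some (inl e) else None
  | inr w => if w == r e then Some (inr e) else None end.

Definition act1 (h : gen) x : option X := match h with
  | inl (inl v) => if uv x.1 == v then Some x else None
  | inl (inr e) => omap (fun f : Ed + Ed => bcons (f : pE Q) x) (lift_edge e x)
  | inr e => if x.2 0 is Some f then (if ue f == e then Some (btail x) else None) else None
  end.

Definition actw (w : seq gen) x : option X :=
  foldr (fun h o => obind (act1 h) o) (Some x) w.

Lemma actw_cat w1 w2 x : actw (w1 ++ w2) x = obind (actw w1) (actw w2 x).
Proof.
rewrite /actw foldr_cat; elim: w1 => [|h w1 IH] /=; first by case: foldr.
by rewrite IH; case: (foldr _ (Some x) w2).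
Qed.

Lemma lift_edgeP e x f : lift_edge e x = Some f -> x.1 = prng (p := Q) f /\ ue f = e.
Proof.
by rewrite /lift_edge; case: x => -[w|w] q /=; case: eqP => // -> [<-].
Qed.

Lemma quotient_pein (f : pE Q) : pein f = pvin (prng f).
Proof. by case: f. Qed.

Lemma quotient_src (f : pE Q) : pein f -> pvin (psrc f).
Proof.
have [hH _ _] := adm; have h e : H (s e) -> H (r e).
  by move=> Hs; apply: (hH _ _ Hs); exists [:: e].
by case: f => e /= => [nr|[[_ _ nr _ _] _]] /h.
Qed.

Lemma act1_boundary h x y : boundary x -> act1 h x = Some y -> boundary y.
Proof.
move=> bx; case: h => [[v|e]|e] /=.
- by case: eqP => // _ [<-].
- case E: (lift_edge e x) => [f|] //= [<-]; have [xf _] := lift_edgeP E.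
  have pf : pein (f : pE Q) by rewrite quotient_pein -xf; case: (bx 0).
  by apply: boundary_cons => //; apply: quotient_src.
- case: (x.2 0) => // f; case: eqP => // _ [<-]; exact: boundary_tail.
Qed.

Lemma actw_boundary w x y : boundary x -> actw w x = Some y -> boundary y.
Proof.
move=> bx; elim: w y => [|h w IH] y /=; first by move=> [<-].
case E: (actw w x) => [z|] //=.
by apply: act1_boundary; apply: IH.
Qed.

Definition oext g o : K := if o is Some y then g y else 0.
(** Words act on points by partial maps, hence on functions by composition. This reverses the order
    and gives a right action, as in [evalfM]. *)
Definition evalf a g x : K := mmap (@idfun K) (fun m : fmonom gen => oext g (actw m x)) a.

Lemma evalfB a b g x : evalf (a - b) g x = evalf a g x - evalf b g x.
Proof. by rewrite /evalf raddfB. Qed.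

Lemma evalf_sum (T : Type) (l : seq T) (F : T -> freealg) g x :
  evalf (\sum_(t <- l) F t) g x = \sum_(t <- l) evalf (F t) g x.
Proof. by rewrite /evalf raddf_sum. Qed.

Lemma evalf0 g x : evalf 0 g x = 0. Proof. by rewrite /evalf raddf0. Qed.

Lemma evalfM a b g x : evalf (a * b) g x = evalf b (evalf a g) x.
Proof.
rewrite malgM_def fgmulr evalf_sum /evalf [RHS]mmapE; apply: eq_bigr => m _.
rewrite raddf_sum /=; case Em: (actw m x) => [y|] /=; last first.
  rewrite mulr0 big1 // => k _; rewrite mmapU fmM actw_cat Em /=.
  by rewrite mulr0.
rewrite mmapE mulr_sumr; apply: eq_bigr => k _.
by rewrite mmapU fmM actw_cat Em /= mulrA [_ * b@_m]mulrC.
Qed.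

Lemma evalf_gen h g x : evalf << fmu h >> g x = oext g (act1 h x).
Proof. by rewrite /evalf mmapU /= mul1r fmU. Qed.

Definition annih a := forall g x, boundary x -> evalf a g x = 0.

Lemma annihB a b : annih a -> annih b -> annih (a - b).
Proof. by move=> ha hb g x bx; rewrite evalfB ha // hb // subr0. Qed.

Lemma annihMl a b : annih b -> annih (a * b).
Proof. by move=> hb g x bx; rewrite evalfM hb. Qed.

Lemma annihMr a b : annih a -> annih (a * b).
Proof.
move=> ha g x bx; rewrite evalfM /evalf mmapE big1 // => m _ /=.
case E: (actw m x) => [y|] /=; rewrite ?mulr0 //.
by rewrite -/(evalf a g y) (ha _ _ (actw_boundary bx E)) mulr0.
Qed.

Lemma eval_edge_ghost e g x : boundary x ->
  evalf (ge K V e * gs K V e) g x =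
  if omap (fun f : Ed + Ed => ue f) (x.2 0) == Some e then g x else 0.
Proof.
move=> bx; rewrite evalfM /gs /ge evalf_gen /=.
case E: (x.2 0) => [f|] //=; case: (eqVneq (ue f) e) => [fe|fe]; last first.
  by rewrite (_ : Some (ue f) == Some e = (ue f == e)) // (negbTE fe).
rewrite fe eqxx /= evalf_gen /=.
have -> : lift_edge e (btail x) = Some f.
  by rewrite /lift_edge /btail E /= -fe; case: (f) => h /=; rewrite eqxx.
by rewrite /= (bcons_tail bx E).
Qed.

Lemma boundary_src x (f : Ed + Ed) : boundary x -> x.2 0 = Some f ->
  [/\ x.1 = inl (s (ue f)), ~ H (r (ue f)) & ~ H (s (ue f))].
Proof.
move=> bx xf; have [xv] := bx 0; rewrite /= xf => -[sf pf].
have pf' : ~ H (r (ue f)) by case: (f) pf => h //= [[]].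
split => //; first by rewrite -sf; case: (f).
by move: (quotient_src pf); case: (f).
Qed.

Lemma regular_quotient v (l : seq Ed) : (forall e, s e = v -> ~ H (r e) -> e \in l) ->
  (exists2 e, s e = v & ~ H (r e)) -> regular (G := Q) (inl v).
Proof.
move=> hl [e se ne]; split; last by exists (inl e) => /=; rewrite se.
exists (map inl l ++ map inr l) => -[f|f] /= pf [sf]; apply/InP; rewrite mem_cat.
  by apply/orP; left; apply: map_f; apply: hl.
by apply/orP; right; apply: map_f; apply: hl => //; case: pf => -[].
Qed.

(** Serves both the sum relation at regular vertices and the gaps of [S]. Over such a vertex every
    boundary path has a first edge, which is counted exactly once. *)
Lemma annih_ck2 v (l : seq Ed) : uniq l -> (forall e, e \in l -> s e = v) ->
  (forall e, s e = v -> ~ H (r e) -> e \in l) ->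
  (forall x, boundary x -> uv x.1 = v -> x.2 0 <> None) ->
  annih (gv K Ed v - \sum_(e <- l) ge K V e * gs K V e).
Proof.
move=> ul ls lH nsing g x bx; rewrite evalfB evalf_sum /gv evalf_gen /=.
rewrite (eq_bigr _ (fun e _ => eval_edge_ghost e g bx)).
case E: (x.2 0) => [f|] /=; last first.
  rewrite big1 // subr0; case: eqP => //= xv; by case: (nsing x bx xv).
have [xs nr ns] := boundary_src bx E; rewrite xs /=.
case: eqP => [sv|sv] /=.
  rewrite (bigD1_seq (ue f)) ?lH //= eqxx big1 ?addr0 ?subrr // => e ef.
  by rewrite (_ : Some (ue f) == Some e = (ue f == e)) // eq_sym (negbTE ef).
rewrite big_seq big1 ?subr0 // => e el.
rewrite (_ : Some (ue f) == Some e = (ue f == e)) //; case: eqP => // fe.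
by case: sv; rewrite fe ls.
Qed.

Lemma annih_rel a : leavitt_rel s r a -> annih a.
Proof.
have gE h g x : evalf << fmu h >> g x = oext g (act1 h x) := evalf_gen h g x.
case=> [[v [w ->]]|[[e ->]|[[e ->]|[[e ->]|[[e ->]|[[e [f ->]]|[v [l [ln ul hl ->]]]]]]]]].
- move=> g x bx; rewrite evalfB evalfM /gv gE /=.
  have [xw|xw] := eqVneq (uv x.1) w => /=.
    rewrite gE /= xw; case: (eqVneq v w) => [->|vw]; first by rewrite gE /= xw eqxx subrr.
    by rewrite /= evalf0 subr0.
  case: eqP => [->|_]; last by rewrite evalf0 subr0.
  by rewrite gE /= (negbTE xw) subr0.
- move=> g x bx; rewrite evalfB evalfM /gv /ge !gE /=.
  case E: (lift_edge e x) => [f|] /=; last by rewrite subr0.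
  have [_ fe] := lift_edgeP E; rewrite gE /=.
  have -> : uv (psrc (p := Q) f) = s e by rewrite -fe; case: (f).
  by rewrite eqxx subrr.
- move=> g x bx; rewrite evalfB evalfM /gv /ge !gE /=.
  case: (eqVneq (uv x.1) (r e)) => [xr|xr] /=; first by rewrite gE subrr.
  case E: (lift_edge e x) => [f|] /=; last by rewrite subr0.
  have [xf fe] := lift_edgeP E; case/eqP: xr; rewrite xf -fe.
  by case: (f).
- move=> g x bx; rewrite evalfB evalfM /gv /gs !gE /=.
  case E: (x.2 0) => [f|] /=; last by rewrite subr0.
  case: (eqVneq (ue f) e) => [fe|] /=; last by rewrite subr0.
  rewrite gE /= {1}/btail E /=.
  have -> : uv (prng (p := Q) f) = r e by rewrite -fe; case: (f).
  by rewrite eqxx subrr.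
- move=> g x bx; rewrite evalfB evalfM /gv /gs !gE /=.
  case: (eqVneq (uv x.1) (s e)) => [xr|xr] /=; first by rewrite gE subrr.
  case E: (x.2 0) => [f|] /=; last by rewrite subr0.
  case: (eqVneq (ue f) e) => [fe|] /=; last by rewrite subr0.
  have [xs _ _] := boundary_src bx E; case/eqP: xr; by rewrite xs /= fe.
- move=> g x bx; rewrite evalfB evalfM /gs /ge !gE /=.
  case E: (lift_edge f x) => [h|] /=; last first.
    rewrite sub0r; case: eqP => [ef|_]; last by rewrite evalf0 oppr0.
    rewrite /gv gE /=; case: eqP => [xr|_] /=; last by rewrite oppr0.
    by move: E xr; rewrite /lift_edge ef; case: (x.1) => w /= + wr; rewrite wr eqxx.
  have [xh hf] := lift_edgeP E; rewrite gE /= hf.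
  case: (eqVneq f e) => [fe|fe] /=; last by rewrite evalf0 subr0.
  rewrite -fe /gv gE /= btail_cons //.
  have -> : uv x.1 = r f by rewrite xh -hf; case: (h).
  by rewrite eqxx subrr.
apply: annih_ck2 => //.
- by move=> e /hl.
- by move=> e /hl.
(* A path of length zero would end at a vertex not regular in [Q]. But [v] emits finitely, so v'
   does not occur, and by saturation some edge from [v] ends outside [H], which makes [v] regular in
   [Q]. *)
move=> x bx xv xN; have [pv] := bx 0; rewrite /= xN => -[nreg _].
have finv : emits_finitely (G := Eg) v by exists l => e _ /= /hl /InP.
case Ex: (x.1) nreg pv xv => [w|w] /= nreg pv xv; last first.
  by case: pv => -[_ + _ _ _] _; rewrite xv.
rewrite xv in nreg pv; apply: nreg; apply: (@regular_quotient v l).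
  by move=> e /hl.
apply: contrapT => no; apply: pv; have [_ sat _] := adm.
apply: sat => //.
  split => //; case: (l) ln hl => // e l' _ hl; exists e; split => //=.
  by apply/hl; rewrite mem_head.
move=> e _ /= se; apply: contrapT => ne; apply: no; by exists e.
Qed.

Lemma annih_relideal a : relideal s r a -> annih a.
Proof.
move=> [l [hl ->]] g x bx; rewrite evalf_sum.
have h t : List.In t l -> evalf (t.1.1 * t.1.2 * t.2) g x = 0.
  by move=> /hl /annih_rel ht; apply: annihMr => //; apply: annihMl.
elim: l {hl} h => [|t l IH] h; first by rewrite big_nil.
rewrite big_cons [X in X + _](h t (or_introl erefl)) add0r.
by apply: IH => u ul; apply: h; right.
Qed.

(* Its quotient acts faithfully on the functions on boundary paths, where every vertex of [Q] is nonzero. *)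
Definition pair_ideal (a : A) : Prop := L a /\ exists2 f, a = lpi s r f & annih f.

Lemma pair_ideal_lpi f : pair_ideal (lpi s r f) -> annih f.
Proof.
move=> [_ [f' /eqP + hf']]; rewrite -subr_eq0 -raddfB => /eqP/lpi_eq0/annih_relideal h.
by move=> g x bx; have := h g x bx; rewrite evalfB (hf' g x bx) subr0.
Qed.

Lemma pair_ideal_ideal : is_ideal L (pair_ideal).
Proof.
have [L0 LB LM] := LPA_ideal K s r; split.
- by move=> a [].
- split => //; exists 0; first by rewrite (raddf0 (lpi s r)).
  by move=> g x _; rewrite evalf0.
- move=> a b [La [f Ea hf]] [Lb [f' Eb hf']]; split; first exact: LB.
  by exists (f - f'); [rewrite (raddfB (lpi s r)) Ea Eb|exact: annihB hf hf'].
- move=> c a _ [La [f Ea hf]]; have [h Eh] := lpi_surj c; split; split.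
  + exact: (LM c _ La).1.
  + by exists (h * f); [rewrite (rmorphM (lpi s r)) Ea Eh|exact: annihMl hf].
  + exact: (LM c _ La).2.
  + by exists (f * h); [rewrite (rmorphM (lpi s r)) Ea Eh|exact: annihMr hf].
Qed.

Lemma gap_lpi v : gap K s r H v =
  lpi s r (gv K Ed v - \sum_(e <- outs s r H v) ge K V e * gs K V e).
Proof.
rewrite raddfB raddf_sum; congr (_ - _); apply: eq_bigr => e _.
exact: esym (rmorphM (lpi s r) _ _).
Qed.

Lemma pair_ideal_vertex v : H v -> pair_ideal (av K s r v).
Proof.
move=> Hv; split; first exact: LPA_av.
exists (gv K Ed v) => // g x bx; rewrite /gv evalf_gen /=; case: eqP => //= xv.
have [+ _] := bx 0; move: xv; rewrite /=; case: (x.1) => w /= ->; first by case.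
by case=> -[_ _ []].
Qed.

Lemma pair_ideal_notin v : ~ H v -> ~ pair_ideal (av K s r v).
Proof.
move=> nH /pair_ideal_lpi /(_ (fun=> 1) (bpath (inl v : pV Q))).
rewrite /gv evalf_gen /= eqxx /= => h.
have /h/eqP : boundary (bpath (inl v : pV Q)) by apply: bpath_boundary => //; case.
by rewrite oner_eq0.
Qed.

Lemma LPA_gap v : L (gap K s r H v).
Proof.
have LS := LPA_SS K s r; apply: (idealB LS); first exact: LPA_av.
by apply: (ideal_sum LS) => e _; apply: (ideal_mull LS); [apply: LPA_ae|apply: LPA_as].
Qed.

Lemma pair_ideal_gap v : S v -> pair_ideal (gap K s r H v).
Proof.
move=> Sv; have [_ _ SB] := adm; have bv := SB _ Sv; have [_ ho] := outsP bv.
split; first exact: LPA_gap.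
eexists; first exact: gap_lpi.
apply: annih_ck2; [exact: outs_uniq|by move=> e /ho []|by move=> e se ne; apply/ho|].
move=> x bx xv xN; have [pv] := bx 0; rewrite /= xN => -[nreg _].
case Ex: (x.1) nreg pv xv => [w|w] /= nreg pv xv; last first.
  by case: pv => _; rewrite xv.
rewrite xv in nreg; apply: nreg; apply: (@regular_quotient v (outs s r H v)).
  by move=> e se ne; apply/ho.
by have [_ _ _ _ [e [_ se ne]]] := bv; exists e.
Qed.

Lemma pair_ideal_gap_notin v : @brk V Ed s r H S v -> ~ pair_ideal (gap K s r H v).
Proof.
move=> bv; rewrite gap_lpi => /pair_ideal_lpi.
pose x := bpath (inr v : pV Q).
have bx : boundary x by apply: bpath_boundary => //; case.
move=> /(_ (fun=> 1) x bx); rewrite evalfB evalf_sum /gv evalf_gen /= eqxx /=.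
rewrite big1; last first.
  move=> e _; rewrite eval_edge_ghost //.
  (* Edges of [Q] start at unprimed vertices, so the path at v' has no first edge: every e e^* kills
     it, while v fixes it. *)
  case E: (x.2 0) => [f|] //=; have [+ _ _] := boundary_src bx E.
  by [].
by rewrite subr0 => /eqP; rewrite oner_eq0.
Qed.
End Representation.

(** * Maximal tails and cycles without exits *)

Section Tails.
Variable G : pgraph.
Implicit Types (u v w : pV G) (e f : pE G) (c : seq (pE G)) (M : pV G -> Prop).

Definition on_cycle c u := exists2 f, List.In f c & psrc f = u.

Lemma path_mem u c w e : path_from u c w -> List.In e c ->
  [/\ pein e, reaches u (psrc e), reaches (psrc e) w &
      prng e = w \/ on_cycle c (prng e)].
Proof.
elim: c u => //= a c IH u [pa sa ac] [<-|ec].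
  split=> //; [by exists [::]|by exists (a :: c)|].
  case: (c) ac => [->|b c' [_ sb _]]; first by left.
  by right; exists b => //; right; left.
have [pe [p up] ew nx] := IH _ ac ec; split => //; first by exists (a :: p).
by case: nx => [->|[f fc sf]]; [left|right; exists f => //; right].
Qed.

Lemma cycle_reach c e f : is_cycle c -> List.In e c -> List.In f c ->
  reaches (psrc e) (psrc f).
Proof.
case=> e0 [c' [_ pc _]] /(path_mem pc) [_ _ h1 _] /(path_mem pc) [_ h2 _ _].
exact: reaches_trans h1 h2.
Qed.

Lemma cycle_next c e : is_cycle c -> List.In e c -> on_cycle c (prng e).
Proof.
case=> e0 [c' [Ec pc _]] /(path_mem pc) [_ _ _ [->|//]].
by exists e0 => //; rewrite Ec; left.
Qed.

Lemma exitless_mem c u e : cycle_without_exits c -> on_cycle c u ->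
  pein e -> psrc e = u -> List.In e c.
Proof.
move=> [cc nx] [f fc sf] pe se; apply: contrapT => nec; apply: (nx e).
by split => //; exists f; rewrite se sf.
Qed.

Lemma exitless_reach c u w : cycle_without_exits c -> on_cycle c u ->
  reaches u w -> on_cycle c w.
Proof.
move=> hc + [p]; elim: p u => [|e p IH] u /= uc; first by move=> <-.
move=> [pe se ep]; apply: (IH (prng e)) => //.
by apply: cycle_next; [case: hc|apply: exitless_mem hc uc pe se].
Qed.

(** A cycle without exits cannot be left, so [x] lies on both cycles; all of [c'] is reachable from
    [x], hence stays on [c]. *)
Lemma exitless_same c c' u w x : cycle_without_exits c -> cycle_without_exits c' ->
  on_cycle c u -> on_cycle c' w -> reaches u x -> reaches w x ->
  forall e, List.In e c' -> List.In e c.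
Proof.
move=> hc hc' uc wc ux wx e ec'.
have xc := exitless_reach hc uc ux; have [f fc' sf] := exitless_reach hc' wc wx.
have fe := cycle_reach hc'.1 fc' ec'; rewrite sf in fe.
have [e0 [c0 [_ pc _]]] := hc'.1; have [pe _ _ _] := path_mem pc ec'.
exact: (exitless_mem hc (exitless_reach hc xc fe) pe).
Qed.

Lemma at_most_n_exitless n (M : nat -> pV G -> Prop) :
  (forall e, pein e -> pvin (psrc e)) -> irredundant_mt_union n M ->
  at_most_n_exitless_cycles G n.
Proof.
move=> src [Mt Mcov _].
(* To each tail belong the edges of all exitless cycles meeting it; by (MT3) these cycles have the
   same edge set. *)
pose X i e := exists c, [/\ cycle_without_exits c, exists2 u, on_cycle c u & M i u &
  List.In e c].
exists (map X (iota 0 n)); split; first by rewrite size_map size_iota.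
move=> c hc; have [e0 [c0 [Ec pc _]]] := hc.1.
have e0c : List.In e0 c by rewrite Ec; left.
have [pe0 _ _ _] := path_mem pc e0c.
have [i ln Mi] := (Mcov _).1 (src _ pe0).
have uc : on_cycle c (psrc e0) by exists e0.
apply/List.Exists_exists; exists (X i); split.
  by apply/InP_map; exists i; split => //; apply/InP; rewrite mem_iota.
move=> e; split; last by move=> ec; exists c; split => //; exists (psrc e0).
case=> c' [hc' [w wc' Mw] ec']; have [_ _ _ _ mt3] := Mt _ ln.
have [x [_ ux wx]] := mt3 _ _ Mi Mw.
exact: (exitless_same hc hc' uc wc' ux wx ec').
Qed.

End Tails.

(** A member contained in the union of the others is dropped, which leaves the union unchanged;
    induction on the length. *)
Lemma irredundant_sublist (T : Type) (D : T -> Prop) (l : seq (T -> Prop)) :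
  (forall u, D u <-> exists2 X, List.In X l & X u) ->
  exists l', [/\ forall X, List.In X l' -> List.In X l,
    forall u, D u <-> exists2 i, (i < size l')%N & nth (fun=> False) l' i u &
    forall i, (i < size l')%N -> exists u, nth (fun=> False) l' i u /\
      forall j, (j < size l')%N -> j <> i -> ~ nth (fun=> False) l' j u].
Proof.
have [n] := ubnP (size l); elim: n l => // n IH l ln hl.
have cov u : D u <-> exists2 i, (i < size l)%N & nth (fun=> False) l i u.
  rewrite hl; split=> [[X Xl Xu]|[i il iu]].
    have [i [il Ei]] := List.In_nth l X (fun=> False) Xl.
    exists i; first by apply/ltP.
    have -> : forall (m : seq (T -> Prop)) k, nth (fun=> False) m k = List.nth k m (fun=> False).
      by elim=> [|a m IHm] [|k] //=.
    by rewrite Ei.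
  exists (nth (fun=> False) l i) => //; elim: (l) i il {iu} => // a m IHm [|i] /= il.
    by left.
  by right; apply: IHm.
have [irr|/existsNP [i /not_implyP [il no]]] := pselect (forall i, (i < size l)%N ->
    exists u, nth (fun=> False) l i u /\ forall j, (j < size l)%N -> j <> i ->
      ~ nth (fun=> False) l j u); first by exists l.
pose l1 := take i l ++ drop i.+1 l.
have sl1 : size l = (size l1).+1.
  by rewrite size_cat size_take size_drop il; lia.
have l1l X : List.In X l1 -> List.In X l.
  rewrite -(cat_take_drop i.+1 l) => /InP_cat [h|h]; apply/InP_cat; last by right.
  left; rewrite (take_nth (fun=> False) il) -cats1; apply/InP_cat; by left.
have [||l' [h1 h2 h3]] := IH l1.
- by rewrite -ltnS -sl1.
- move=> u; split; last by case=> X /l1l Xl Xu; apply/hl; exists X.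
  move=> Du; have [j [jl ju ji]] : exists j, [/\ (j < size l)%N, nth (fun=> False) l j u & j <> i].
    apply: contrapT => nj; apply: no; exists u.
    have hj j : (j < size l)%N -> nth (fun=> False) l j u -> j = i.
      by move=> jl ju; apply: contrapT => ji; apply: nj; exists j.
    have [j jl ju] := (cov u).1 Du; rewrite -{1}(hj _ jl ju); split => // k kl ki ku.
    by apply: ki; apply: hj.
  exists (nth (fun=> False) l j) => //; apply/InP_cat.
  case: (ltngtP j i) => [ji'|ji'|//].
    left; rewrite -(nth_take _ ji'); have : (j < size (take i l))%N by rewrite size_take il.
    elim: (take i l) (j) => // a m IHm [|k] /= km; first by left.
    by right; apply: IHm.
  right; rewrite -(subnKC ji') -nth_drop.
  have : (j - i.+1 < size (drop i.+1 l))%N by rewrite size_drop; lia.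
  elim: (drop i.+1 l) (j - i.+1)%N => // a m IHm [|k] /= km; first by left.
  by right; apply: IHm.
by exists l'; split => // X /h1 /l1l.
Qed.

Lemma flatten_iota_split (T : Type) (F : nat -> seq T) n i : (i < n)%N ->
  flatten (map F (iota 0 n)) =
  flatten (map F (iota 0 i)) ++ F i ++ flatten (map F (iota i.+1 (n - i.+1))).
Proof.
move=> ln; have {1}-> : n = (i + (n - i.+1).+1)%N by lia.
by rewrite iotaD map_cat flatten_cat.
Qed.

(** * Blocks of primes attached to maximal tails *)

Section Blocks.
Variables (K : fieldType) (B : pzRingType) (kap : {rmorphism K -> B}).
Hypothesis kapC : forall k x, kap k * x = x * kap k.
Variables (V E : choiceType) (vin : V -> Prop) (ein : E -> Prop).
Variables (s r : E -> V) (fv : V -> B) (fe fs : E -> B).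
Hypothesis LF : leavitt_family vin ein s r fv fe fs.
Let TF := lf_toeplitz LF.
Let G := PGraph vin ein s r.
Local Notation path := (@path_from G).
Local Notation lev := (lpeval kap vin ein s r fv fe).
Local Notation cyclic := (cyclic (G := G)).
Local Notation reaches := (reaches (G := G)).
Variable S : B -> Prop.
Hypothesis SS : is_ideal S S.
Hypothesis spanS : forall x, S x <-> spanned kap vin ein s r fv fe fs x.
Local Notation loop_prime := (loop_prime kap vin ein s r fv fe S).
Implicit Types (u v w : V) (p q : seq E) (f g h : {poly K}) (M : V -> Prop).

(** (MT1) holds because [P] is an ideal, (MT2) by the sum relation at a regular vertex, (MT3) by
    [prime_downward]. *)
Lemma prime_maximal_tail P : is_prime S P -> (exists u, ~ P (fv u)) ->
  maximal_tail (G := G) (fun u => ~ P (fv u)).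
Proof.
move=> pP [u0 nu0]; have hP := prime_ideal pP; split.
- by exists u0.
- by move=> v nv; apply/(lf_vin LF) => v0; apply: nv; rewrite v0; apply: (ideal0 hP).
- by move=> u v _ nv uv Pu; apply: nv; apply: (ideal_reach LF spanS hP uv Pu).
- move=> v nv [/emits_finitelyP [l ul hl] [e0 he0]]; apply: contrapT => no; apply: nv.
  rewrite (lf_ck2 LF ul _ hl); last by move=> l0; have := (hl e0).2 he0; rewrite l0.
  apply: (ideal_sum hP) => e /InP/hl [pe se].
  have Pe : P (fv (r e)) by apply: contrapT => ne; apply: no; exists e.
  have Se x : spanned kap vin ein s r fv fe fs x -> S x by move/spanS.
  rewrite -(tf_rs TF) mulrA.
  apply: (ideal_mulr hP); first exact: (Se _ (spanned_fs kap LF e)).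
  by apply: (ideal_mull hP) => //; apply: (Se _ (spanned_fe kap LF e)).
- move=> u v nu nv; have [z [? ? ?]] := prime_downward kapC LF SS spanS pP nu nv.
  by exists z.
Qed.

Definition loop_block v (gs : seq {poly K}) (b : seq (B -> Prop)) : Prop :=
  [/\ gs <> [::], b = map (loop_prime v) gs, lev v (\prod_(g <- gs) g) = 0 &
      forall f, lev v f = 0 -> \prod_(g <- gs) g %| f].

(** In a tail without cyclic vertex the reduction only ever yields vertices, so one prime avoiding
    the tail is enough; otherwise the primes come from the loop at one chosen cyclic vertex. *)
Definition tail_block M (b : seq (B -> Prop)) : Prop :=
  [/\ b <> [::], forall P, List.In P b -> is_prime S P,
      forall P u, List.In P b -> M u -> ~ P (fv u) &
      (exists v gs, [/\ M v, cyclic v & loop_block v gs b]) \/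
      (forall v, M v -> ~ cyclic v)].

Lemma tail_reach_cyclic M u v : maximal_tail (G := G) M -> M u -> M v -> cyclic v ->
  reaches u v.
Proof.
move=> [_ _ _ _ mt3] Mu Mv cv; have [z [_ uz vz]] := mt3 _ _ Mu Mv.
by have [_ zv] := cyclic_reach cv vz; apply: reaches_trans uz zv.
Qed.

(** Without a cyclic vertex, a prime is chosen maximal off the vertices of [M]: by (MT3) two ideals
    each containing a vertex of [M] share one, and so does their product. *)
Lemma exists_tail_block M : maximal_tail (G := G) M -> exists b, tail_block M b.
Proof.
move=> hM; have [[u0 Mu0] Mvin mt1 mt2 mt3] := hM.
have [[v [Mv cv]]|noc] := pselect (exists v, M v /\ cyclic v).
  have [gs [gN gp gd gz gall]] := loop_prime_factors kapC LF (Mvin _ Mv) cv.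
  exists (map (loop_prime v) gs); split.
  - by case: (gs) gN.
  - move=> P /InP_map [g [<- /InP gl]].
    by apply: (loop_prime_prime kapC LF SS spanS cv (gp _ gl)) => f; apply: gd.
  - move=> P u /InP_map [g [<- /InP gl]] Mu.
    apply: (loop_prime_reach kapC LF SS spanS cv (gp _ gl)); first by move=> f; apply: gd.
    exact: tail_reach_cyclic hM Mu Mv cv.
  - by left; exists v, gs.
have zI : is_ideal S (fun x => x = 0).
  split=> [x ->|//|x y -> ->|a x _ ->]; first exact: (ideal0 SS).
    by rewrite subr0.
  by rewrite mulr0 mul0r.
have [|||P [pP _ PM]] := exists_prime_avoiding SS (T := fun x => exists2 u, M u & x = fv u) zI.
- by exists (fv u0); [exists u0|apply: (S_fv LF spanS)].
- by move=> _ [u Mu ->]; apply/(lf_vin LF)/Mvin.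
- move=> X Y _ _ hX hY [u Mu ->] Xu [w Mw ->] Yw; have [z [Mz uz wz]] := mt3 _ _ Mu Mw.
  exists (fv z); first by exists z.
  rewrite -(fvv TF); apply: idprod_mul.
    exact: (ideal_reach LF spanS hX uz Xu).
  exact: (ideal_reach LF spanS hY wz Yw).
exists [:: P]; split => //; [by move=> _ [<-|[]]| |by right=> v Mv cv; apply: noc; exists v].
by move=> _ u [<-|[]] Mu; apply: PM; exists u.
Qed.

Lemma lev_rotate_neq0 v w p f : cyclic v -> path v p w -> lev v f <> 0 -> lev w f <> 0.
Proof.
move=> cv vp nz z; apply: nz.
rewrite -(lpeval_tgt kap vin ein TF v f) -(cyclic_pth_gst LF cv vp) mulrA.
by rewrite (lpeval_rotate kapC LF f cv vp) z mulr0 mul0r.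
Qed.

(** A nonzero [x] would reduce inside the product to a vertex or a loop polynomial at some [w] in a
    tail [M i]. The vertex is avoided by the primes of block [i]. The polynomial, carried to the
    base of the loop of [M i], becomes a multiple of the product of [gs] evaluated there, which is
    0. *)
Lemma blocks_product_zero n (M : nat -> V -> Prop) (F : nat -> seq (B -> Prop)) x :
  irredundant_mt_union (G := G) n M -> (forall i, (i < n)%N -> tail_block (M i) (F i)) ->
  idprodl S (flatten (map F (iota 0 n))) x -> x = 0.
Proof.
move=> [Mt Mcov _] hF lx; set l := flatten _ in lx.
have hl P : List.In P l -> is_ideal S P.
  have : forall m, (forall i, i \in m -> (i < n)%N) ->
      List.In P (flatten (map F m)) -> is_ideal S P.
    elim=> //= i m IH hm /InP_cat [|].
      by have [_ h _ _] := hF i (hm _ (mem_head _ _)); move=> /h /prime_ideal.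
    by apply: IH => j jm; apply: hm; rewrite inE jm orbT.
  by apply; move=> i; rewrite mem_iota.
have hI := idprodl_ideal SS hl; have Sx := ideal_sub hI lx.
apply: contrapT => /(reducible_spanned kapC LF ((spanS x).1 Sx)).
move=> [u [p [w [u' [q [up uq nz red]]]]]].
have ly : idprodl S l (gst fv fs u p * x * pth fv fe u' q).
  apply: (ideal_mulr hI); first exact: (S_pth LF spanS uq).
  by apply: (ideal_mull hI) => //; apply: (S_gst LF spanS up).
have pw : vin w.
  apply/(lf_vin LF) => w0; apply: nz.
  by rewrite -(pth_tgt TF uq) w0 !mulr0.
have [i ln Miw] := (Mcov w).1 pw; have [bN bp bM bc] := hF i ln.
have El := flatten_iota_split F ln; rewrite -/l in El; move: El.
set l1 := flatten _; set l2 := flatten _ => El.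
have sub : set_incl (idprodl S l) (idprodl S (F i)).
  rewrite El in hl *; move=> y /(idprodl_sub_catr SS hl); apply: (idprodl_sub_catl SS) => //.
  by move=> Q HQ; apply: hl; apply/InP_cat; right.
have hFi Q : List.In Q (F i) -> is_ideal S Q by move/bp/prime_ideal.
case: red => [[k kn Ey]|[cw [f Ey]]].
  rewrite Ey in ly; have fvl := ideal_fv kapC LF SS spanS hI kn ly.
  have [P Pb] : exists P, List.In P (F i) by case: (F i) bN => // P b _; exists P; left.
  apply: (bM P w Pb Miw); exact: (idprodl_sub_mem SS hFi Pb (sub _ fvl)).
case: bc => [[v [gs [Mv cv [gN Eb gz _]]]]|/(_ _ Miw)//].
have [t wt] := tail_reach_cyclic (Mt _ ln) Miw Mv cv.
rewrite Ey in nz ly; apply: (lev_rotate_neq0 cw wt nz).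
have lv : idprodl S (F i) (lev v f).
  apply: sub; rewrite -(lpeval_rotateK kapC LF f cw wt).
  apply: (ideal_mulr hI); first exact: (S_pth LF spanS wt).
  by apply: (ideal_mull hI) => //; apply: (S_gst LF spanS wt).
rewrite Eb in lv; have [b _] := product_loop_primes kapC LF SS spanS cv gN lv.
by rewrite (lpeval_fvl kapC LF f cv) gz mul0r.
Qed.
End Blocks.

(** * Conditions (2), (3) and (4) *)

Section Main.
Variables (K : fieldType) (V Ed : choiceType) (s r : Ed -> V).
Local Notation A := (lpa_amb K s r).
Local Notation L := (@LPA K V Ed s r).
Local Notation Eg := (fullgraph s r).
Local Notation Q := (quotient_graph s r).
Local Notation av := (@av K V Ed s r).
Let LS := LPA_SS K s r.

Lemma kernel_qpi I (hI : is_ideal L I) : kernel L (qpi (ideal_ts hI)) = I.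
Proof.
apply/funext => x; apply/propext; split; first by case=> _ /qpi_eq0.
by move=> Ix; split; [apply: (ideal_sub hI)|apply/qpi_eq0].
Qed.

(** The primes of a homomorphic image correspond to the primes of [L] over its kernel, and every
    ideal [I] is the kernel of the projection modulo [I]. *)
Lemma finite_minimal_quotients :
  (forall I : A -> Prop, proper_ideal_of L I -> ~ is_prime L I ->
     finite_family (min_prime_over L I)) <->
  (forall (B : pzRingType) (f : A -> B),
     ring_hom_on L f -> (exists2 x, L x & f x <> 0) ->
     prime_ring (image_of L f) \/ finite_family (minimal_prime (image_of L f))).
Proof.
split=> [c2 B f hf [x Lx fx]|c3 I [hI [x [Lx nIx]]] npI].
  have hk := kernel_ideal LS hf.
  have [pk|npk] := pselect (is_prime L (kernel L f)); first by left; apply/(kernel_prime LS hf).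
  right; apply/(finite_minimal_transfer LS hf); apply: c2 => //; split => //.
  by exists x; split => // -[].
have hf := qpi_hom (ideal_ts hI).
have [|pr|fm] := c3 _ _ hf.
- by exists x => // /qpi_eq0.
- by case: npI; rewrite -(kernel_qpi hI); apply/(kernel_prime LS hf).
by rewrite -(kernel_qpi hI); apply/(finite_minimal_transfer LS hf).
Qed.

Lemma quotient_tails (H S : V -> Prop) (adm : admissible_pair (G := Eg) H S) v0 :
  (forall I : A -> Prop, proper_ideal_of L I -> ~ is_prime L I ->
     finite_family (min_prime_over L I)) -> ~ H v0 ->
  exists n : nat, (0 < n)%N /\
    exists M : nat -> (V + V)%type -> Prop,
      irredundant_mt_union (G := Q H S) n M /\
      at_most_n_exitless_cycles (Q H S) n.
Proof.
move=> c2 nH0; pose hI := pair_ideal_ideal K adm.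
set I := pair_ideal H S in hI.
have LF := quotient_family adm (I := ideal_ts hI) (@pair_ideal_vertex K V Ed s r H S)
  (pair_ideal_gap K adm) (pair_ideal_notin adm) (pair_ideal_gap_notin adm).
have spanS := SB_spanned adm (I := ideal_ts hI) (@pair_ideal_vertex K V Ed s r H S)
  (pair_ideal_gap K adm) (pair_ideal_notin adm) (pair_ideal_gap_notin adm).
have hf := qpi_hom (ideal_ts hI).
have SS := SB_ideal (ideal_ts hI).
pose q := qv K s r H S.
have Lq u : L (q u) by apply: LPA_qv.
have qI u : pvin (p := Q H S) u -> ~ I (q u).
  by move=> /(lf_vin LF) nq /(qpi_eq0 (ideal_ts hI)).
have [lP [lPp lPI lPc]] : exists lP : seq (A -> Prop),
    [/\ forall P, List.In P lP -> is_prime L P, forall P, List.In P lP -> set_incl I P &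
        forall u, pvin (p := Q H S) u -> exists2 P, List.In P lP & ~ P (q u)].
  (* Condition (2) says nothing about a prime [I], but such an [I] is by itself the required
     list. *)
  have [pI|npI] := pselect (is_prime L I).
    exists [:: I]; split; [by move=> P [<-|[]]|by move=> P [<-|[]]|].
    by move=> u /qI nu; exists I => //; left.
  have [|l hl] := c2 I _ npI.
    by split => //; exists (av v0); split; [apply: LPA_av|apply: pair_ideal_notin].
  have mem P : List.In P [seq P <- l | `[< min_prime_over L I P >]] -> min_prime_over L I P.
    by elim: (l) => //= R l' IH; case: asboolP => // hR [<-|/IH].
  exists [seq P <- l | `[< min_prime_over L I P >]]; split.
  - by move=> P /mem [].
  - by move=> P /mem [].
  move=> u pu; have qq : q u * q u = q u by rewrite /q qvM eqxx.
  (* The element [q u] is idempotent, so a product of ideals containing it contains it again. *)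
  have [|||R [pR IR nR]] := exists_prime_avoiding LS (T := fun x => x = q u) hI.
  - by exists (q u).
  - by move=> _ ->; apply: qI.
  - move=> X Y _ _ _ _ -> Xu -> Yu; exists (q u) => //.
    by rewrite -qq; apply: idprod_mul.
  have [P mP PR] := exists_minimal_prime LS pR IR.
  exists P; last by move=> /PR; apply: nR.
  have /List.Exists_exists [R' [R'l PR']] := hl P mP.
  have E : P = R' by apply/funext => x; apply/propext; apply: PR'.
  rewrite -{}E in R'l; elim: (l) R'l => //= Z l' IH; case: asboolP => hZ [ZP|/IH] //.
  - by left.
  - by right.
  - by case: hZ; rewrite ZP.
(* The tail of [P] is read off in [L/I], where the elements [q u] form a Leavitt family of the
   quotient graph. *)
pose T (P : A -> Prop) (u : V + V) := ~ image_of P (qpi (ideal_ts hI)) (qpi (ideal_ts hI) (q u)).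
have TE P u : List.In P lP -> T P u <-> ~ P (q u).
  move=> Pl; have hP := prime_ideal (lPp _ Pl).
  have kP : set_incl (kernel L (qpi (ideal_ts hI))) P by rewrite kernel_qpi; apply: lPI.
  have h := preideal_image LS hf hP kP (q u); split=> [n Pq|n Pq].
    by apply: n; exists (q u).
  by apply: n; apply/h.
have Tmt P : List.In P lP -> (exists u, ~ P (q u)) -> maximal_tail (G := Q H S) (T P).
  move=> Pl [u nu].
  have kP : set_incl (kernel L (qpi (ideal_ts hI))) P by rewrite kernel_qpi; apply: lPI.
  have pP := image_prime LS hf (lPp _ Pl) kP.
  apply: (prime_maximal_tail (@kapB_central K V Ed s r (ideal_ts hI)) LF SS spanS pP).
  by exists u; apply/TE.
pose lT := map T [seq P <- lP | `[< exists u, ~ P (q u) >]].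
have memT X : List.In X lT -> exists P, [/\ X = T P, List.In P lP & exists u, ~ P (q u)].
  move=> /InP_map [P [<- hP]]; exists P; move: hP; elim: (lP) => //= R l' IH.
  by case: asboolP => [hR [<-|/IH []]|hR /IH []] //; split => //; [left|right|right].
have [|l' [h1 h2 h3]] := @irredundant_sublist _ (pvin (p := Q H S)) lT.
  move=> u; split.
    move=> /lPc [P Pl nP]; exists (T P); last by apply/TE.
    apply/InP_map; exists P; split => //; elim: (lP) Pl => //= R l' IH [->|/IH h].
      by rewrite (asboolT (ex_intro _ u nP)); left.
    by case: asboolP => // _; right.
  move=> [X /memT [P [-> Pl nP]] Tu].
  by have [_ h _ _ _] := Tmt P Pl nP; apply: h.
exists (size l'); split.
  have [i] := (h2 (inl v0)).1 nH0.
  by case: (size l').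
exists (nth (fun=> False) l').
have irr : irredundant_mt_union (G := Q H S) (size l') (nth (fun=> False) l').
  split => // i il.
  have /h1/memT [P [-> Pl nP]] : List.In (nth (fun=> False) l' i) l'.
    elim: (l') i il => //= X l1 IH [|i] /= il; first by left.
    by right; apply: IH.
  exact: Tmt.
split => //; apply: at_most_n_exitless irr.
by move=> e; apply: (quotient_src adm).
Qed.

(** * Proper ideals as products of primes *)

Section Factorization.
Variables (I : A -> Prop) (hI : is_ideal L I).
Local Notation H := (fun v => I (av v)).
Local Notation S := (fun v => breaking_vertex (G := Eg) H v /\ I (gap K s r H v)).
Local Notation QI := (Q H S).
Local Notation qv := (qv K s r H S).
Local Notation qe := (qe K s r H S).
Local Notation qs := (qs K s r H S).
Local Notation levA := (lpeval (kapA s r) (pvin (p := QI)) (pein (p := QI))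
  (psrc (p := QI)) (prng (p := QI)) qv qe).

Lemma two_sidedl a x : I x -> I (a * x). Proof. by case/(ideal_two_sided hI a). Qed.
Lemma two_sidedr a x : I x -> I (x * a). Proof. by case/(ideal_two_sided hI a). Qed.

Lemma ideal_admissible : admissible_pair (G := Eg) H S.
Proof.
split; last by move=> w [].
- move=> u v Hu [p]; elim: p u Hu => [|e p IH] u Hu /=; first by move=> <-.
  case=> _ se; apply: IH; rewrite -se in Hu.
  have := two_sidedl (as_ K s r e) (two_sidedr (ae K s r e) Hu).
  by rewrite av_ae as_ae eqxx.
move=> v _ [[l hl] [e0 [_ /= se0]]] he.
pose l1 := undup [seq e <- l | s e == v].
have l1P e : s e = v <-> e \in l1.
  rewrite mem_undup mem_filter; split; last by case/andP => /eqP.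
  by move=> se; rewrite se eqxx; apply/InP/hl.
rewrite (@av_ck2 K V Ed s r v l1 _ (undup_uniq _) l1P); last first.
  by apply/negP => /eqP l10; have := (l1P e0).1 se0; rewrite l10.
apply: (ideal_sum hI) => e /InP/l1P se.
by rewrite -ae_av; apply: two_sidedr; apply: two_sidedl; apply: he.
Qed.

Lemma proper_vertex : (exists x, L x /\ ~ I x) -> exists v, ~ H v.
Proof.
move=> [x [Lx nIx]]; apply: contrapT => no; apply: nIx.
have allH v : I (av v) by apply: contrapT => nv; apply: no; exists v.
move: x Lx; apply: LPA_ind.
- exact: (ideal0 hI).
- by move=> y z; apply: (idealD hI).
move=> k g w; apply: two_sidedl; apply: two_sidedr.
case: g => [[v|e]|e] /=; first exact: allH.
  by rewrite -av_ae; apply: two_sidedr; apply: allH.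
by rewrite -av_as; apply: two_sidedr; apply: allH.
Qed.

Let adm := ideal_admissible.

Lemma good_gap_notin v : @brk V Ed s r H S v -> ~ I (gap K s r H v).
Proof. by move=> [b nS] Ig; apply: nS. Qed.

Let famI := quotient_family adm (I := ideal_ts hI) (fun v h => h) (fun v h => proj2 h)
  (fun v h => h) good_gap_notin.
Let spanI := SB_spanned adm (I := ideal_ts hI) (fun v h => h) (fun v h => proj2 h)
  (fun v h => h) good_gap_notin.
Local Notation B := (qring (ideal_ts hI)).
Local Notation pi := (qpi (ideal_ts hI)).
Local Notation SB := (image_of L pi).
Local Notation lev := (lpeval (kapB (ideal_ts hI)) (pvin (p := QI)) (pein (p := QI))
  (psrc (p := QI)) (prng (p := QI)) (pi \o qv) (pi \o qe)).
Local Notation block := (tail_block (kapB (ideal_ts hI)) (pvin (p := QI)) (pein (p := QI))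
  (psrc (p := QI)) (prng (p := QI)) (pi \o qv) (pi \o qe) SB).
Local Notation lblock := (loop_block (kapB (ideal_ts hI)) (pvin (p := QI)) (pein (p := QI))
  (psrc (p := QI)) (prng (p := QI)) (pi \o qv) (pi \o qe) SB).
Local Notation lprime := (loop_prime (kapB (ideal_ts hI)) (pvin (p := QI)) (pein (p := QI))
  (psrc (p := QI)) (prng (p := QI)) (pi \o qv) (pi \o qe) SB).
Let SBI := SB_ideal (ideal_ts hI).
Let hpi := qpi_hom (ideal_ts hI).
Let kC := @kapB_central K V Ed s r (ideal_ts hI).
Let TA := q_toeplitz K adm.

Lemma pi_levA v f : pi (levA v f) = lev v f.
Proof. exact: map_lpeval. Qed.

Lemma LPA_levA v f : cyclic (G := QI) v -> L (levA v f).
Proof.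
move=> cv; rewrite -(lpeval_tgt (kapA s r) _ _ TA).
have Lv : L (qv v) by apply: LPA_qv.
by have [_ _ /(_ (levA v f) _ Lv) []] := LPA_ideal K s r.
Qed.

(** This is shown in [L] rather than in [L/I], because a product of preimages may be smaller than
    the preimage of the product. The extra factor [h] is absorbed by the first prime. *)
Lemma levA_mem_product v gs h : cyclic (G := QI) v -> gs <> [::] ->
  idprodl L (map (preideal L pi) (map (lprime v) gs)) (levA v (h * \prod_(g <- gs) g)).
Proof.
move=> cv; have vl := loop_path cv.
have one g h' : preideal L pi (lprime v g) (levA v (h' * g)).
  split; first exact: LPA_levA.
  rewrite pi_levA (lpevalM kC famI _ _ cv).
  apply: (ideal_mull (loop_prime_ideal _ _ _ SBI g cv)).
    exact: (S_lpeval kC famI SBI spanI h' cv).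
  exact: (loop_prime_lpeval kC famI SBI spanI g cv).
elim: gs h => // g [|g' gs] IH h _; first by rewrite big_seq1; apply: one.
rewrite big_cons mulrA (lpeval_mul (@kapA_central K V Ed s r) TA _ _ vl).
apply: (@idprodl_cons _ L (preideal L pi (lprime v g))
  (map (preideal L pi) (map (lprime v) (g' :: gs)))); [by []|exact: one|].
by rewrite -[X in levA v X]mul1r; apply: IH.
Qed.

Lemma product_of_primes : (exists x, L x /\ ~ I x) ->
  (forall H S : V -> Prop, admissible_pair (G := Eg) H S -> (exists v, ~ H v) ->
     exists n : nat, (0 < n)%N /\ exists M : nat -> (V + V)%type -> Prop,
       irredundant_mt_union (G := Q H S) n M /\ at_most_n_exitless_cycles (Q H S) n) ->
  exists l : seq (A -> Prop),
    [/\ l <> [::], List.Forall (is_prime L) l & seteq I (idprodl L l)].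
Proof.
move=> /proper_vertex nH c4; have [n [n0 [M [irr _]]]] := c4 _ _ adm nH.
have [Mt Mcov Mirr] := irr.
have /choice [F hF] : forall i, exists b, (i < n)%N -> block (M i) b.
  move=> i; have [ln|] := boolP (i < n)%N; last by exists [::].
  have [b hb] := exists_tail_block kC famI SBI spanI (Mt _ ln).
  by exists b.
pose l := flatten (map F (iota 0 n)); pose lA := map (preideal L pi) l.
have split_l i : (i < n)%N -> _ := @flatten_iota_split _ F n i.
have memF P (m : seq nat) : List.In P (flatten (map F m)) ->
    exists2 i, i \in m & List.In P (F i).
  elim: m => //= i m IH /InP_cat [h|/IH [j jm h]]; first by exists i; rewrite ?mem_head.
  by exists j; rewrite // inE jm orbT.
have lp P : List.In P l -> is_prime SB P.
  move=> /memF [i]; rewrite mem_iota => ln hP.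
  by have [_ h _ _] := hF i ln; apply: h.
have lAp P : List.In P lA -> is_prime L P.
  by move=> /InP_map [R [<- /lp]]; apply: preideal_prime.
have lAi P : List.In P lA -> is_ideal L P by move/lAp/prime_ideal.
have hlA := idprodl_ideal LS lAi.
have IlA P : List.In P lA -> set_incl I P.
  move=> /InP_map [R [<- /lp /prime_ideal hR]]; rewrite -{1}(kernel_qpi hI).
  exact: kernel_preideal.
exists lA; split.
- have := split_l 0 n0; rewrite -/l /lA => ->; rewrite /= !map_cat.
  by have [+ _ _ _] := hF 0 n0; case: (F 0).
- by apply/List.Forall_forall.
have lAI : set_incl (idprodl L lA) I.
  move=> x lx; apply/(qpi_eq0 (ideal_ts hI)).
  apply: (blocks_product_zero kC famI SBI spanI irr hF).
  by apply: (preideal_idprodl LS hpi) => // R /lp /prime_ideal.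
(* The loop polynomials are taken only at the base vertices chosen for the blocks, since their
   membership in the product is checked there; other cyclic vertices of the same tail are reached by
   rotation. *)
pose gen (x : A) := [\/ exists2 v, H v & x = av v, exists2 v, S v & x = gap K s r H v |
  exists i v gs f, [/\ (i < n)%N, M i v, cyclic (G := QI) v, lblock v gs (F i) &
                      I x /\ x = levA v f]].
have genI x : gen x -> I x.
  by case=> [[v Hv ->]|[v [_ Sv] ->]|[i [v [gs [f [_ _ _ _ []]]]]]].
pose J x := L x /\ forall Y, is_ideal L Y -> (forall g, gen g -> Y g) -> Y x.
have genJ x : gen x -> J x.
  by move=> gx; split; [apply: (ideal_sub hI); apply: genI|move=> Y _; apply].
have JI : set_incl J I by move=> x [_ /(_ I hI genI)].
have hJ : is_ideal L J.
  split.
  - by move=> x [].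
  - by split; [apply: (ideal0 LS)|move=> Y hY _; apply: (ideal0 hY)].
  - move=> x y [Lx Jx] [Ly Jy]; split; first exact: (idealB LS).
    by move=> Y hY gY; apply: (idealB hY); [apply: Jx|apply: Jy].
  - move=> a x La [Lx Jx]; split; split; [exact: (ideal_mull LS)| |exact: (ideal_mulr LS)|].
      by move=> Y hY gY; apply: (ideal_mull hY) => //; apply: Jx.
    by move=> Y hY gY; apply: (ideal_mulr hY) => //; apply: Jx.
have Lq u : L (qv u) by apply: LPA_qv.
have reach_M i u v : (i < n)%N -> M i u -> M i v -> cyclic (G := QI) v ->
    reaches (G := QI) u v.
  by move=> ln; apply: (tail_reach_cyclic (Mt _ ln)).
have gen_prod x : gen x -> idprodl L lA x.
  case=> [[v Hv ->]|[v [bv Sv] ->]|[i [v [gs [f [ln Mv cv lb [Ix Ex]]]]]]].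
  - by apply: idprodl_idem; rewrite ?avM ?eqxx //; [apply: LPA_av|move=> P /IlA; apply].
  - by apply: idprodl_idem; rewrite ?gapM //; [apply: LPA_gap|move=> P /IlA; apply].
  rewrite {x}Ex in Ix *; have vl := loop_path cv; have [gsN Fi gz gall] := lb.
  have El : lA = map (preideal L pi) (flatten (map F (iota 0 i))) ++
      map (preideal L pi) (F i) ++ map (preideal L pi) (flatten (map F (iota i.+1 (n - i.+1)))).
    by rewrite /lA /l (split_l i ln) !map_cat.
  (* If a prime of block [j] missed [v], then by [prime_downward] and cyclicity every vertex of
     [M j] would reach [v], so [M j] would lie inside [M i], against irredundancy. *)
  have out j : (j < n)%N -> j <> i -> forall P, List.In P (F j) -> preideal L pi P (qv v).
    move=> jn ji P Pj; split => //; apply: contrapT => nPv.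
    have [u [Mu nu]] := Mirr j jn; apply: (nu i ln); first exact: nesym.
    have [_ bp bM _] := hF j jn; have pP := bp _ Pj; have nPu := bM _ _ Pj Mu.
    have [z [uz vz _]] := prime_downward kC famI SBI spanI pP nPu nPv.
    have [_ zv] := cyclic_reach cv vz.
    have [_ Mvin mt1 _ _] := Mt _ ln; have [_ Mvj _ _ _] := Mt _ jn.
    by apply: (mt1 u v); [apply: Mvj|exact: Mv|apply: reaches_trans uz zv].
  rewrite El; apply: (idprodl_block LS (e := qv v)).
  - by rewrite -El.
  - by rewrite Fi; case: (gs) gsN.
  - by rewrite qvM eqxx.
  - exact: Lq.
  - exact: (lpeval_src (@kapA_central K V Ed s r) TA _ vl).
  - exact: (lpeval_tgt (kapA s r) _ _ TA).
  - move=> P /InP_cat [] /InP_map [R [<- /memF [j]]]; rewrite mem_iota => jn Rj;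
      apply: (out j) Rj; lia.
  rewrite Fi; have fz : lev v f = 0 by rewrite -pi_levA; apply/(qpi_eq0 (ideal_ts hI)).
  have [h ->] := dvdpP _ _ (gall _ fz).
  exact: levA_mem_product cv gsN.
move=> x; split; last exact: lAI.
move=> Ix; suff Jx : J x by case: Jx => _ /(_ _ hlA gen_prod).
apply: contrapT => nJx.
(* [J] contains the vertices of [H] and the gaps of [S], and it lies in [I], so no further vertex of
   the graph dies: [L/J] carries a Leavitt family of the same quotient graph as [L/I]. *)
have famJ := quotient_family adm (I := ideal_ts hJ)
  (fun v h => genJ _ (Or31 _ _ (ex_intro2 _ _ v h erefl)))
  (fun v h => genJ _ (Or32 _ _ (ex_intro2 _ _ v h erefl)))
  (fun v nH Jv => nH (JI _ Jv)) (fun v b Jv => good_gap_notin b (JI _ Jv)).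
have spanJ := SB_spanned adm (I := ideal_ts hJ)
  (fun v h => genJ _ (Or31 _ _ (ex_intro2 _ _ v h erefl)))
  (fun v h => genJ _ (Or32 _ _ (ex_intro2 _ _ v h erefl)))
  (fun v nH Jv => nH (JI _ Jv)) (fun v b Jv => good_gap_notin b (JI _ Jv)).
have kJ := @kapB_central K V Ed s r (ideal_ts hJ).
set pj := qpi (ideal_ts hJ) in famJ spanJ *.
have pj0 y : pj y = 0 <-> J y := qpi_eq0 (ideal_ts hJ) y.
have pjM a b : pj (a * b) = pj a * pj b := rmorphM pj a b.
have pjB a b : pj (a - b) = pj a - pj b := rmorphB pj a b.
have Sx : image_of L pj (pj x) by exists x => //; apply: (ideal_sub hI).
have nx : pj x <> 0 by move/pj0.
have [u [p [w [u' [q [up uq nz red]]]]]] := reducible_spanned kJ famJ ((spanJ _).1 Sx) nx.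
pose y := gst qv qs u p * x * pth qv qe u' q.
have Iy : I y by apply: two_sidedr; apply: two_sidedl.
have Ey : gst (pj \o qv) (pj \o qs) u p * pj x * pth (pj \o qv) (pj \o qe) u' q = pj y.
  by rewrite -(map_gst pj) -(map_pth pj) -!pjM.
rewrite {}Ey in nz red.
have pw : pvin (p := QI) w.
  apply/(lf_vin famJ) => w0; apply: nz.
  by rewrite /y -(pth_tgt TA uq) !mulrA pjM [X in _ * X]w0 mulr0.
case: red => [[k kn Ek]|[cw [f Ef]]].
  (* Modulo [J] the element [y] of [I] is a nonzero multiple of the vertex [w]. As [J] is inside
     [I], this multiple lies in [I], whereas [w] survives in [L/I]. *)
  apply: (kap_fv_neq0 (kap := kapB (ideal_ts hI)) famI pw kn).
  rewrite -[LHS]/(pi (kapA s r k) * pi (qv w)) -(rmorphM pi); apply/(qpi_eq0 (ideal_ts hI)).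
  apply: (idealBl hI _ Iy); apply: JI; apply/pj0.
  by rewrite pjB Ek pjM subrr.
have [i ln Mw] := (Mcov w).1 pw; have [_ _ _ bc] := hF i ln.
case: bc => [[v [gs [Mv cv lb]]]|/(_ _ Mw)//].
have [t wt] := reach_M i w v ln Mw Mv cv.
(* Rotation carries the polynomial from [w] to the chosen base vertex [v]. Its value there lies in
   [I], so it is one of the generators of [J] and vanishes in [L/J]. *)
rewrite Ef in nz; apply: (lev_rotate_neq0 kJ famJ cw wt nz).
rewrite -(lpeval_rotateK kJ famJ f cw wt) -Ef.
pose z := gst qv qs w t * y * pth qv qe w t.
have Ez : gst (pj \o qv) (pj \o qs) w t * pj y * pth (pj \o qv) (pj \o qe) w t = pj z.
  by rewrite -(map_gst pj) -(map_pth pj) -!pjM.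
have Iz : I z by apply: two_sidedr; apply: two_sidedl.
have Ezl : pj z = pj (levA v f).
  by rewrite -Ez Ef (lpeval_rotateK kJ famJ f cw wt); apply/esym/map_lpeval.
rewrite Ez Ezl; apply/pj0; apply: genJ; apply: Or33.
exists i, v, gs, f; split => //; split => //.
by apply: (idealBl hI _ Iz); apply: JI; apply/pj0; rewrite pjB Ezl subrr.
Qed.
End Factorization.
End Main.

Theorem theorem4p6 (K : fieldType) (V Ed : choiceType) (s r : Ed -> V)
  (nonempty_vertices : exists v : V, True) :
  let A := lpa_amb K s r in          (* ambient ring F / J *)
  let L := @LPA K V Ed s r in             (* L = L_K(E), a subring of A *)
  let E := fullgraph s r in
  (* (1) every proper ideal of L is a product of finitely many primes *)
  let c1 := forall I : A -> Prop, proper_ideal_of L I ->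
              exists l : seq (A -> Prop),
                [/\ l <> [::], List.Forall (is_prime L) l & seteq I (idprodl L l)] in
  (* (2) finitely many primes minimal over any proper non-prime ideal *)
  let c2 := forall I : A -> Prop, proper_ideal_of L I -> ~ is_prime L I ->
              finite_family (min_prime_over L I) in
  (* (3) every proper (= nonzero) homomorphic image of L is a prime ring or
         has only finitely many minimal prime ideals *)
  let c3 := forall (B : pzRingType) (f : A -> B),
              ring_hom_on L f -> (exists2 x, L x & (f x <> 0)%R) ->
              prime_ring (image_of L f) \/
              finite_family (minimal_prime (image_of L f)) in
  (* (4) graph condition *)
  let c4 := forall H S : V -> Prop,
              admissible_pair (G := E) H S -> (exists v, ~ H v) ->
              exists n : nat, (0 < n)%N /\
                exists M : nat -> (V + V)%type -> Prop,
                  irredundant_mt_union (G := quotient_graph s r H S) n M /\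
                  at_most_n_exitless_cycles (quotient_graph s r H S) n in
  [/\ c1 <-> c2, c2 <-> c3 & c3 <-> c4].
Proof.
move=> A L E c1 c2 c3 c4.
have LS := LPA_SS K s r.
have h12 : c1 -> c2.
  move=> h I pI _; have [l [lN lp Il]] := h I pI.
  exact: (finitely_many_minimal_of_product LS pI.1 lN lp Il).
have h23 : c2 <-> c3 by apply: finite_minimal_quotients.
have h24 : c2 -> c4.
  by move=> h H S adm [v nH]; apply: (quotient_tails adm h nH).
have h41 : c4 -> c1.
  by move=> h I [hI pI]; apply: (product_of_primes hI pI h).
by split; split; tauto.
Qed.
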